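(* Let $D$ and $r$ be positive integers with $D \geq 2$. There exists a rooted tree $U_r^D$ such that every $D$-distinguishable tree $T$ having radius at most $r$ and satisfying $\rho^D(T) = F(T)$ is isomorphic to a branched subgraph of $U_r^D$. Further, if $r \geq 2$, this tree $U_r^D$ has the property that every branched subgraph $T$ of $U_r^D$ having radius $r$ is $D$-distinguishable and satisfies $\rho^D(T) = F(T)$.
   Context: Graphs are finite and simple; a tree is a connected graph without cycles. The eccentricity of a vertex $v$ in a connected graph $G$ is $\max_{w \in V(G)} \mathrm{dist}(v,w)$, and the radius of $G$ is the minimum eccentricity of a vertex of $G$. A distinguishing $t$-coloring of a graph $G$ is a (not necessarily proper) vertex coloring using at most $t$ colors such that the only automorphism of $G$ preserving the color of every vertex is the identity; $G$ is $t$-distinguishable if it has a distinguishing $t$-coloring, and the distinguishing number $D(G)$ is the least $t$ for which $G$ is $t$-distinguishable. A fixing set of $G$ is a set $S \subseteq V(G)$ such that the only automorphism of $G$ fixing every vertex of $S$ is the identity, and the fixing number $F(G)$ is the minimum cardinality of a fixing set. For $t \geq D(G)$, the $t$-paint cost $\rho^t(G)$ of a graph $G$ on $n$ vertices is the minimum, over all distinguishing $t$-colorings $c$ of $G$, of $n - |C|$, where $C$ is a largest color class of $c$. Automorphisms of (and isomorphisms between) trees are those of the underlying unrooted graphs. Let $T$ be a rooted tree with root $x$. The branches of $T$ are the maximal subtrees of $T$ that contain $x$ as a leaf (one for each neighbor of $x$). A branched subgraph of $T$ is any union of a nonempty collection of branches of $T$, or the one-vertex subtree consisting only of $x$. *)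

(* Defs.v *)
From HB Require Import structures.
From mathcomp Require Import all_boot all_fingroup.

Set Implicit Arguments.
Unset Strict Implicit.
Unset Printing Implicit Defensive.

Record sgraph := SGraph {
  vertex :> finType;
  edge : rel vertex;
  edge_sym : symmetric edge;
  edge_irrefl : irreflexive edge }.

Definition graph_iso (G H : sgraph) : Prop :=
  exists f : G -> H, bijective f /\ forall u v, edge (f u) (f v) = edge u v.

Definition connected (G : sgraph) : Prop :=
  0 < #|G| /\ forall u v : G, connect (@edge G) u v.

(* [ucycle] accepts lists of length at most 2 (an edge traversed back and
   forth, or the empty list); these are not cycles of a simple graph. *)
Definition acyclic (G : sgraph) : Prop :=
  forall p : seq G, 2 < size p -> ~ ucycle (@edge G) p.

Definition is_tree (G : sgraph) : Prop := connected G /\ acyclic G.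

Definition leaf (G : sgraph) (v : G) : bool := #|[set w | edge v w]| == 1.

(* Length of a shortest walk; the default value [#|G|] is only taken when
   there is no walk at all, hence never in a connected graph. *)
Definition dist (G : sgraph) (u v : G) : nat :=
  \big[minn/#|G|]_(n < #|G| |
      [exists p : n.-tuple G, path (@edge G) u p && (last u p == v)]) n.

Definition eccentricity (G : sgraph) (v : G) : nat := \max_(w : G) dist v w.

(* In a connected (nonempty) graph every eccentricity is below the default
   value [#|G|]. *)
Definition radius (G : sgraph) : nat :=
  \big[minn/#|G|]_(v : G) eccentricity v.

Definition automorphism (G : sgraph) (s : {perm G}) : bool :=
  [forall u, forall v, edge (s u) (s v) == edge u v].

Definition distinguishing (G : sgraph) (t : nat) (c : {ffun G -> 'I_t}) : bool :=
  [forall s : {perm G},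
     automorphism s && [forall v, c (s v) == c v] ==> (s == 1%g)].

Definition distinguishable (t : nat) (G : sgraph) : Prop :=
  exists c : {ffun G -> 'I_t}, distinguishing c.

Definition fixing_set (G : sgraph) (S : {set G}) : bool :=
  [forall s : {perm G},
     automorphism s && [forall v in S, s v == v] ==> (s == 1%g)].

(* The default value [#|G|] is harmless: [setT] is a fixing set. *)
Definition fixing_number (G : sgraph) : nat :=
  \big[minn/#|G|]_(S : {set G} | fixing_set S) #|S|.

(* Meaningful only when [G] is [t]-distinguishable, i.e. when the minimum is
   over a nonempty family; each term is at most the default value [#|G|]. *)
Definition paint_cost (t : nat) (G : sgraph) : nat :=
  \big[minn/#|G|]_(c : {ffun G -> 'I_t} | distinguishing c)
     (#|G| - \max_(i < t) #|[set v | c v == i]|).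

Section Induced.
Variables (G : sgraph) (S : {set G}).

Definition induced_edge : rel {v : G | v \in S} :=
  fun u v => edge (val u) (val v).

Lemma induced_edge_sym : symmetric induced_edge.
Proof. by move=> u v; apply: edge_sym. Qed.

Lemma induced_edge_irrefl : irreflexive induced_edge.
Proof. by move=> u; apply: edge_irrefl. Qed.

Definition induced : sgraph := SGraph induced_edge_sym induced_edge_irrefl.

End Induced.

(* Every connected subgraph of a tree is induced, so subtrees of a tree [U],
   and unions of branches of [U], are represented by their vertex sets. *)
Definition subtree_with_leaf (U : sgraph) (x : U) (S : {set U}) : Prop :=
  is_tree (induced S) /\ exists y : induced S, val y = x /\ leaf y.

Definition is_branch (U : sgraph) (x : U) (B : {set U}) : Prop :=
  subtree_with_leaf x B /\
  forall S : {set U}, subtree_with_leaf x S -> B \subset S -> S = B.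

Definition branched_subgraph (U : sgraph) (x : U) (S : {set U}) : Prop :=
  S = [set x] \/
  exists P : {set {set U}},
    [/\ P != set0, forall B, B \in P -> is_branch x B & S = cover P].

(* Main.v *)
Require Import Defs.
From Stdlib Require Import Classical_Prop.
From HB Require Import structures.
From mathcomp Require Import all_boot all_fingroup zify.

Set Implicit Arguments.
Unset Strict Implicit.
Unset Printing Implicit Defensive.

(** Call a graph good when it has a distinguishing colouring with [D] colours and a
    colour class whose complement is a fixing set of minimum size. This means that the
    graph is [D]-distinguishable and that its paint cost is its fixing number
    ([goodP]).

    In a tree with a distinguishing colouring, the branches that hang from a vertex
    are pairwise non-isomorphic as coloured rooted trees. Hence a [D]-distinguishable
    tree of radius at most [r] has boundedly many vertices ([card_tree]), and there
    are finitely many good trees of radius at most [r]. The tree [U] is obtained by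
    gluing all of them at a common vertex, the hub, each tree [T] being glued at one
    of its vertices [v]; the leaves of [T] at [v] are represented by [D] pendant
    vertices of the hub shared by all trees ([glue], [piece_represented]). It remains
    to choose [v] so that a union of branches of radius exactly [r] is good
    ([root_choice], [closed_good]).

    - If the radius of [T] is below [r], take for [v] a center. Pieces of such trees
      only form unions of radius below [r].
    - If [T] has radius [r] and diameter [2 * r], take for [v] an end of a longest path.
      Adding any other branch makes the radius exceed [r].
    - If [T] has radius [r] and diameter [2 * r - 1], take for [v] again an end of a
      longest path. Adding a branch of depth 2 makes the radius exceed [r], so that
      only the trees [ext v j], which are [T] with [j <= D] new leaves at [v], are to be
      good. This depends on the end that is taken.

    Gluing all trees at a center would not do. For [D = 2] and [r = 2], the union of
    two pendant vertices with a branch of three vertices in which the hub is adjacent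
    to a vertex with two leaves would be the tree with two adjacent vertices bearing
    two leaves each; it has fixing number 2, but the colourings of cost 2 that fix each
    half are preserved by an exchange of the halves.

    The choice of the end in the third case is made in [bicentral_root]. An exchange
    argument shows that, for each end [v], the tree has a colouring that is optimal
    among those only required to exclude the automorphisms fixing [v]
    ([pinned_coloring]). With distinct colours on the new leaves it becomes an optimal
    colouring of [ext v j] for the automorphisms fixing [v] ([ext_coloring]). The other
    automorphisms, the flips, exchange the new leaves with the ends opposite to [v]. If
    flips move a set of twin leaves of size between 2 and [D - 1], changing one colour in
    this set makes the colouring distinguishing ([bundle_good]). There remains the case
    where flips exist at both ends [v] and [w] of a longest path, with [j] equal to 1 or
    [D]. The flips are then reflections about two adjacent vertices, and [T] has so much
    symmetry that its vertices are determined by their distances to [v] and [w], apart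
    from twin leaves at both ends ([coord_inj]). If [j = 1] at one of the ends, then this
    end is a suitable choice ([single_far_good]). If [j = D] at both ends, every
    candidate for an optimal colouring of [T] is preserved by the reflection that
    exchanges [v] and [w], so that [T] is not good ([full_ends_not_good]). *)

(** * Walks and distances *)

Section BigMin.
Variables (I : finType) (P : pred I) (F : I -> nat) (d : nat).

Lemma bigminn_le_default : \big[minn/d]_(i | P i) F i <= d.
Proof.
elim/big_rec: _ => // i m _ le_m.
by rewrite geq_min le_m orbT.
Qed.

Lemma bigminn_le i : P i -> \big[minn/d]_(j | P j) F j <= F i.
Proof.
move=> Pi; have: i \in index_enum I by rewrite mem_index_enum.
elim: (index_enum I) => // a s IHs; rewrite inE big_cons => /orP[/eqP <-|/IHs le_s].
  by rewrite Pi geq_minl.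
by case: ifP => // _; rewrite geq_min le_s orbT.
Qed.

Lemma bigminn_attained :
  \big[minn/d]_(i | P i) F i = d \/
  exists2 i, P i & \big[minn/d]_(i | P i) F i = F i.
Proof.
elim/big_rec: _ => [|i m Pi IHm]; first by left.
rewrite /minn; case: ltnP => _; last by [].
by right; exists i.
Qed.

End BigMin.

Section Walks.
Variable G : sgraph.
Implicit Types (u v w : G) (p : seq G).

Lemma connect_ind (e : rel G) (Q : G -> Prop) u v :
  (forall a b, Q a -> e a b -> Q b) -> Q u -> connect e u v -> Q v.
Proof.
move=> closedQ Qu /connectP[p].
elim: p u Qu => [|w p IHp] u Qu /=; first by move=> _ ->.
by case/andP=> uw wp eq_v; apply: IHp (closedQ _ _ Qu uw) wp eq_v.
Qed.

Lemma dist_le_walk u p : path (@edge G) u p -> dist u (last u p) <= size p.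
Proof.
move=> walk_p; case: (ltnP (size p) #|G|) => [lt_p|].
  apply: (@bigminn_le _ _ _ _ (Ordinal lt_p)).
  by apply/existsP; exists (in_tuple p); rewrite /= walk_p eqxx.
exact/leq_trans/bigminn_le_default.
Qed.

Hypothesis connG : connected G.

Lemma dist_walk u v :
  exists p, [/\ path (@edge G) u p, last u p = v & size p = dist u v].
Proof.
have: dist u v < #|G|.
  have /connectP[p0 walk_p0 ->] := connG.2 u v.
  case/shortenP: walk_p0 => p walk_p uniq_p _.
  apply: leq_ltn_trans (dist_le_walk walk_p) _.
  by rewrite -[_.+1]/(size (u :: p)) -(card_uniqP uniq_p) max_card.
rewrite /dist.
have := bigminn_attained (fun n : 'I_#|G| =>
  [exists p : n.-tuple G, path (@edge G) u p && (last u p == v)])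
  (@nat_of_ord _) #|G|.
case=> [->|]; first by rewrite ltnn.
case=> n /existsP[p /andP[walk_p /eqP last_p]] -> _.
by exists p; rewrite size_tuple.
Qed.

(** Lower bounds on distances are obtained from functions on the vertices that
    grow by at most one along each edge. *)
Lemma dist_lipschitz (phi : G -> nat) :
  (forall a b, edge a b -> phi b <= (phi a).+1) ->
  forall u v, phi v <= phi u + dist u v.
Proof.
move=> lip u v; have [p [walk_p <- <-]] := dist_walk u v.
elim: p u walk_p => [|w p IHp] u /=; first by rewrite addn0.
case/andP=> uw /IHp le_w; apply: leq_trans le_w _.
by rewrite addnS -addSn leq_add2r lip.
Qed.

Lemma distxx u : dist u u = 0.
Proof. by apply/eqP; rewrite -leqn0 (@dist_le_walk u [::]). Qed.

Lemma dist_eq0 u v : (dist u v == 0) = (u == v).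
Proof.
apply/eqP/eqP=> [d0|->]; last exact: distxx.
have [p [_ last_p]] := dist_walk u v.
by rewrite d0 => /size0nil p0; rewrite -last_p p0.
Qed.

Lemma dist_triangle u v w : dist u w <= dist u v + dist v w.
Proof.
have [p [walk_p <- <-]] := dist_walk u v.
have [q [walk_q <- <-]] := dist_walk (last u p) w.
rewrite -last_cat -size_cat; apply: dist_le_walk.
by rewrite cat_path walk_p.
Qed.

Lemma dist_edge u v : edge u v -> dist u v = 1.
Proof.
move=> uv; apply/eqP; rewrite eqn_leq (@dist_le_walk u [:: v]) /= ?uv //.
by rewrite lt0n dist_eq0; apply: contraTneq uv => ->; rewrite edge_irrefl.
Qed.

Lemma dist_sym u v : dist u v = dist v u.
Proof.
suff le_d (a b : G) : dist a b <= dist b a by apply/eqP; rewrite eqn_leq !le_d.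
have := @dist_lipschitz (fun t => dist t b) _ b a.
rewrite distxx; apply=> s t st; rewrite -add1n -(@dist_edge t s).
  exact: dist_triangle.
by rewrite edge_sym.
Qed.

Lemma dist1_edge u v : dist u v = 1 -> edge u v.
Proof.
have [p [walk_p <- <-]] := dist_walk u v.
by case: p walk_p => [|a [|b p]] /=; rewrite ?andbT.
Qed.

Lemma dist_step u v : u != v ->
  exists2 w, edge u w & dist u v = (dist w v).+1.
Proof.
move=> neq_uv; have [p [walk_p last_p size_p]] := dist_walk u v.
case: p walk_p last_p size_p => [_ /= eq_uv|w p /= /andP[uw walk_p] last_p size_p].
  by rewrite eq_uv eqxx in neq_uv.
exists w => //; apply/eqP; rewrite eqn_leq -{1}add1n -{1}(dist_edge uw) dist_triangle /=.
by rewrite -size_p ltnS -last_p dist_le_walk.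
Qed.

Lemma dist_le_ecc u v : dist u v <= eccentricity u.
Proof. exact: (leq_bigmax (F := fun w => dist u w)). Qed.

Lemma ecc_leP u n : reflect (forall w, dist u w <= n) (eccentricity u <= n).
Proof.
by apply: (iffP (bigmax_leqP _ _ _)) => le_n w; [apply: le_n | move=> _].
Qed.

Lemma ecc_attained u : exists w, dist u w = eccentricity u.
Proof.
have [w e_w] := eq_bigmax (fun w => dist u w) (proj1 connG).
by exists w; rewrite -e_w.
Qed.

Lemma radius_attained : exists v, eccentricity v = radius G.
Proof.
have ltG u : eccentricity u < #|G|.
  rewrite -(prednK connG.1) ltnS; apply/ecc_leP => w.
  have /connectP[p0 walk_p0 ->] := connG.2 u w.
  case/shortenP: walk_p0 => p walk_p uniq_p _.
  apply: leq_trans (dist_le_walk walk_p) _.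
  by rewrite -ltnS prednK ?connG.1 // -[_.+1]/(size (u :: p)) -(card_uniqP uniq_p) max_card.
rewrite /radius; case: (bigminn_attained predT (@eccentricity G) #|G|); last first.
  by case=> v _ ->; exists v.
move=> e_rad.
have /card_gt0P[v _] := connG.1.
have := @bigminn_le _ predT (@eccentricity G) #|G| v isT.
by rewrite e_rad leqNgt ltG.
Qed.

Lemma radius_le_ecc v : radius G <= eccentricity v.
Proof. exact: bigminn_le. Qed.

Lemma dist_le_radius u v : dist u v <= (radius G).*2.
Proof.
have [c e_c] := radius_attained; rewrite -e_c -addnn.
apply: leq_trans (dist_triangle u c v) _.
by rewrite leq_add ?dist_le_ecc // dist_sym dist_le_ecc.
Qed.

End Walks.

(** * Branches of a tree *)

Section Components.
Variable G : sgraph.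
Implicit Types (p z t u v w : G).

Definition avoid p : rel G := fun a b => [&& edge a b, a != p & b != p].

(** In a tree, for adjacent [p] and [z], this is the part of the tree that hangs
    from [p] through [z]. Speaking of components instead of descendants makes it
    independent of any choice of a root. *)
Definition branch p z : {set G} := [set t | connect (avoid p) z t].

Lemma avoid_connect_sym p : connect_sym (avoid p).
Proof. by apply: sym_connect_sym => a b; rewrite /avoid edge_sym [(a != p) && _]andbC. Qed.

Lemma branch_self p z : z \in branch p z.
Proof. by rewrite inE connect0. Qed.

Lemma branch_neq p z t : edge p z -> t \in branch p z -> t != p.
Proof.
move=> pz; rewrite inE; apply: (connect_ind (Q := fun t => t != p)) => [a b _ /and3P[]//|].
by apply: contraTneq pz => ->; rewrite edge_irrefl.
Qed.

Lemma branch_closed p z a b :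
  edge p z -> a \in branch p z -> edge a b -> b != p -> b \in branch p z.
Proof.
move=> pz a_in ab b_neq; have a_neq := branch_neq pz a_in; move: a_in.
rewrite !inE => z_a; apply: connect_trans z_a (connect1 _).
by rewrite /avoid ab a_neq.
Qed.

Section Acyclic.
Hypothesis acycG : acyclic G.

(** A path from [z] to [z'] avoiding [p] would be closed into a cycle by [p]. *)
Lemma branch_inj p z z' t :
  edge p z -> edge p z' -> t \in branch p z -> t \in branch p z' -> z = z'.
Proof.
move=> pz pz'; rewrite !inE => zt z't.
have: connect (avoid p) z z' by apply: connect_trans zt _; rewrite avoid_connect_sym.
case/connectP=> q0 walk_q0 eq_z'; move: walk_q0 eq_z' => /shortenP[q walk_q uniq_q _] eq_z'.
apply/eqP; apply: contraT => neq_zz'; case: (acycG (p := [:: p, z & q])).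
  by case: q eq_z' {walk_q uniq_q} => //= z'z; rewrite z'z eqxx in neq_zz'.
have neq_pz : z != p by apply: contraTneq pz => ->; rewrite edge_irrefl.
apply/andP; split.
  rewrite /= pz rcons_path -eq_z' edge_sym pz' andbT.
  by apply: sub_path walk_q => a b /and3P[].
rewrite cons_uniq uniq_q andbT inE negb_or eq_sym neq_pz /=.
elim: q z neq_pz walk_q {uniq_q neq_zz' pz zt eq_z'} => //= a q IHq z neq_pz.
case/andP=> /and3P[_ _ neq_pa] /(IHq _ neq_pa).
by rewrite inE negb_or eq_sym neq_pa.
Qed.

Lemma branch_nbr p z t : edge p z -> edge p t -> t \in branch p z -> t = z.
Proof. by move=> pz pt /(branch_inj pt pz (branch_self _ _)). Qed.

Lemma branch_edge_out p z a b :
  edge p z -> a \in branch p z -> b \notin branch p z ->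
  edge a b = (a == z) && (b == p).
Proof.
move=> pz a_in b_out; apply/idP/andP=> [ab|[/eqP -> /eqP ->]]; last by rewrite edge_sym.
have /eqP b_p : b == p.
  by apply: contraNT b_out => /(branch_closed pz a_in ab).
move: ab; rewrite b_p eqxx edge_sym => pa; split=> //.
by rewrite (branch_nbr pz pa a_in).
Qed.

(** A path that starts at [w] and avoids [z] cannot reach [p]: otherwise [p] and
    [w], both adjacent to [z], would lie in the same branch at [z]. *)
Lemma branch_nested p z w t :
  edge p z -> edge z w -> w != p -> t \in branch z w -> t \in branch p z.
Proof.
move=> pz zw neq_wp; rewrite inE => wt.
have zp : edge z p by rewrite edge_sym.
suff [] : t \in branch z w /\ t \in branch p z by [].
apply: (connect_ind (Q := fun t => t \in branch z w /\ t \in branch p z)) wt.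
  move=> a b [a_zw a_pz] /and3P[ab neq_az neq_bz].
  have b_zw : b \in branch z w by apply: branch_closed ab _.
  split=> //; apply: branch_closed ab _ => //.
  by apply: contraNneq neq_wp => b_p; rewrite (branch_nbr zw zp) // -b_p.
split; first exact: branch_self.
by apply: branch_closed zw _ => //; apply: branch_self.
Qed.

End Acyclic.

Section Tree.
Hypothesis treeG : is_tree G.
Let connG : connected G := treeG.1.
Let acycG : acyclic G := treeG.2.

Lemma branch_cover p t : t != p -> exists2 z, edge p z & t \in branch p z.
Proof.
move en: (dist t p) => n; elim: n t en => [|n IHn] t en neq_tp.
  by rewrite -(dist_eq0 connG) en in neq_tp.
have [w tw] := dist_step connG neq_tp; rewrite en => -[/esym en'].
have [w_p|neq_wp] := eqVneq w p.
  by exists t; rewrite ?branch_self // edge_sym -w_p.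
have [z pz w_in] := IHn w en' neq_wp; exists z => //.
by apply: branch_closed w_in _ neq_tp => //; rewrite edge_sym.
Qed.

(** Every walk into the branch uses the edge from [p] to [z]. For the lower bound,
    the claimed value of the distance from [s], used inside the branch, and the
    actual distance outside together form a function that grows by at most one
    along each edge. *)
Lemma dist_cut p z s t : edge p z -> t \in branch p z -> s \notin branch p z ->
  dist s t = (dist s p + dist z t).+1.
Proof.
move=> pz t_in s_out; apply/eqP; rewrite eqn_leq; apply/andP; split.
  apply: leq_trans (dist_triangle connG s p t) _.
  rewrite -addnS leq_add2l -add1n -(dist_edge connG pz).
  exact: dist_triangle.
pose psi u := if u \in branch p z then (dist s p + dist z u).+1 else dist s u.
have lip a b : edge a b -> psi b <= (psi a).+1.
  move=> ab; rewrite /psi; case: ifPn => b_in; case: ifPn => a_in.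
  - by have := dist_triangle connG z a b; rewrite (dist_edge connG ab); lia.
  - move: ab; rewrite edge_sym (branch_edge_out _ pz b_in a_in) //.
    by case/andP=> /eqP -> /eqP ->; rewrite distxx // addn0.
  - move: ab; rewrite (branch_edge_out _ pz a_in b_in) //.
    by case/andP=> /eqP -> /eqP ->; lia.
  - by have := dist_triangle connG s a b; rewrite (dist_edge connG ab); lia.
have := dist_lipschitz connG lip s t.
by rewrite /psi t_in (negPf s_out) distxx.
Qed.

Lemma dist_branch p z t : edge p z -> t \in branch p z -> dist p t = (dist z t).+1.
Proof.
move=> pz t_in; rewrite (dist_cut pz t_in) ?distxx //.
by apply/negP=> /(branch_neq pz); rewrite eqxx.
Qed.

Lemma dist_via p z1 z2 a b : edge p z1 -> edge p z2 -> z1 != z2 ->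
  a \in branch p z1 -> b \in branch p z2 -> dist a b = dist a p + dist p b.
Proof.
move=> pz1 pz2 neq_z a_in b_in.
rewrite (dist_branch pz2 b_in) addnS; apply: dist_cut => //.
by apply: contra neq_z => /(branch_inj acycG pz1 pz2 a_in) ->.
Qed.

Lemma branch_toward u v z : edge u z -> dist z v < dist u v -> v \in branch u z.
Proof.
move=> uz lt_d; have: v != u.
  by apply: contraTneq lt_d => ->; rewrite distxx.
case/branch_cover=> w uw v_in; have [<-//|neq_wz] := eqVneq w z.
have z_out : z \notin branch u w.
  by apply: contra neq_wz => /(branch_nbr acycG uw uz) ->.
move: lt_d; rewrite (dist_cut uw v_in z_out) (dist_branch uw v_in).
by rewrite dist_sym // (dist_edge connG uz); lia.
Qed.

Lemma dist_edge_step u u' v : edge u u' ->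
  dist u v = (dist u' v).+1 \/ dist u' v = (dist u v).+1.
Proof.
move=> uu'; case: (boolP (v \in branch u u')) => v_in.
  by left; apply: dist_branch.
right; rewrite ![dist _ v]dist_sym // (dist_cut uu' (branch_self _ _) v_in).
by rewrite distxx // addn0.
Qed.

Lemma closer_nbr_uniq u v z z' : edge u z -> edge u z' ->
  dist z v < dist u v -> dist z' v < dist u v -> z = z'.
Proof.
move=> uz uz' /(branch_toward uz) v_z /(branch_toward uz') v_z'.
exact: branch_inj v_z v_z'.
Qed.

End Tree.
End Components.

(** * Automorphisms *)

Section Automorphisms.
Variable G : sgraph.
Implicit Types (s : {perm G}) (u v t p z : G).

Lemma autP s : reflect (forall u v, edge (s u) (s v) = edge u v) (automorphism s).
Proof.
apply: (iffP forallP) => aut_s u; first by move=> v; have /forallP/(_ v)/eqP := aut_s u.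
by apply/forallP=> v; rewrite aut_s.
Qed.

Lemma autV s : automorphism s -> automorphism s^-1.
Proof. by move/autP=> aut_s; apply/autP=> u v; rewrite -aut_s !permKV. Qed.

Lemma autM s s' : automorphism s -> automorphism s' -> automorphism (s * s').
Proof. by move=> /autP as_ /autP as'; apply/autP=> u v; rewrite !permM as' as_. Qed.

Lemma aut1 : automorphism (1 : {perm G}).
Proof. by apply/autP=> u v; rewrite !perm1. Qed.

Lemma aut_branch s p z t : automorphism s ->
  (s t \in branch (s p) (s z)) = (t \in branch p z).
Proof.
suff imp s' p' z' t' : automorphism s' -> t' \in branch p' z' -> s' t' \in branch (s' p') (s' z').
  move=> aut_s; apply/idP/idP; last exact: imp.
  by move/(imp _ _ _ _ (autV aut_s)); rewrite !permK.
move=> /autP aut_s; rewrite !inE.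
apply: (connect_ind (Q := fun t => connect (avoid (s' p')) (s' z') (s' t))) => [a b|]; last exact: connect0.
move=> za /and3P[ab neq_a neq_b]; apply: connect_trans za (connect1 _).
by rewrite /avoid aut_s ab !(inj_eq perm_inj) neq_a.
Qed.

Lemma aut_dist s u v : connected G -> automorphism s -> dist (s u) (s v) = dist u v.
Proof.
move=> connG; suff le_d s' u' v' : automorphism s' -> dist (s' u') (s' v') <= dist u' v'.
  move=> aut_s; apply/eqP; rewrite eqn_leq le_d //=.
  by have := le_d _ (s u) (s v) (autV aut_s); rewrite !permK.
move=> /autP aut_s; have := dist_lipschitz connG (phi := fun t => dist (s' u') (s' t)) _ u' v'.
rewrite distxx; apply=> a b; rewrite -aut_s => ab.
have := dist_triangle connG (s' u') (s' a) (s' b).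
by rewrite (dist_edge connG ab) addn1.
Qed.

Lemma twins_aut u v : (forall t, edge u t = edge v t) -> automorphism (tperm u v).
Proof.
move=> twin; apply/autP=> a b.
have e t : edge (tperm u v t) =1 edge t by case: tpermP => // -> x; rewrite twin.
by rewrite e edge_sym e edge_sym.
Qed.

End Automorphisms.

(** * Graphs whose paint cost equals their fixing number *)

Section Good.
Variable D : nat.

(** The minima of the two parameters are eliminated: the vertices outside the class
    of [i0] form a fixing set because [c] is distinguishing, and the second clause
    makes it a smallest one. *)
Definition good (G : sgraph) : Prop :=
  exists (c : {ffun G -> 'I_D}) (i0 : 'I_D), distinguishing c /\
    forall S : {set G}, fixing_set S -> #|[set v | c v != i0]| <= #|S|.

Variable G : sgraph.
Implicit Types (c : {ffun G -> 'I_D}) (S : {set G}) (s : {perm G}).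

Lemma distinguishingP c :
  reflect (forall s, automorphism s -> (forall v, c (s v) = c v) -> s = 1%g)
          (distinguishing c).
Proof.
apply: (iffP forallP) => dist_c s.
  move=> aut_s c_s; apply/eqP; apply: (implyP (dist_c s)); rewrite aut_s.
  by apply/forallP=> v; rewrite c_s.
apply/implyP=> /andP[aut_s /forallP c_s]; apply/eqP/dist_c => // v.
exact/eqP.
Qed.

Lemma fixing_setP S :
  reflect (forall s, automorphism s -> (forall v, v \in S -> s v = v) -> s = 1%g)
          (fixing_set S).
Proof.
apply: (iffP forallP) => fix_S s.
  move=> aut_s s_S; apply/eqP; apply: (implyP (fix_S s)); rewrite aut_s.
  by apply/forallP=> v; apply/implyP=> v_S; rewrite s_S.
apply/implyP=> /andP[aut_s /forallP s_S]; apply/eqP/fix_S => // v v_S.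
exact/eqP/(implyP (s_S v)).
Qed.

(** An automorphism that fixes every vertex outside one colour class maps this
    class to itself, so it preserves all colours. In particular the paint cost is
    never below the fixing number. *)
Lemma distinguishing_fixing c i :
  distinguishing c -> fixing_set [set v | c v != i].
Proof.
move/distinguishingP=> dist_c; apply/fixing_setP=> s aut_s s_S.
apply: dist_c => // v; case: (boolP (v \in [set v | c v != i])) => [/s_S -> //|].
rewrite inE negbK => /eqP c_v; apply/eqP; rewrite c_v; apply: contraT => c_sv.
have /perm_inj ssv : s (s v) = s v by apply: s_S; rewrite inE.
by rewrite ssv c_v eqxx in c_sv.
Qed.

Lemma fixing_number_le S : fixing_set S -> fixing_number G <= #|S|.
Proof. exact: bigminn_le. Qed.

Lemma fixing_number_attained :
  exists2 S : {set G}, fixing_set S & #|S| = fixing_number G.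
Proof.
rewrite /fixing_number.
have [e_d|[S fS ->]] := bigminn_attained (@fixing_set G) (fun S => #|S|) #|G|.
  exists setT; last by rewrite cardsT.
  by apply/fixing_setP=> s _ s1; apply/permP=> v; rewrite perm1 s1.
by exists S.
Qed.

Lemma goodP : 0 < D -> good G <->
  distinguishable D G /\ paint_cost D G = fixing_number G.
Proof.
move=> D_gt0.
have card_off c i : #|[set v | c v != i]| = #|G| - #|[set v | c v == i]|.
  by rewrite -(cardsC [set v | c v == i]) addKn; apply: eq_card => v; rewrite !inE.
have max_class c : exists i, \max_(i < D) #|[set v | c v == i]| = #|[set v | c v == i]|.
  have [|i e_i] := eq_bigmax (fun i : 'I_D => #|[set v | c v == i]|).
    by rewrite card_ord.
  by exists i; apply: e_i.
split=> [[c [i0 [dist_c min_c]]] | [[c0 dist_c0] cost_eq]].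
  split; first by exists c.
  apply/eqP; rewrite eqn_leq; apply/andP; split.
    have [S fS <-] := fixing_number_attained.
    apply: leq_trans (bigminn_le _ _ dist_c) _; apply: leq_trans (min_c S fS).
    by rewrite card_off leq_sub2l // (leq_bigmax (F := fun i => #|[set v | c v == i]|)).
  rewrite /paint_cost.
  have [->|[c' dist_c' ->]] := bigminn_attained (@distinguishing G D)
      (fun c : {ffun G -> 'I_D} => #|G| - \max_(i < D) #|[set v | c v == i]|) #|G|.
    exact: bigminn_le_default.
  have [i ->] := max_class c'; rewrite -card_off.
  exact/fixing_number_le/distinguishing_fixing.
suff [c dist_c e_c] : exists2 c : {ffun G -> 'I_D}, distinguishing c &
    paint_cost D G = #|G| - \max_(i < D) #|[set v | c v == i]|.
  have [i0 e_i0] := max_class c; exists c, i0; split=> // S fS.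
  by rewrite card_off -e_i0 -e_c cost_eq fixing_number_le.
have [e_d|[c dist_c e_c]] := bigminn_attained (@distinguishing G D)
      (fun c : {ffun G -> 'I_D} => #|G| - \max_(i < D) #|[set v | c v == i]|) #|G|.
  exists c0 => //; apply/eqP; rewrite eqn_leq bigminn_le //=.
  by rewrite /paint_cost e_d leq_subr.
by exists c.
Qed.

(** The transposition of two vertices with the same neighbours is an automorphism. *)
Lemma distinguishing_twins c u v : distinguishing c ->
  (forall t, edge u t = edge v t) -> c u = c v -> u = v.
Proof.
move/distinguishingP=> dist_c twin c_uv.
have t1: tperm u v = 1%g.
  by apply: dist_c (twins_aut twin) _ => w; case: tpermP => // ->.
by have := tpermL u v; rewrite t1 perm1.
Qed.

End Good.

(** * Exchanging isomorphic branches *)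

Section Swap.
Variables (G : sgraph) (A A' : {set G}) (f g : G -> G).
Hypotheses (disjA : [disjoint A & A'])
  (fA : forall a, a \in A -> f a \in A') (gA : forall a, a \in A' -> g a \in A)
  (fK : forall a, a \in A -> g (f a) = a) (gK : forall a, a \in A' -> f (g a) = a)
  (edge_in : forall a b, a \in A -> b \in A -> edge (f a) (f b) = edge a b)
  (edge_out : forall a b, a \in A -> b \notin A -> b \notin A' -> edge (f a) b = edge a b)
  (edge_btw : forall a b, a \in A -> b \in A -> edge a (f b) = edge (f a) b).

(** The last condition on edges leaves room for edges between [A] and [A'], as for
    the two halves of a tree that is cut at its central edge. *)
Lemma swap_aut : exists s : {perm G},
  [/\ automorphism s, {in A, s =1 f}, {in A', s =1 g}
    & forall t, t \notin A -> t \notin A' -> s t = t].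
Proof.
have A'_A a : a \in A' -> a \in A = false.
  by move=> aA'; apply/negbTE/negP => aA; rewrite (disjointFr disjA aA) in aA'.
pose sg t := if t \in A then f t else if t \in A' then g t else t.
have sgK : involutive sg.
  move=> t; rewrite {2}/sg; case: ifPn => [tA|tNA]; last case: ifPn => [tA'|tNA'].
  - by rewrite /sg A'_A fA ?fK.
  - by rewrite /sg gA ?gK.
  - by rewrite /sg (negPf tNA) (negPf tNA').
pose s := perm (inv_inj sgK).
have imp1 a b : (a \in A) || (b \notin A) && ((a \in A') || (b \notin A')) ->
    edge a b -> edge (sg a) (sg b).
  rewrite /sg; case: ifP => //= [aA _|aNA].
    case: ifP => [bA|/negbT bNA]; first by rewrite edge_in.
    case: ifP => [bA'|/negbT bNA']; last by rewrite edge_out.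
    by rewrite -{1}(gK bA') edge_btw ?gA //.
  case/andP=> bNA; rewrite (negPf bNA).
  case: ifP => /= [aA' _|aNA' /negPf ->]; last by [].
  case: ifPn => [bA'|bNA'].
    by rewrite -{1}(gK aA') -{1}(gK bA') edge_in ?gA //.
  by rewrite -{1}(gK aA') edge_out ?gA //.
have imp a b : edge a b -> edge (sg a) (sg b).
  have [cond|] := boolP ((a \in A) || (b \notin A) && ((a \in A') || (b \notin A'))).
    exact: imp1.
  rewrite edge_sym [edge (sg a) _]edge_sym => cond; apply: imp1; move: cond.
  by case: (a \in A); case: (b \in A); case: (a \in A'); case: (b \in A').
exists s; split=> [|t tA|t tA'|t tNA tNA'].
- apply/autP=> a b; rewrite !permE; apply/idP/idP; last exact: imp.
  by move/imp; rewrite !sgK.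
- by rewrite permE /sg tA.
- by rewrite permE /sg A'_A // tA'.
- by rewrite permE /sg (negPf tNA) (negPf tNA').
Qed.

End Swap.

Section SwapSiblings.
Variables (G : sgraph) (p z z' : G) (f g : G -> G).
Hypotheses (acycG : acyclic G) (pz : edge p z) (pz' : edge p z') (neq_z : z != z')
  (fA : forall a : G, a \in branch p z -> f a \in branch p z')
  (gA : forall a : G, a \in branch p z' -> g a \in branch p z)
  (fK : forall a : G, a \in branch p z -> g (f a) = a)
  (gK : forall a : G, a \in branch p z' -> f (g a) = a)
  (edge_in : forall a b : G, a \in branch p z -> b \in branch p z -> edge (f a) (f b) = edge a b)
  (fz : f z = z').

Lemma branch_disjoint : [disjoint branch p z & branch p z'].
Proof.
rewrite disjoint_subset; apply/subsetP=> t t_z; rewrite inE.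
by apply: contra neq_z => /(branch_inj acycG pz pz' t_z) ->.
Qed.

Lemma swap_siblings : exists s : {perm G},
  [/\ automorphism s, {in branch p z, s =1 f}, {in branch p z', s =1 g}
    & forall t, t \notin branch p z -> t \notin branch p z' -> s t = t].
Proof.
apply: swap_aut => // [|a b a_in bNz bNz'|a b a_in b_in]; first exact: branch_disjoint.
  rewrite (branch_edge_out acycG pz a_in bNz) (branch_edge_out acycG pz' (fA a_in) bNz').
  rewrite -fz; congr (_ && _); apply/eqP/eqP=> [|-> //].
  by move/(congr1 g); rewrite !fK // branch_self.
have out x y : x \in branch p z -> y \in branch p z' -> edge x y = false.
  move=> x_in y_in; apply/negP=> xy.
  have : y \in branch p z by apply: (branch_closed pz x_in xy (branch_neq pz' y_in)).
  by apply/negP; rewrite (disjointFl branch_disjoint).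
by rewrite out ?fA // edge_sym out ?fA.
Qed.

End SwapSiblings.

(** * The size of a distinguishable tree *)

Section Bound.
Variable D : nat.

Definition code_type N : finType :=
  ('I_N.+1 * {ffun 'I_N.+1 * 'I_N.+1 -> bool} * {ffun 'I_N.+1 -> 'I_D} * 'I_N.+1)%type.

(** The data describing a coloured branch up to isomorphism: vertices are replaced
    by their ranks in the enumeration of the branch, so that all branches with at
    most [N] vertices have codes in one finite type. *)
Definition code (G : sgraph) (c : {ffun G -> 'I_D}) N (A : {set G}) (z : G) : code_type N :=
  (inord #|A|,
   [ffun ij : 'I_N.+1 * 'I_N.+1 => edge (nth z (enum A) ij.1) (nth z (enum A) ij.2)],
   [ffun i : 'I_N.+1 => c (nth z (enum A) i)],
   inord (index z (enum A))).

Fixpoint size_bound h : nat :=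
  if h is h'.+1 then (#|code_type (size_bound h')| * size_bound h').+1 else 1.

Variable G : sgraph.
Hypothesis treeG : is_tree G.
Variable c : {ffun G -> 'I_D}.
Hypothesis dist_c : distinguishing c.
Let connG := treeG.1.
Let acycG := treeG.2.

(** Two branches at [p] with the same code are isomorphic as coloured rooted trees;
    exchanging them is an automorphism that preserves the colours. *)
Lemma code_sibling_inj N (p z z' : G) : edge p z -> edge p z' ->
  #|branch p z| <= N -> #|branch p z'| <= N ->
  code c N (branch p z) z = code c N (branch p z') z' -> z = z'.
Proof.
move=> pz pz' le_N le_N' [e_card e_edge e_col e_root]; apply/eqP/negPn/negP => neq_z.
have {}e_card : #|branch p z| = #|branch p z'|.
  by move: e_card => /(congr1 val); rewrite /= !inordK.
have in_enum x y : (y \in enum (branch p x)) = (y \in branch p x) by rewrite mem_enum.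
have size_enum x : size (enum (branch p x)) = #|branch p x| by rewrite -cardE.
have lt_index x y : y \in branch p x -> index y (enum (branch p x)) < #|branch p x|.
  by rewrite -size_enum index_mem in_enum.
pose tr a b y := nth b (enum (branch p b)) (index y (enum (branch p a))).
have trA a b y : #|branch p a| = #|branch p b| -> y \in branch p a -> tr a b y \in branch p b.
  by move=> e_ab y_in; rewrite -in_enum mem_nth // size_enum -e_ab lt_index.
have trK a b y : #|branch p a| = #|branch p b| -> y \in branch p a -> tr b a (tr a b y) = y.
  move=> e_ab y_in; rewrite /tr index_uniq ?enum_uniq ?nth_index ?in_enum //.
  by rewrite size_enum -e_ab lt_index.
have e_edge' i j : i < #|branch p z| -> j < #|branch p z| ->
    edge (nth z (enum (branch p z)) i) (nth z (enum (branch p z)) j) =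
    edge (nth z' (enum (branch p z')) i) (nth z' (enum (branch p z')) j).
  move=> lt_i lt_j; have /ffunP/(_ (inord i, inord j)) := e_edge.
  by rewrite !ffunE /= !inordK //; lia.
have [||||||s [aut_s s_z s_z' s_out]] := swap_siblings (f := tr z z') (g := tr z' z) acycG pz pz' neq_z.
- by move=> a; apply: trA.
- by move=> a; apply: trA.
- by move=> a; apply: trK.
- by move=> a; apply: trK.
- move=> a b a_in b_in; rewrite /tr -e_edge' ?lt_index //.
  by rewrite !nth_index ?in_enum.
- move: e_root => /(congr1 val); rewrite /= !inordK.
  + by rewrite /tr => ->; rewrite nth_index // in_enum branch_self.
  + by have := lt_index z' z' (branch_self _ _); lia.
  + by have := lt_index z z (branch_self _ _); lia.
have col_tr y : y \in branch p z -> c (tr z z' y) = c y.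
  move=> y_in; have lt_y := lt_index _ _ y_in.
  have /ffunP/(_ (inord (index y (enum (branch p z))))) := e_col.
  by rewrite !ffunE /= !inordK ?nth_index ?in_enum //; lia.
have s1 : s = 1%g.
  apply: (distinguishingP c dist_c s aut_s) => t.
  case: (boolP (t \in branch p z)) => [t_in|tNz]; first by rewrite s_z ?col_tr.
  case: (boolP (t \in branch p z')) => [t_in|tNz']; last by rewrite s_out.
  by rewrite s_z' // -{2}(trK z' z t) // col_tr // trA.
have := trA z z' z e_card (branch_self _ _); rewrite -s_z ?branch_self // s1 perm1.
by rewrite (disjointFr (branch_disjoint acycG pz pz' neq_z) (branch_self _ _)).
Qed.

Lemma card_siblings N (p : G) (Z : {set G}) :
  (forall z, z \in Z -> edge p z /\ #|branch p z| <= N) ->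
  #|\bigcup_(z in Z) branch p z| <= #|code_type N| * N.
Proof.
move=> Z_N; have cardZ : #|Z| <= #|code_type N|.
  rewrite -(@card_in_imset _ _ (fun z => code c N (branch p z) z)) ?max_card //.
  move=> z z' /Z_N[pz le_z] /Z_N[pz' le_z']; exact: code_sibling_inj.
apply: (@leq_trans (\sum_(z in Z) N)); last by rewrite sum_nat_const leq_mul2r cardZ orbT.
elim/big_rec2: _ => [|z m B zZ le_B]; first by rewrite cards0.
by apply: leq_trans (leq_card_setU _ _) _; rewrite leq_add // (Z_N z zZ).2.
Qed.

Lemma card_branch h (p z : G) : edge p z ->
  (forall t, t \in branch p z -> dist z t <= h) -> #|branch p z| <= size_bound h.
Proof.
elim: h p z => [|h IHh] p z pz le_h.
  rewrite /= -(cards1 z) subset_leq_card //; apply/subsetP=> t /le_h.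
  by rewrite leqn0 dist_eq0 // => /eqP ->; rewrite inE.
have sub : branch p z \subset z |: \bigcup_(w in [set w | edge z w && (w != p)]) branch z w.
  apply/subsetP=> t t_in; rewrite in_setU1; have [//|neq_tz] := eqVneq t z.
  have [w zw t_w] := branch_cover treeG neq_tz; apply/bigcupP; exists w => //.
  rewrite inE zw /=; apply: contraTneq t_in => w_p; apply/negP => t_z.
  have := dist_branch treeG pz t_z; have := dist_branch treeG zw t_w.
  by rewrite w_p; lia.
apply: leq_trans (subset_leq_card sub) _; apply: leq_trans (leq_card_setU _ _) _.
rewrite cards1 add1n ltnS; apply: card_siblings => w; rewrite inE => /andP[zw neq_wp].
split=> //; apply: IHh => // t t_w.
rewrite -ltnS -(dist_branch treeG zw t_w); apply: le_h.
by apply: (branch_nested acycG pz zw neq_wp).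
Qed.

Lemma card_tree (x : G) : #|G| <= size_bound (eccentricity x).
Proof.
case e_ecc: (eccentricity x) => [|h].
  rewrite /= -cardsT -(cards1 x) subset_leq_card //; apply/subsetP=> t _.
  by rewrite inE eq_sym -(dist_eq0 connG) -leqn0 -e_ecc dist_le_ecc.
have sub : setT \subset x |: \bigcup_(w in [set w | edge x w]) branch x w.
  apply/subsetP=> t _; rewrite in_setU1; have [//|neq_tx] := eqVneq t x.
  have [w xw t_w] := branch_cover treeG neq_tx; apply/bigcupP; exists w => //.
  by rewrite inE.
rewrite -cardsT; apply: leq_trans (subset_leq_card sub) _.
apply: leq_trans (leq_card_setU _ _) _.
rewrite cards1 add1n ltnS; apply: card_siblings => w; rewrite inE => xw.
split=> //; apply: card_branch => // t t_w.
by rewrite -ltnS -(dist_branch treeG xw t_w) -e_ecc dist_le_ecc.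
Qed.

End Bound.

Lemma size_bound_mono D h h' : 0 < D -> h <= h' -> size_bound D h <= size_bound D h'.
Proof.
move=> D_gt0; elim: h' => [|h' IHh']; first by rewrite leqn0 => /eqP ->.
rewrite leq_eqVlt => /orP[/eqP -> //|/IHh' le_h]; apply: leq_trans le_h _.
apply: leqW => /=; apply: leq_pmull.
by apply/card_gt0P; exists (ord0, [ffun _ => true], [ffun _ => Ordinal D_gt0], ord0).
Qed.

Section FiniteReps.

Lemma mx_edge_sym n (e : {ffun 'I_n * 'I_n -> bool}) :
  symmetric (fun i j => (i != j) && (e (i, j) || e (j, i))).
Proof. by move=> i j; rewrite eq_sym orbC. Qed.

Lemma mx_edge_irrefl n (e : {ffun 'I_n * 'I_n -> bool}) :
  irreflexive (fun i j => (i != j) && (e (i, j) || e (j, i))).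
Proof. by move=> i; rewrite eqxx. Qed.

Definition mx_graph n (e : {ffun 'I_n * 'I_n -> bool}) : sgraph :=
  SGraph (mx_edge_sym e) (mx_edge_irrefl e).

Lemma mx_graph_iso (G : sgraph) :
  exists e : {ffun 'I_#|G| * 'I_#|G| -> bool}, graph_iso G (mx_graph e).
Proof.
exists [ffun ij => edge (enum_val ij.1) (enum_val ij.2)].
exists (@enum_rank G); split; first exact: enum_rank_bij.
move=> u v /=; rewrite !ffunE /= !enum_rankK [edge v u]edge_sym orbb.
rewrite (inj_eq enum_rank_inj).
by have [->|_] := eqVneq u v; rewrite ?edge_irrefl.
Qed.

Lemma finite_reps N : exists reps : seq sgraph,
  forall G : sgraph, #|G| <= N -> exists2 H, List.In H reps & graph_iso G H.
Proof.
exists (flatten [seq map (@mx_graph n) (enum {: {ffun 'I_n * 'I_n -> bool}}) | n <- iota 0 N.+1]).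
move=> G le_N; have [e iso_e] := mx_graph_iso G; exists (mx_graph e) => //.
have in_cat (T : Type) (x : T) s1 s2 : List.In x (s1 ++ s2) <-> List.In x s1 \/ List.In x s2.
  by elim: s1 => [|y s1 IH] /=; [tauto|rewrite IH; tauto].
have: #|G| \in iota 0 N.+1 by rewrite mem_iota ltnS.
elim: (iota 0 N.+1) => //= n s IHs; rewrite inE => /orP[/eqP e_n|/IHs in_s].
  apply/in_cat; left; subst n.
  have: e \in enum {: {ffun 'I_#|G| * 'I_#|G| -> bool}} by rewrite mem_enum.
  by elim: (enum _) => //= e' s' IHs'; rewrite inE => /orP[/eqP ->|/IHs']; [left|right].
by apply/in_cat; right.
Qed.

End FiniteReps.

(** * Invariance under isomorphism *)

Section Isomorphisms.

Lemma graph_iso_trans (G H K : sgraph) : graph_iso G H -> graph_iso H K -> graph_iso G K.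
Proof.
case=> f [bij_f fE] [g [bij_g gE]]; exists (g \o f); split; first exact: bij_comp.
by move=> u v; rewrite /= gE.
Qed.

Lemma graph_iso_good D (G H : sgraph) : graph_iso G H -> good D G -> good D H.
Proof.
case=> f [[g fK gK] fE] [c [i0 [dist_c min_c]]].
have gE u v : edge (g u) (g v) = edge u v by rewrite -fE !gK.
have f_inj := can_inj fK; have g_inj := can_inj gK.
have conj_inj (s : {perm G}) : injective (fun u => f (s (g u))).
  by move=> x y /f_inj /perm_inj /g_inj.
have conj_inj' (s : {perm H}) : injective (fun u => g (s (f u))).
  by move=> x y /g_inj /perm_inj /f_inj.
exists [ffun u => c (g u)], i0; split.
  apply/distinguishingP=> s aut_s cs.
  have s1 : perm (conj_inj' s) = 1%g.
    apply: (distinguishingP c dist_c) => [|u].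
      by apply/autP=> u v; rewrite !permE gE (autP _ aut_s) fE.
    by rewrite permE; have := cs (f u); rewrite !ffunE fK.
  apply/permP=> u; rewrite perm1; apply: g_inj.
  by have := permE (conj_inj' s) (g u); rewrite s1 perm1 gK.
move=> S fS; have -> : [set v | [ffun u => c (g u)] v != i0] = g @^-1: [set v | c v != i0].
  by apply/setP=> u; rewrite !inE ffunE.
have card_g (A : {set G}) : #|g @^-1: A| = #|A|.
  rewrite -(card_imset (g @^-1: A) g_inj); apply: eq_card => u.
  apply/imsetP/idP=> [[x]|uA]; first by rewrite inE => ? ->.
  by exists (f u); rewrite ?inE fK.
have card_f : #|f @^-1: S| = #|S|.
  rewrite -(card_imset (f @^-1: S) f_inj); apply: eq_card => u.
  apply/imsetP/idP=> [[x]|uS]; first by rewrite inE => ? ->.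
  by exists (g u); rewrite ?inE gK.
rewrite card_g -card_f; apply: min_c; apply/fixing_setP=> s aut_s s_fix.
have s1 : perm (conj_inj s) = 1%g.
  apply: (fixing_setP _ fS) => [|u uS].
    by apply/autP=> u v; rewrite !permE fE (autP _ aut_s) gE.
  by rewrite permE s_fix ?inE gK.
apply/permP=> u; rewrite perm1; apply: f_inj.
by have := permE (conj_inj s) (f u); rewrite s1 perm1 fK.
Qed.

Lemma graph_iso_tree (G H : sgraph) : graph_iso G H -> is_tree G -> is_tree H.
Proof.
case=> f [[g fK gK] fE] [[G_gt0 connG] acycG].
have gE u v : edge (g u) (g v) = edge u v by rewrite -fE !gK.
split; first split.
- by have /card_gt0P[u _] := G_gt0; apply/card_gt0P; exists (f u).
- move=> u v; rewrite -(gK u) -(gK v).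
  apply: (connect_ind (Q := fun t => connect (@edge H) (f (g u)) (f t)) _ _ (connG (g u) (g v))).
    by move=> a b ua ab; apply: connect_trans ua (connect1 _); rewrite fE.
  exact: connect0.
move=> p lt_p /andP[cycle_p uniq_p]; apply: (acycG (map g p)); first by rewrite size_map.
rewrite /ucycle map_inj_uniq ?uniq_p ?andbT; last exact: can_inj gK.
case: p cycle_p {uniq_p lt_p} => //= u p; rewrite -map_rcons.
by rewrite path_map (eq_path (e' := @edge H)) // => a b; apply: gE.
Qed.

Lemma graph_iso_radius (G H : sgraph) :
  graph_iso G H -> connected G -> connected H -> radius H <= radius G.
Proof.
case=> f [[g fK gK] fE] connG connH.
have [c e_c] := radius_attained connG; rewrite -e_c.
apply: leq_trans (radius_le_ecc (f c)) _; apply/ecc_leP=> w.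
rewrite -(gK w); apply: leq_trans (dist_le_ecc c (g w)).
have := dist_lipschitz connG (phi := fun t => dist (f c) (f t)) _ c (g w).
rewrite distxx; apply=> a b; rewrite -fE => ab.
have := dist_triangle connH (f c) (f a) (f b).
by rewrite (dist_edge connH ab) addn1.
Qed.

End Isomorphisms.

(** * Pinning one end of a tree of odd diameter *)

Lemma geodesic_point (G : sgraph) (v w : G) k : connected G -> k <= dist v w ->
  exists2 x, dist v x = k & dist x w = dist v w - k.
Proof.
move=> connG; elim: k => [|k IHk] le_k; first by exists v; rewrite ?distxx ?subn0.
have [x d_vx d_xw] := IHk (ltnW le_k).
have neq_xw : x != w by rewrite -(dist_eq0 connG) d_xw -lt0n subn_gt0.
have [y xy d_y] := dist_step connG neq_xw; exists y; last by lia.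
have := dist_triangle connG v x y; have := dist_triangle connG v y w.
by rewrite (dist_edge connG xy); lia.
Qed.

Section Cut.
Variables (G : sgraph) (s : {perm G}) (p z : G).
Hypotheses (acycG : acyclic G) (aut_s : automorphism s) (pz : edge p z)
  (sp : s p = p) (sz : s z = z).

(** The only edge leaving the branch joins two vertices fixed by [s], so [s] can be
    replaced by the identity outside the branch. *)
Lemma cut_aut : exists k : {perm G}, [/\ automorphism k, {in branch p z, k =1 s}
  & forall t, t \notin branch p z -> k t = t].
Proof.
have s_in t : (s t \in branch p z) = (t \in branch p z).
  by rewrite -{1}sp -{1}sz aut_branch.
pose k0 t := if t \in branch p z then s t else t.
have k0_inj : injective k0.
  move=> a b; rewrite /k0; case: ifPn => a_in; case: ifPn => b_in //; first exact: perm_inj.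
    by move=> e_ab; rewrite -e_ab s_in a_in in b_in.
  by move=> e_ab; rewrite e_ab s_in b_in in a_in.
exists (perm k0_inj); split=> [|t t_in|t /negPf t_out]; last 2 first.
- by rewrite permE /k0 t_in.
- by rewrite permE /k0 t_out.
have out a b : a \in branch p z -> b \notin branch p z -> edge (s a) b = edge a b.
  move=> a_in b_out; rewrite !(branch_edge_out acycG pz) ?s_in //.
  by rewrite -{1}sz (inj_eq perm_inj).
apply/autP=> a b; rewrite !permE /k0; case: ifPn => a_in; case: ifPn => b_in //.
- exact: autP.
- exact: out.
- by rewrite edge_sym out // edge_sym.
Qed.

End Cut.

Section OddDiameter.
Variables (G : sgraph) (r : nat) (v w : G).
Hypotheses (treeG : is_tree G) (r_gt0 : 0 < r).
Hypotheses (diamG : forall a b : G, dist a b <= r.*2.-1) (d_vw : dist v w = r.*2.-1).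
Let connG : connected G := treeG.1.
Let acycG : acyclic G := treeG.2.

(** The vertices fixed by the stabilizer of [v]. *)
Definition pinned_by (t : G) :=
  forall s : {perm G}, automorphism s -> s v = v -> s t = t.

(** The two middle vertices of a longest path are exactly the vertices of
    eccentricity at most [r], so automorphisms permute them. An automorphism fixing
    [v] cannot exchange them, as only one of them is at distance [r] from [v]. *)
Lemma center_edge : exists x y : G,
  [/\ edge y x, v \in branch y x, pinned_by x, pinned_by y
    & forall s : {perm G}, automorphism s ->
        s x = x /\ s y = y \/ s x = y /\ s y = x].
Proof.
have [|x d_vx d_xw] := @geodesic_point G v w r.-1 connG; first by lia.
have neq_xw : x != w by rewrite -(dist_eq0 connG); lia.
have [y xy d_y] := dist_step connG neq_xw.
have yx : edge y x by rewrite edge_sym.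
have d_vy : dist v y = r.
  have := dist_triangle connG v x y; have := dist_triangle connG v y w.
  by rewrite (dist_edge connG xy); lia.
have v_in : v \in branch y x.
  by apply: (branch_toward treeG) => //; rewrite ![dist _ v]dist_sym //; lia.
have w_out : w \notin branch y x.
  by apply/negP=> /(dist_branch treeG yx); lia.
pose cen (t : G) := [forall u, dist t u <= r].
have cenE t : cen t = (t == x) || (t == y).
  apply/idP/idP=> [/forallP cen_t|]; last first.
    move=> t_xy; apply/forallP => u.
    case: (boolP (u \in branch y x)) => u_in.
      have := dist_cut treeG yx u_in w_out; have := diamG w u.
      have := dist_branch treeG yx u_in; rewrite [dist w y]dist_sym //.
      by case/orP: t_xy => /eqP ->; lia.
    have := dist_cut treeG yx v_in u_in; have := diamG u v.
    have := dist_triangle connG x y u.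
    rewrite (dist_edge connG xy) [dist u y]dist_sym // [dist x v]dist_sym //.
    by case/orP: t_xy => /eqP ->; lia.
  case: (boolP (t \in branch y x)) => t_in.
    have := dist_cut treeG yx t_in w_out; have := cen_t w.
    rewrite [dist t w]dist_sym // [dist w y]dist_sym // [t == x]eq_sym -(dist_eq0 connG x).
    by lia.
  have := dist_cut treeG yx v_in t_in; have := cen_t v.
  by rewrite [dist x v]dist_sym // -(dist_eq0 connG t y); lia.
have neq_xy : x != y by rewrite -(dist_eq0 connG) (dist_edge connG xy).
have cen_aut (s : {perm G}) t : automorphism s -> cen t -> cen (s t).
  move=> aut_s /forallP cen_t; apply/forallP=> u.
  by rewrite -(permKV s u) aut_dist.
have xy_aut (s : {perm G}) : automorphism s -> s x = x /\ s y = y \/ s x = y /\ s y = x.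
  move=> aut_s; have := cen_aut s x aut_s; have := cen_aut s y aut_s.
  rewrite !cenE !eqxx orbT /= => /(_ isT) sy /(_ isT) sx.
  have neq_s : s x != s y by rewrite (inj_eq perm_inj).
  case/orP: sx sy neq_s => /eqP ->; rewrite ?eqxx ?(eq_sym y x) ?(negPf neq_xy) ?orbF /=.
    by case/orP=> /eqP ->; rewrite ?eqxx //; left.
  by case/orP=> /eqP ->; rewrite ?eqxx //; right.
have pin_xy (s : {perm G}) : automorphism s -> s v = v -> s x = x /\ s y = y.
  move=> aut_s sv; case: (xy_aut s aut_s) => // -[sx _].
  by have := aut_dist v x connG aut_s; rewrite sv sx d_vx d_vy; lia.
exists x, y; split=> // s aut_s sv; by case: (pin_xy s aut_s sv).
Qed.

(** The edge is found by walking from [p0] towards [v] up to the first vertex that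
    [t] moves. All vertices met on the way are on the path from [p0] to [v], hence
    fixed with [v]. *)
Lemma first_moved (t : {perm G}) p0 : automorphism t -> pinned_by p0 ->
  t p0 = p0 -> t v != v ->
  exists p z, [/\ edge p z, v \in branch p z, pinned_by p, pinned_by z & t p = p /\ t z != z].
Proof.
move=> aut_t; move en: (dist p0 v) => n; elim: n p0 en => [|n IHn] p0 en pin_p tp tv.
  by move/eqP: en; rewrite (dist_eq0 connG) => /eqP e_p; rewrite -e_p tp eqxx in tv.
have neq_vp : v != p0 by apply: contraNneq tv => ->; apply/eqP.
have [z pz v_in] := branch_cover treeG neq_vp.
have pin_z : pinned_by z.
  move=> s aut_s sv; have := aut_branch p0 z v aut_s; rewrite v_in sv pin_p // => v_in'.
  apply: (branch_inj acycG _ pz v_in' v_in).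
  by rewrite -{1}(pin_p s aut_s sv) (autP _ aut_s).
have [tz|neq_tz] := eqVneq (t z) z; last by exists p0, z.
apply: (IHn z) => //.
by have := dist_branch treeG pz v_in; rewrite en => -[].
Qed.

(** If [t] exchanges the two central vertices, the branch is the half of the tree
    that contains [v]; otherwise it starts at the first vertex moved by [t] on the
    way from the center to [v]. In both cases [t] maps it to a disjoint branch, and
    exchanging the two is an automorphism. *)
Lemma separate (t : {perm G}) : automorphism t -> t v != v ->
  exists p z, [/\ edge p z, v \in branch p z, pinned_by p /\ pinned_by z,
    [disjoint branch p z & branch (t p) (t z)]
  & exists s : {perm G}, [/\ automorphism s, {in branch p z, s =1 t}
    & forall u, u \notin branch p z -> s u != u -> u \in branch (t p) (t z)]].
Proof.
move=> aut_t tv; have [x [y [yx v_in pin_x pin_y xy_aut]]] := center_edge.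
have t_in p z a : a \in branch p z -> t a \in branch (t p) (t z) by rewrite aut_branch.
have tV_in p z a : a \in branch (t p) (t z) -> (t^-1)%g a \in branch p z.
  by rewrite -(aut_branch p z _ aut_t) permKV.
case: (xy_aut t aut_t) => [[tx ty]|[tx ty]].
  have [p [z [pz v_z pin_p pin_z [tp tz]]]] := first_moved aut_t pin_y ty tv.
  have ptz : edge p (t z) by rewrite -tp (autP _ aut_t).
  have neq_z : z != t z by rewrite eq_sym.
  exists p, z; rewrite tp; split=> //; first exact: branch_disjoint.
  have [|||||//|s [aut_s s_in s_in' s_out]] :=
      swap_siblings (f := t) (g := (t^-1)%g) acycG pz ptz neq_z.
  - by move=> a /t_in; rewrite tp.
  - by move=> a; rewrite -{1}tp => /tV_in.
  - by move=> a _; rewrite permK.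
  - by move=> a _; rewrite permKV.
  - by move=> a b _ _; apply: autP.
  exists s; split=> // u u_out; apply: contraR => u_out'.
  by rewrite s_out.
have xy : edge x y by rewrite edge_sym.
have disj : [disjoint branch y x & branch x y].
  rewrite disjoint_subset; apply/subsetP=> u u_in; rewrite inE; apply/negP.
  move=> /(dist_branch treeG xy); rewrite (dist_branch treeG yx u_in).
  by lia.
have cover u : u \notin branch y x -> u \in branch x y.
  move=> u_out; have neq_ux : u != x.
    by apply: contraNneq u_out => ->; apply: branch_self.
  have [z xz u_z] := branch_cover treeG neq_ux.
  have [<-//|neq_zy] := eqVneq z y.
  by rewrite (branch_nested acycG yx xz neq_zy u_z) in u_out.
have tin a : a \in branch y x -> t a \in branch x y by move/t_in; rewrite tx ty.
have [||||||s [aut_s s_in s_in' s_out]] :=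
    swap_aut (f := t) (g := (t^-1)%g) disj tin.
- by move=> a; rewrite -{1}tx -{1}ty => /tV_in.
- by move=> a _; rewrite permK.
- by move=> a _; rewrite permKV.
- by move=> a b _ _; apply: autP.
- by move=> a b _ /cover->.
- move=> a b a_in b_in.
  rewrite (branch_edge_out acycG yx a_in) ?(disjointFl disj (tin _ _)) //.
  rewrite edge_sym (branch_edge_out acycG yx b_in) ?(disjointFl disj (tin _ _)) //.
  by rewrite -[in t b == _]tx -[in t a == _]tx !(inj_eq perm_inj) andbC.
exists y, x; rewrite tx ty; split=> //; exists s; split=> // u /cover.
by [].
Qed.

Section Exchange.
Variables (D : nat) (c : {ffun G -> 'I_D}) (i0 : 'I_D) (S : {set G}).
Hypotheses (dist_c : distinguishing c)
  (orbit_off : forall s : {perm G}, automorphism s -> c (s v) = i0)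
  (fixS : fixing_set (v |: S)) (nfixS : ~~ fixing_set S).

(** A colour can be moved onto the orbit of [v]. Some [t] fixes [S] and moves [v], and
    the branch that [separate] provides, as well as its image under [t], contains no
    vertex of [S]. As [S] and [v] fix the tree, neither branch has a nontrivial
    automorphism that fixes its root. The colouring must break the exchange of the two branches,
    so one of them contains a coloured vertex [a]; let [s v] be the copy of [v] in
    it. After the colour of [a] is moved to [s v], the latter is the only coloured
    vertex of its orbit, so it is fixed by automorphisms preserving colours; then
    the rigid branch around it is fixed, with the vertex [a] in it. *)
Lemma exchange : exists (c' : {ffun G -> 'I_D}) (s : {perm G}),
  [/\ automorphism s, distinguishing c', c' (s v) != i0
    & #|[set u | c' u != i0]| <= #|[set u | c u != i0]|].
Proof.
have [t [aut_t tS t_neq1]] : exists t : {perm G},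
    [/\ automorphism t, forall u, u \in S -> t u = u & t != 1%g].
  case/forallPn: nfixS => t; rewrite negb_imply => /andP[/andP[aut_t /forallP tS] t1].
  by exists t; split=> // u uS; apply/eqP/(implyP (tS u)).
have tv : t v != v.
  apply: contra t_neq1 => /eqP tv; apply/eqP; apply: (fixing_setP _ fixS) => // u.
  by case/setU1P=> [->|/tS].
have [p [z [pz v_in [pin_p pin_z] disj [s0 [aut_s0 s0_in s0_out]]]]] := separate aut_t tv.
have tpz : edge (t p) (t z) by rewrite (autP _ aut_t).
have S_out u : u \in S -> u \notin branch (t p) (t z).
  move=> uS; apply/negP => u_in; have := u_in.
  by rewrite -{1}(tS u uS) aut_branch // => /(disjointFr disj); rewrite u_in.
(* The far copy of the branch contains neither v nor a vertex of S, so an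
   automorphism restricted to it fixes v |: S. *)
have rigid' (s : {perm G}) : automorphism s -> s (t p) = t p -> s (t z) = t z ->
    {in branch (t p) (t z), forall u, s u = u}.
  move=> aut_s sp sz u u_in; have [k [aut_k k_in k_out]] := cut_aut acycG aut_s tpz sp sz.
  suff k1 : k = 1%g by rewrite -k_in // k1 perm1.
  apply: (fixing_setP _ fixS) => // a; case/setU1P=> [->|aS]; apply: k_out.
    by apply/negP => /(disjointFl disj); rewrite v_in.
  exact: S_out.
have rigid (s : {perm G}) : automorphism s -> s p = p -> s z = z ->
    {in branch p z, forall u, s u = u}.
  move=> aut_s sp sz u u_in; apply: (@perm_inj _ t).
  have <- : (t^-1 * s * t)%g (t u) = t (s u) by rewrite !permM permK.
  apply: rigid'; rewrite ?permM ?permK ?sp ?sz //; last by rewrite aut_branch.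
  by rewrite !autM ?autV.
have [q [a [aut_q a_in col_a qrigid]]] : exists (q : {perm G}) (a : G), [/\ automorphism q,
    a \in branch (q p) (q z), c a != i0 &
    forall s : {perm G}, automorphism s -> s (q p) = q p -> s (q z) = q z -> s a = a].
  apply: NNPP => none.
  have off u : u \in branch p z -> c u = i0.
    move=> u_in; apply/eqP/negPn/negP => col_u; apply: none.
    exists 1%g, u; rewrite !perm1; split=> //; first exact: aut1.
    by move=> s aut_s sp sz; apply: rigid.
  have off' u : u \in branch (t p) (t z) -> c u = i0.
    move=> u_in; apply/eqP/negPn/negP => col_u; apply: none.
    by exists t, u; split=> // s aut_s sp sz; apply: rigid'.
  have s01 : s0 = 1%g.
    apply: (distinguishingP c dist_c s0 aut_s0) => u.
    case: (boolP (u \in branch p z)) => u_in.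
      by rewrite s0_in // (off u) // off' // aut_branch.
    have [->//|s0u] := eqVneq (s0 u) u; have u_in' := s0_out u u_in s0u.
    rewrite (off' u u_in'); case: (boolP (s0 u \in branch p z)) => s0u_in; first exact: off.
    by apply/off'/s0_out; rewrite ?(inj_eq perm_inj).
  by rewrite -(s0_in v v_in) s01 perm1 eqxx in tv.
have neq_a (s : {perm G}) : automorphism s -> s v != a.
  by move=> aut_s; apply: contraNneq col_a => <-; rewrite orbit_off.
pose c' := [ffun u => if u == a then i0 else if u == q v then c a else c u].
have c'_qv : c' (q v) = c a by rewrite ffunE (negPf (neq_a q aut_q)) eqxx.
exists c', q; split=> //; last 2 first.
- by rewrite c'_qv.
- have sub : [set u | c' u != i0] \subset q v |: ([set u | c u != i0] :\ a).
    apply/subsetP=> u; rewrite !inE ffunE; case: (u == a); first by rewrite eqxx.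
    by case: (u == q v).
  apply: leq_trans (subset_leq_card sub) _; apply: leq_trans (leq_card_setU _ _) _.
  by rewrite cards1 [leqRHS](cardsD1 a) inE col_a.
apply/distinguishingP=> s aut_s c's.
have s_qv : s (q v) = q v.
  have := c's (q v); rewrite c'_qv ffunE -permM (negPf (neq_a _ _)) ?autM //.
  case: eqP => // _; rewrite orbit_off ?autM // => e_a.
  by rewrite -e_a eqxx in col_a.
have pin_q u : pinned_by u -> s (q u) = q u.
  move=> pin_u; apply: (@perm_inj _ (q^-1)%g); rewrite permK.
  have <- : (q * s * q^-1)%g u = (q^-1)%g (s (q u)) by rewrite !permM.
  by apply: pin_u; rewrite ?autM ?autV // !permM s_qv permK.
have s_a : s a = a by apply: qrigid; rewrite ?pin_q.
apply: (distinguishingP c dist_c s aut_s) => u.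
have [->|neq_ua] := eqVneq u a; first by rewrite s_a.
have [->|neq_uq] := eqVneq u (q v); first by rewrite s_qv.
have := c's u; rewrite !ffunE (negPf neq_ua) (negPf neq_uq).
by rewrite -{1}s_a -{1}s_qv !(inj_eq perm_inj) (negPf neq_ua) (negPf neq_uq).
Qed.

End Exchange.

(** If the coloured vertices of an optimal colouring meet the orbit of [v], the
    colouring can be transported so that [v] is coloured, and then the colour of [v]
    can be removed. Otherwise the colouring itself works, unless a smaller set
    fixes the tree together with [v]; then [exchange] leads back to the first case. *)
Lemma pinned_coloring D : good D G ->
  exists (c : {ffun G -> 'I_D}) (i0 : 'I_D), [/\ c v = i0,
    forall s : {perm G}, automorphism s -> s v = v -> (forall t, c (s t) = c t) -> s = 1%g
  & forall S : {set G}, fixing_set (v |: S) -> #|[set t | c t != i0]| <= #|S|].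
Proof.
case=> c0 [i0 [dist_c0 min_c0]].
suff on (c : {ffun G -> 'I_D}) (q : {perm G}) : automorphism q -> distinguishing c ->
    c (q v) != i0 -> #|[set u | c u != i0]| <= #|[set u | c0 u != i0]| ->
    exists (c : {ffun G -> 'I_D}) (i0 : 'I_D), [/\ c v = i0,
    forall s : {perm G}, automorphism s -> s v = v -> (forall t, c (s t) = c t) -> s = 1%g
  & forall S : {set G}, fixing_set (v |: S) -> #|[set t | c t != i0]| <= #|S|].
  have [/existsP[q /andP[aut_q c0_q]]|none] :=
      boolP [exists q : {perm G}, automorphism q && (c0 (q v) != i0)]; first exact: on c0_q _.
  have off (s : {perm G}) : automorphism s -> c0 (s v) = i0.
    move=> aut_s; apply/eqP/negPn/negP => c0_s.
    by case/existsP: none; exists s; rewrite aut_s.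
  case: (boolP [exists S : {set G}, fixing_set (v |: S) && (#|S| < #|[set t | c0 t != i0]|)]).
    case/existsP=> S /andP[fS lt_S].
    have nfS : ~~ fixing_set S by apply: contraL lt_S => /min_c0; rewrite leqNgt.
    by have [c [q [aut_q dist_c c_q le_c]]] := exchange dist_c0 off fS nfS; apply: on c_q le_c.
  move/existsPn=> none'; exists c0, i0; split=> [|s aut_s _|S fS].
  - by have := off _ (aut1 G); rewrite perm1.
  - exact: (distinguishingP c0 dist_c0).
  - by rewrite leqNgt; have := none' S; rewrite fS.
move=> aut_q dist_c c_q le_c.
exists [ffun t => if t == v then i0 else c (q t)], i0; split=> [|s aut_s sv cs|S fS].
- by rewrite ffunE eqxx.
- suff: (q^-1 * s * q = 1)%g.
    by move/(congr1 (fun x => q * x * q^-1)%g); rewrite !mulgA mulgV mul1g mulgK mulg1 mulgV.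
  apply: (distinguishingP c dist_c) => [|t]; first by rewrite !autM ?autV.
  rewrite !permM -[in RHS](permKV q t); set u := (q^-1)%g t.
  have := cs u; rewrite !ffunE -{1}sv (inj_eq perm_inj).
  by have [->|_] := eqVneq u v; first rewrite sv.
- have e_set : [set t | [ffun t => if t == v then i0 else c (q t)] t != i0]
      = q @^-1: ([set u | c u != i0] :\ q v).
    apply/setP=> t; rewrite !inE ffunE (inj_eq perm_inj).
    by have [->|_] := eqVneq t v; rewrite ?eqxx.
  rewrite e_set card_preimset; last exact: perm_inj.
  have := leq_trans le_c (min_c0 _ fS); rewrite cardsU1 (cardsD1 (q v)) inE c_q.
  by case: (v \notin S); lia.
Qed.

End OddDiameter.

(** * Adding leaves at a vertex *)

Section Ext.
Variables (T : sgraph) (v : T) (j : nat).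

Definition ext_edge (a b : T + 'I_j) : bool :=
  match a, b with
  | inl x, inl y => edge x y
  | inl x, inr _ | inr _, inl x => x == v
  | inr _, inr _ => false
  end.

Lemma ext_edge_sym : symmetric ext_edge.
Proof. by case=> [x|i] [y|k] //=; rewrite edge_sym. Qed.

Lemma ext_edge_irrefl : irreflexive ext_edge.
Proof. by case=> [x|i] //=; rewrite edge_irrefl. Qed.

(** In the universal tree, this is the union of the branch made of [T] hanging from its
    leaf [v] with [j] branches consisting of one edge. *)
Definition ext : sgraph := SGraph ext_edge_sym ext_edge_irrefl.

Definition old (x : T) : ext := inl x.
Definition new (i : 'I_j) : ext := inr i.

Lemma old_inj : injective old. Proof. by move=> x y []. Qed.
Lemma new_inj : injective new. Proof. by move=> x y []. Qed.

Lemma ext_cases (a : ext) : (exists x, a = old x) \/ (exists i, a = new i).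
Proof. by case: a => [x|i]; [left; exists x | right; exists i]. Qed.

Lemma edge_old x y : edge (old x) (old y) = edge x y. Proof. by []. Qed.
Lemma edge_new_old i x : edge (new i) (old x) = (x == v). Proof. by []. Qed.
Lemma edge_old_new x i : edge (old x) (new i) = (x == v). Proof. by []. Qed.
Lemma edge_new_new i k : edge (new i) (new k) = false. Proof. by []. Qed.

Hypothesis connT : connected T.

Lemma connect_old a b : connect (@edge ext) (old a) (old b).
Proof.
apply: (connect_ind (Q := fun t => connect (@edge ext) (old a) (old t)) _ _ (connT.2 a b)).
  by move=> x y ax xy; apply: connect_trans ax (connect1 _).
exact: connect0.
Qed.

Lemma ext_connected : connected ext.
Proof.
split; first by apply/card_gt0P; exists (old v).
have to_v a : connect (@edge ext) a (old v).
  case: (ext_cases a) => [[x ->]|[i ->]]; first exact: connect_old.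
  by apply: connect1; rewrite edge_new_old.
move=> a b; apply: connect_trans (to_v a) _.
by rewrite (sym_connect_sym (@edge_sym ext)).
Qed.

Lemma dist_old a b : dist (old a) (old b) = dist a b.
Proof.
apply/eqP; rewrite eqn_leq; apply/andP; split.
  have := dist_lipschitz connT (phi := fun t => dist (old a) (old t)) _ a b.
  rewrite distxx; apply=> x y xy; have := dist_triangle ext_connected (old a) (old x) (old y).
  by rewrite (@dist_edge _ ext_connected (old x)) // addn1.
pose phi (u : ext) := match u with inl t => dist a t | inr _ => dist a v end.
have := dist_lipschitz ext_connected (phi := phi) _ (old a) (old b).
rewrite /phi /= distxx; apply.
case=> [x|i] [y|k] //=.
- move=> xy; have := dist_triangle connT a x y.
  by rewrite (dist_edge connT xy) addn1.
- by move/eqP->.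
- by move/eqP->.
Qed.

Lemma dist_new_old i b : dist (new i) (old b) = (dist v b).+1.
Proof.
apply/eqP; rewrite eqn_leq; apply/andP; split.
  apply: leq_trans (dist_triangle ext_connected _ (old v) _) _.
  by rewrite dist_old (dist_edge ext_connected) ?edge_new_old ?add1n.
pose phi (u : ext) := match u with inl t => dist b t | inr _ => (dist b v).+1 end.
rewrite (dist_sym connT v) (dist_sym ext_connected).
have lip x y : edge x y -> phi y <= (phi x).+1.
  case: x y => [x|k] [y|l] //=.
  - move=> xy; have := dist_triangle connT b x y.
    by rewrite (dist_edge connT xy) addn1.
  - by move/eqP->.
  - by move/eqP->; lia.
by have := dist_lipschitz ext_connected lip (old b) (new i); rewrite /phi /= distxx.
Qed.

Lemma dist_new_new i k : dist (new i) (new k) <= 2.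
Proof.
apply: leq_trans (dist_triangle ext_connected _ (old v) _) _.
by rewrite dist_new_old distxx (@dist_edge _ ext_connected (old v)) ?edge_old_new.
Qed.

Lemma aut_extend (s : {perm T}) : automorphism s -> s v = v ->
  exists k : {perm ext}, [/\ automorphism k, forall t, k (old t) = old (s t)
    & forall i, k (new i) = new i].
Proof.
move=> aut_s sv; pose k0 (a : ext) : ext := match a with inl t => inl (s t) | inr i => inr i end.
have k0_inj : injective k0.
  by case=> [x|i]; case=> [y|k] // [e_xy]; rewrite ?(perm_inj e_xy) ?e_xy.
exists (perm k0_inj); split=> [|t|i]; rewrite ?permE //.
apply/autP=> -[x|i] [y|k]; rewrite !permE //=; first exact: autP.
  by rewrite -{1}sv (inj_eq perm_inj).
by rewrite -{1}sv (inj_eq perm_inj).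
Qed.

Section Flip.
Variables (r : nat) (w : T).
Hypotheses (r_gt1 : 1 < r) (j_gt0 : 0 < j)
  (diamT : forall a b : T, dist a b <= r.*2.-1) (d_vw : dist v w = r.*2.-1).

Definition far_set : {set T} := [set u | dist v u == r.*2.-1].
Local Notation W := far_set.

Lemma w_far : w \in W. Proof. by rewrite inE d_vw. Qed.

(** When [v] ends a longest path of [T], the pairs of vertices of [ext] at distance
    [2 * r] consist of a new leaf and a vertex at distance [2 * r - 1] from [v]. *)
Lemma far_pair (s : {perm ext}) i u : automorphism s -> u \in W ->
  (exists i' u', [/\ u' \in W, s (new i) = new i' & s (old u) = old u']) \/
  (exists i' u', [/\ u' \in W, s (new i) = old u' & s (old u) = new i']).
Proof.
move=> aut_s; rewrite inE => /eqP d_u.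
have: dist (s (new i)) (s (old u)) = r.*2.
  by rewrite (aut_dist _ _ ext_connected aut_s) dist_new_old d_u; lia.
case: (ext_cases (s (new i))) => [[x ->]|[i' ->]];
  case: (ext_cases (s (old u))) => [[y ->]|[k ->]].
- by rewrite dist_old; have := diamT x y; lia.
- rewrite (dist_sym ext_connected) dist_new_old => d_x; by right; exists k, x; rewrite inE; split=> //; lia.
- by rewrite dist_new_old => d_y; left; exists i', y; rewrite inE; split=> //; lia.
- by have := dist_new_new i' k; lia.
Qed.

Lemma far_not_nbr u : u \in W -> edge v u = false.
Proof. by rewrite inE => /eqP d_u; apply/negP => /(dist_edge connT); lia. Qed.

Lemma aut_pin (s : {perm ext}) : automorphism s -> s (old v) = old v ->
  forall i, exists i', s (new i) = new i'.
Proof.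
move=> aut_s sv i; case: (far_pair i aut_s w_far) => [[i' [u' [_ -> _]]]|]; first by exists i'.
case=> i' [u' [u'W s_new _]]; have := autP _ aut_s (old v) (new i).
by rewrite sv s_new edge_old far_not_nbr // edge_old_new eqxx.
Qed.

(** An automorphism that moves [v] exchanges the two sides of the pairs at maximal
    distance. Such an automorphism is called a flip below. *)
Lemma aut_flip (s : {perm ext}) : automorphism s -> s (old v) != old v ->
  (forall i, exists2 u, u \in W & s (new i) = old u) /\
  (forall u, u \in W -> exists i, s (old u) = new i).
Proof.
move=> aut_s sv.
have flip i u : u \in W -> exists i' u', [/\ u' \in W, s (new i) = old u' & s (old u) = new i'].
  case/(far_pair i aut_s) => // -[i' [u' [_ s_new _]]].
  have := autP _ aut_s (old v) (new i); rewrite s_new edge_old_new eqxx.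
  case: (ext_cases (s (old v))) sv => [[x ->]|[k ->]] //.
  by rewrite edge_old_new (inj_eq old_inj) => /negPf->.
split=> [i|u uW].
  by have [i' [u' [u'W e _]]] := flip i w w_far; exists u'.
by have [i' [u' [_ _ e]]] := flip (Ordinal j_gt0) u uW; exists i'.
Qed.

Lemma aut_restrict (s : {perm ext}) : automorphism s -> s (old v) = old v ->
  exists k : {perm T}, [/\ automorphism k, k v = v & forall t, s (old t) = old (k t)].
Proof.
move=> aut_s sv.
have sVv : (s^-1)%g (old v) = old v by rewrite -{1}sv permK.
have s_old t : exists t', s (old t) = old t'.
  case: (ext_cases (s (old t))) => // -[i e_i].
  by have [i' ] := aut_pin (autV aut_s) sVv i; rewrite -e_i permK.
pose k0 t := if s (old t) is inl t' then t' else t.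
have k0E t : s (old t) = old (k0 t) by rewrite /k0; case: (s_old t) => t' ->.
have k0_inj : injective k0.
  by move=> x y e_xy; apply/old_inj/(@perm_inj _ s); rewrite !k0E e_xy.
exists (perm k0_inj); split=> [||t]; rewrite ?permE //.
  by apply/autP=> x y; rewrite !permE -edge_old -!k0E (autP _ aut_s).
by apply: old_inj; rewrite -k0E.
Qed.

Lemma card_far (s : {perm ext}) : automorphism s -> s (old v) != old v -> #|W| = j.
Proof.
move=> aut_s sv; have [s_new s_far] := aut_flip aut_s sv.
apply/eqP; rewrite eqn_leq -{2}[j]card_ord; apply/andP; split.
  have [f fE] : exists f : T -> 'I_j, forall u, u \in W -> s (old u) = new (f u).
    exists (fun u => if s (old u) is inr i then i else Ordinal j_gt0) => u /s_far[i ->].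
    by [].
  rewrite -[j]card_ord -(card_in_imset (f := f) (D := mem W)) ?max_card // => x y xW yW e_xy.
  by apply/old_inj/(@perm_inj _ s); rewrite !fE ?e_xy.
have [f fE] : exists f : 'I_j -> T, forall i, f i \in W /\ s (new i) = old (f i).
  exists (fun i => if s (new i) is inl u then u else v) => i.
  by have [u uW ->] := s_new i.
rewrite -cardsT -(card_in_imset (f := f) (D := mem [set: 'I_j])).
  by apply: subset_leq_card; apply/subsetP=> _ /imsetP[i _ ->]; case: (fE i).
move=> x y _ _ e_xy; apply/new_inj/(@perm_inj _ s).
by rewrite (fE x).2 (fE y).2 e_xy.
Qed.

Section Coloring.
Variables (D : nat) (c : {ffun T -> 'I_D}) (i0 : 'I_D).
Hypotheses (le_jD : j <= D)
  (pin_c : forall s : {perm T}, automorphism s -> s v = v -> (forall t, c (s t) = c t) -> s = 1%g)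
  (min_c : forall S : {set T}, fixing_set (v |: S) -> #|[set t | c t != i0]| <= #|S|).

(** The new leaves get distinct colours, one of them being the default colour [i0].
    This is optimal, because a fixing set contains all new leaves but one, and its
    other vertices fix [T] together with [v]. Only automorphisms moving [v] can
    preserve the colours. *)
Lemma ext_coloring : exists d : {ffun ext -> 'I_D}, [/\
    forall s : {perm ext}, automorphism s -> s (old v) = old v ->
      (forall t, d (s t) = d t) -> s = 1%g
  & forall S : {set ext}, fixing_set S -> #|[set t | d t != i0]| <= #|S|].
Proof.
pose o := Ordinal j_gt0.
(* An injection of the new leaves into the colours that maps the first to i0. *)
pose e i := tperm i0 (widen_ord le_jD o) (widen_ord le_jD i).
have e_inj : injective e by move=> x y /perm_inj /(congr1 val) /= /val_inj.
have e_o : e o = i0 by rewrite /e tpermR.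
exists [ffun a : ext => match a with inl t => c t | inr i => e i end]; split.
  move=> s aut_s sv ds; have [k [aut_k kv kE]] := aut_restrict aut_s sv.
  have k1 : k = 1%g.
    by apply: pin_c => // t; have := ds (old t); rewrite kE !ffunE.
  apply/permP => a; rewrite perm1; case: (ext_cases a) => [[x ->]|[i ->]].
    by rewrite kE k1 perm1.
  have [i' e_i'] := aut_pin aut_s sv i; have := ds (new i).
  by rewrite e_i' !ffunE => /e_inj ->.
move=> S fS.
set dd := [set _ | _].
have sub : dd \subset old @: [set t | c t != i0] :|: new @: [set i | i != o].
  apply/subsetP=> a; rewrite !inE ffunE; case: a => [x|i] d_a.
    by apply/orP; left; apply: imset_f; rewrite inE.
  apply/orP; right; apply: imset_f; rewrite inE.
  by apply: contraNneq d_a => ->; rewrite e_o.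
apply: leq_trans (subset_leq_card sub) _; apply: leq_trans (leq_card_setU _ _) _.
rewrite !card_imset; [|exact: new_inj|exact: old_inj].
pose ST := old @^-1: S; pose SL := new @^-1: S.
have subS : old @: ST :|: new @: SL \subset S.
  by apply/subsetP=> a /setUP[] /imsetP[x]; rewrite inE => x_in ->.
have disj : [disjoint old @: ST & new @: SL].
  rewrite disjoint_subset; apply/subsetP=> _ /imsetP[x _ ->]; rewrite inE.
  by apply/imsetP => -[i _].
apply: leq_trans (subset_leq_card subS); rewrite cardsU disjoint_setI0 // cards0 subn0.
rewrite !card_imset; [|exact: new_inj|exact: old_inj].
apply: leq_add.
  apply: min_c; apply/fixing_setP=> k aut_k k_fix.
  have kv : k v = v by apply: k_fix; rewrite setU11.
  have [s [aut_s s_old s_new]] := aut_extend aut_k kv.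
  have s1 : s = 1%g.
    apply: (fixing_setP _ fS) => // a; case: (ext_cases a) => [[x ->] x_in|[i ->] _] //.
    by rewrite s_old k_fix // !inE x_in orbT.
  by apply/permP=> t; apply: old_inj; rewrite -s_old s1 !perm1.
have ->: #|[set i : 'I_j | i != o]| = j.-1.
  have -> : [set i : 'I_j | i != o] = ~: [set o] by apply/setP=> i; rewrite !inE.
  by rewrite cardsC1 card_ord.
have: #|~: SL| <= 1.
  apply/card_le1_eqP=> i k; rewrite !inE => i_out k_out; apply: new_inj.
  have twin t : edge (new i) t = edge (new k) t by case: t.
  have t1 : tperm (new k) (new i) = 1%g.
    apply: (fixing_setP _ fS); first exact: twins_aut.
    by move=> a aS; rewrite tpermD //; [apply: contraNneq k_out | apply: contraNneq i_out] => ->.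
  by have := tpermL (new k) (new i); rewrite t1 perm1.
by have := cardsC SL; rewrite card_ord; lia.
Qed.

End Coloring.

End Flip.

End Ext.

(** * Recolouring twin leaves *)

Section Bundle.
Variables (G : sgraph) (D : nat).

Definition leaves_at (u : G) : {set G} := [set l | edge u l && leaf l].

Lemma leaf_nbr (u l t : G) : l \in leaves_at u -> edge l t -> t = u.
Proof.
rewrite inE edge_sym => /andP[lu /cards1P[x e_x]] lt.
have: u \in [set w | edge l w] by rewrite inE.
have: t \in [set w | edge l w] by rewrite inE.
by rewrite e_x !inE => /eqP -> /eqP ->.
Qed.

Lemma leaves_twins (u l l' t : G) : l \in leaves_at u -> l' \in leaves_at u ->
  edge l t = edge l' t.
Proof.
move=> l_in l'_in; have lu : edge l u by move: l_in; rewrite inE edge_sym => /andP[].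
have l'u : edge l' u by move: l'_in; rewrite inE edge_sym => /andP[].
by apply/idP/idP=> [/(leaf_nbr l_in)|/(leaf_nbr l'_in)] ->.
Qed.

Lemma aut_leaves (s : {perm G}) u l : automorphism s ->
  (s l \in leaves_at (s u)) = (l \in leaves_at u).
Proof.
move=> aut_s; rewrite !inE (autP _ aut_s); congr (_ && (_ == 1)).
rewrite -(card_imset [set w | edge l w] (@perm_inj _ s)); apply: eq_card => t.
apply/idP/imsetP=> [|[x]]; rewrite !inE.
  by move=> lt; exists ((s^-1)%g t); rewrite ?permKV // inE -(autP _ aut_s) permKV.
by move=> lx ->; rewrite (autP _ aut_s).
Qed.

Variables (d : {ffun G -> 'I_D}) (i0 : 'I_D) (X u u' : G).
Hypotheses
  (pin_d : forall s : {perm G}, automorphism s -> s X = X -> (forall t, d (s t) = d t) -> s = 1%g)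
  (min_d : forall S : {set G}, fixing_set S -> #|[set t | d t != i0]| <= #|S|)
  (u_pin : forall s : {perm G}, automorphism s -> s X = X -> s u = u)
  (u_flip : forall s : {perm G}, automorphism s -> s X != X -> s u = u')
  (neq_u : u != u') (X_out : X \notin leaves_at u)
  (bundle : 1 < #|leaves_at u| < D).

(** Call an automorphism that moves [X] a flip. If a flip preserves [d], then the leaves at [u] and at [u'] bear the same set of
    colours. There are fewer than [D] leaves at [u], so one of them, not of the
    default colour, can take a colour that is absent from this set. After that no flip preserves the colours, and the
    leaves at [u] still have distinct colours, hence automorphisms fixing [X] are
    still excluded. *)
Lemma bundle_good : good D G.
Proof.
case: (boolP (distinguishing d)) => [dist_d|ndist]; first by exists d, i0.
have d_inj : {in leaves_at u &, injective d}.
  move=> l l' l_in l'_in d_l; apply/eqP; apply: contraT => neq_l.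
  have twin t := leaves_twins t l_in l'_in.
  have t1 : tperm l l' = 1%g.
    apply: pin_d; first exact: twins_aut.
      by rewrite tpermD //; apply: contraNneq X_out => <-.
    by move=> t; case: tpermP => // ->.
  by have := tpermL l l'; rewrite t1 perm1 => e_l; rewrite e_l eqxx in neq_l.
have disj l : l \in leaves_at u' -> l \notin leaves_at u.
  move=> l_in; apply: contra neq_u => /leaf_nbr e_u; apply/eqP/esym/e_u.
  by move: l_in; rewrite inE edge_sym => /andP[].
have [s [aut_s ds sX]] : exists s : {perm G},
    [/\ automorphism s, forall t, d (s t) = d t & s X != X].
  case/forallPn: ndist => s; rewrite negb_imply => /andP[/andP[aut_s /forallP ds] s1].
  have {}ds t : d (s t) = d t by apply/eqP.
  by exists s; split=> //; apply: contra s1 => /eqP sX; apply/eqP/pin_d.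
have su := u_flip aut_s sX.
have colors_sub l : l \in leaves_at u' -> d l \in d @: leaves_at u.
  move=> l_in; rewrite -(permKV s l) ds; apply: imset_f.
  by rewrite -(aut_leaves _ _ aut_s) su permKV.
have [b b_out] : exists b, b \notin d @: leaves_at u.
  apply/existsP; apply: contraT; rewrite negb_exists => /forallP all_in.
  case/andP: bundle => _; rewrite -(card_in_imset d_inj) ltnNge.
  rewrite -{1}[D]card_ord subset_leq_card //.
  by apply/subsetP=> b _; have := all_in b; rewrite negbK.
have [l0 l0_in d_l0] : exists2 l, l \in leaves_at u & d l != i0.
  case/andP: bundle => /card_gt1P[x [y [x_in y_in neq_xy]]] _.
  have [d_x|] := eqVneq (d x) i0; last by exists x.
  exists y => //; apply: contra neq_xy => /eqP d_y; apply/eqP/d_inj => //.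
  by rewrite d_x.
pose d' := [ffun t => if t == l0 then b else d t].
have d'_inj : {in leaves_at u &, injective d'}.
  move=> x y x_in y_in; rewrite !ffunE.
  have [->|neq_x] := eqVneq x l0; have [->|neq_y] := eqVneq y l0 => // e_b.
  - by case/negP: b_out; rewrite e_b; apply: imset_f.
  - by case/negP: b_out; rewrite -e_b; apply: imset_f.
  - exact: d_inj.
exists d', i0; split; last first.
  move=> S /min_d; apply: leq_trans.
  rewrite [leqRHS](cardsD1 l0) inE d_l0.
  have sub : [set t | d' t != i0] \subset l0 |: ([set t | d t != i0] :\ l0).
    by apply/subsetP=> t; rewrite !inE ffunE; case: (t == l0).
  apply: leq_trans (subset_leq_card sub) _.
  by apply: leq_trans (leq_card_setU _ _) _; rewrite cards1.
apply/distinguishingP=> k aut_k d'k.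
have [kX|kX] := eqVneq (k X) X.
  have ku := u_pin aut_k kX.
  have k_l0 : k l0 = l0.
    by apply: d'_inj => //; rewrite -{1}ku aut_leaves.
  apply: pin_d => // t; have := d'k t; rewrite !ffunE -{1}k_l0 (inj_eq perm_inj).
  by case: eqP => // ->; rewrite k_l0.
have ku := u_flip aut_k kX.
have kl0_in : k l0 \in leaves_at u' by rewrite -ku aut_leaves.
have := d'k l0; rewrite !ffunE eqxx; case: eqP => [e_l0|_].
  by rewrite e_l0 in kl0_in; case/negP: (disj _ kl0_in).
by move=> e_b; rewrite -e_b colors_sub in b_out.
Qed.

End Bundle.

(** * Flips at both ends of a longest path *)

Lemma pendant_dist (T : sgraph) (w q x : T) : connected T ->
  (forall t, edge w t -> t = q) -> x != w -> dist w x = (dist q x).+1.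
Proof.
by move=> connT wq; rewrite eq_sym => /(dist_step connT)[t /wq -> ->].
Qed.

(** The vertices of [B] are leaves at a vertex fixed by [s], so the action of [s] on [B]
    can be replaced by the identity. *)
Lemma freeze_aut (G : sgraph) (s : {perm G}) (u : G) (B : {set G}) :
  automorphism s -> s u = u -> (forall b t, b \in B -> edge b t = (t == u)) ->
  (forall b, (s b \in B) = (b \in B)) ->
  exists k : {perm G}, [/\ automorphism k, {in B, forall b, k b = b}
    & forall b, b \notin B -> k b = s b].
Proof.
move=> aut_s su B_nbr sB; pose k0 t := if t \in B then t else s t.
have k0_inj : injective k0.
  move=> a b; rewrite /k0; case: ifPn => aB; case: ifPn => bB //; last exact: perm_inj.
    by move=> e_ab; rewrite e_ab sB (negPf bB) in aB.
  by move=> e_ab; rewrite -e_ab sB (negPf aB) in bB.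
have su_eq t : (s t == u) = (t == u) by rewrite -{1}su (inj_eq perm_inj).
exists (perm k0_inj); split=> [|b bB|b /negPf bB]; last 2 first.
- by rewrite permE /k0 bB.
- by rewrite permE /k0 bB.
apply/autP=> a b; rewrite !permE /k0; case: ifPn => aB; case: ifPn => bB //.
- by rewrite !B_nbr.
- by rewrite edge_sym [RHS]edge_sym !B_nbr.
- exact: autP.
Qed.

Section FlipMaps.
Variables (T : sgraph) (r : nat).
Hypotheses (treeT : is_tree T) (r_gt1 : 1 < r).
Hypothesis diamT : forall a b : T, dist a b <= r.*2.-1.
Let connT : connected T := treeT.1.

Lemma end_nbr_uniq (v w x y : T) : dist v w = r.*2.-1 -> edge v x -> edge v y -> x = y.
Proof.
move=> d_vw vx vy; apply: (closer_nbr_uniq treeT vx vy (v := w)).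
  by case: (dist_edge_step treeT w vx); have := diamT x w; lia.
by case: (dist_edge_step treeT w vy); have := diamT y w; lia.
Qed.

Lemma end_nbr (v w : T) : dist v w = r.*2.-1 ->
  exists q, edge v q /\ forall t, edge v t -> t = q.
Proof.
move=> d_vw; have neq : v != w by rewrite -(dist_eq0 connT) d_vw; lia.
have [q vq _] := dist_step connT neq; exists q; split=> // t vt.
exact: end_nbr_uniq d_vw vt vq.
Qed.

Section Half.
Variables (v w : T) (j : nat) (s : {perm ext v j}).
Hypotheses (d_vw : dist v w = r.*2.-1) (j_gt0 : 0 < j).
Hypotheses (aut_s : automorphism s) (sv : s (old v j v) != old v j v).
Local Notation W := (far_set v r).

Lemma flip_inv : (s^-1)%g (old v j v) != old v j v.
Proof. by apply: contra sv => /eqP e; rewrite -{1}e permKV. Qed.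

Lemma flip_v q : edge w q -> s (old v j v) = old v j q.
Proof.
move=> wq; have w_in : w \in W by rewrite inE d_vw.
have [_ /(_ w w_in)[i e_i]] := aut_flip connT r_gt1 j_gt0 diamT d_vw (autV aut_s) flip_inv.
have := autP _ aut_s (new v i) (old v j v); rewrite -e_i permKV e_i edge_new_old eqxx.
case: (ext_cases (s (old v j v))) => [[x ->]|[k ->]].
  rewrite edge_old => wx; congr old; apply: (end_nbr_uniq (v := w) (w := v)) wx wq.
  by rewrite dist_sym.
rewrite edge_old_new => /eqP e_w; move: d_vw; rewrite e_w distxx; lia.
Qed.

End Half.

Section Maps.
Variables (v w q : T) (j : nat) (s : {perm ext v j}).
Hypotheses (d_vw : dist v w = r.*2.-1) (j_gt0 : 0 < j) (wq : edge w q).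
Hypotheses (aut_s : automorphism s) (sv : s (old v j v) != old v j v).
Local Notation W := (far_set v r).

Lemma flip_far_nbr u : u \in W -> edge u q.
Proof.
move=> u_in; have w_in : w \in W by rewrite inE d_vw.
have [_ /(_ u u_in)[i e_i]] :=
  aut_flip connT r_gt1 j_gt0 diamT d_vw (autV aut_s) (flip_inv sv).
have := autP _ aut_s (new v i) (old v j v).
by rewrite -e_i permKV e_i edge_new_old eqxx (flip_v d_vw j_gt0 aut_s sv wq) edge_old.
Qed.

Lemma flip_half (k : {perm ext v j}) : automorphism k -> k (old v j v) != old v j v ->
  exists m : T -> T, forall u, u \notin W ->
  [/\ m u \notin W, k (old v j u) = old v j (m u), (dist v (m u)).+1 = dist w u
    & dist w (m u) = (dist v u).+1].
Proof.
move=> aut_k kv; exists (fun u => if k (old v j u) is inl t then t else u) => u u_out.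
have kVv := flip_inv kv.
have [far1 far2] := aut_flip connT r_gt1 j_gt0 diamT d_vw aut_k kv.
have [far1' far2'] := aut_flip connT r_gt1 j_gt0 diamT d_vw (autV aut_k) kVv.
case: (ext_cases (k (old v j u))) => [[x e_x]|[i e_i]]; last first.
  have [y y_in] := far1' i; rewrite -e_i permK => /old_inj e_y.
  by rewrite e_y y_in in u_out.
rewrite e_x /= -/(old v j x).
have w_in : w \in W by rewrite inE d_vw.
have x_out : x \notin W.
  by apply/negP=> /far2'[i]; rewrite -e_x permK.
have wq_uniq t : edge w t -> t = q.
  by move=> wt; apply: (end_nbr_uniq (v := w) (w := v)) wt wq; rewrite dist_sym.
have neq_x : x != w by apply: contraNneq x_out => ->.
have neq_u : u != w by apply: contraNneq u_out => ->.
have kq : k (old v j q) = old v j v.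
  by rewrite -(flip_v d_vw j_gt0 (autV aut_k) kVv wq) permKV.
split=> //; last first.
  rewrite (pendant_dist connT wq_uniq neq_x) -(dist_old v j connT) -e_x.
  rewrite -(flip_v d_vw j_gt0 aut_k kv wq) (aut_dist _ _ (ext_connected v j connT)) //.
  by rewrite dist_old.
rewrite (pendant_dist connT wq_uniq neq_u) -(dist_old v j connT) -e_x -kq.
by rewrite (aut_dist _ _ (ext_connected v j connT)) // dist_old.
Qed.

(** A flip of [ext v j] acts on the vertices of [T] that are not ends opposite to [v].
    In terms of the coordinates [(dist v u, dist w u)] it maps [(a, b)] to
    [(b - 1, a + 1)], which is the reflection of the path from [v] to [w] extended by
    a new leaf at [v]. *)
Definition flip_maps (v w : T) (m m' : T -> T) := forall u, u \notin far_set v r ->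
  [/\ m u \notin far_set v r, m' (m u) = u, (dist v (m u)).+1 = dist w u
    & dist w (m u) = (dist v u).+1].

Lemma flip_mapsP : exists m m', flip_maps v w m m' /\ flip_maps v w m' m.
Proof.
have [m mE] := flip_half aut_s sv.
have [m' m'E] := flip_half (autV aut_s) (flip_inv sv).
exists m, m'; split=> u u_out.
  have [out e_m d1 d2] := mE u u_out; split=> //.
  by have [_ e_m' _ _] := m'E _ out; apply: (@old_inj _ v j); rewrite -e_m' -e_m permK.
have [out e_m d1 d2] := m'E u u_out; split=> //.
by have [_ e_m' _ _] := mE _ out; apply: (@old_inj _ v j); rewrite -e_m' -e_m permKV.
Qed.

End Maps.

Section Coordinates.
Variables (v w u0 q : T) (m m' n n' : T -> T).
Hypotheses (d_vw : dist v w = r.*2.-1) (vu0 : edge v u0) (wq : edge w q).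
Local Notation W := (far_set v r).
Local Notation V := (far_set w r).
Hypotheses (Vu0 : forall x, x \in V -> edge x u0) (Wq : forall x, x \in W -> edge x q).

Lemma d_wv : dist w v = r.*2.-1. Proof. by rewrite dist_sym. Qed.
Lemma v_V : v \in V. Proof. by rewrite inE d_wv. Qed.
Lemma w_W : w \in W. Proof. by rewrite inE d_vw. Qed.

Lemma V_nbr x t : x \in V -> edge x t -> t = u0.
Proof.
move=> x_in xt; have xu0 := Vu0 x_in; move: x_in; rewrite inE => /eqP d_x.
by apply: (end_nbr_uniq (v := x) (w := w)) xt xu0; rewrite dist_sym.
Qed.

Lemma W_nbr x t : x \in W -> edge x t -> t = q.
Proof.
move=> x_in xt; have xq := Wq x_in; move: x_in; rewrite inE => /eqP d_x.
by apply: (end_nbr_uniq (v := x) (w := v)) xt xq; rewrite dist_sym.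
Qed.

Lemma V_dist x t : x \in V -> t != x -> dist x t = (dist u0 t).+1.
Proof. by move=> x_in; apply: pendant_dist => // y; apply: V_nbr. Qed.

Lemma W_dist x t : x \in W -> t != x -> dist x t = (dist q t).+1.
Proof. by move=> x_in; apply: pendant_dist => // y; apply: W_nbr. Qed.

Lemma V_dist2 x y : x \in V -> y \in V -> x != y -> dist x y = 2.
Proof.
move=> x_in y_in neq; rewrite V_dist // 1?eq_sym // (@dist_edge _ connT) //.
by rewrite edge_sym Vu0.
Qed.

Lemma W_dist2 x y : x \in W -> y \in W -> x != y -> dist x y = 2.
Proof.
move=> x_in y_in neq; rewrite W_dist // 1?eq_sym // (@dist_edge _ connT) //.
by rewrite edge_sym Wq.
Qed.

Lemma VW x : x \in V -> x \notin W.
Proof.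
move=> x_in; rewrite inE; have [->|neq] := eqVneq x v; first by rewrite distxx; lia.
by rewrite dist_sym // (V_dist2 x_in v_V neq); lia.
Qed.

Lemma d_u0q : dist u0 q = r.*2.-1 - 2.
Proof.
have e1 : dist v w = (dist u0 w).+1.
  by apply: V_dist; rewrite ?v_V // -(dist_eq0 connT) d_wv; lia.
have neq : u0 != w by rewrite -(dist_eq0 connT); move: d_vw; lia.
by have := W_dist w_W neq; rewrite [dist w _]dist_sym // [dist q _]dist_sym //; lia.
Qed.

Lemma u0_out : u0 \notin V /\ u0 \notin W.
Proof.
have d1 : dist v u0 = 1 by apply: dist_edge.
have d2 : dist v w = (dist u0 w).+1.
  by apply: V_dist; rewrite ?v_V // -(dist_eq0 connT) d_wv; lia.
by rewrite !inE d1 [dist w _]dist_sym //; split; lia.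
Qed.

Lemma q_out : q \notin V /\ q \notin W.
Proof.
have d1 : dist w q = 1 by apply: dist_edge.
have d2 : dist w v = (dist q v).+1.
  by apply: W_dist; rewrite ?w_W // -(dist_eq0 connT) d_vw; lia.
rewrite !inE d1 [dist v _]dist_sym //; split; first lia.
by rewrite d_wv in d2; lia.
Qed.

Lemma inner_dist x : x \notin V -> x \notin W ->
  dist v x = (dist u0 x).+1 /\ dist w x = (dist q x).+1.
Proof.
move=> xV xW; split; [apply: V_dist v_V _ | apply: W_dist w_W _].
  by apply: contraNneq xV => ->; apply: v_V.
by apply: contraNneq xW => ->; apply: w_W.
Qed.

Lemma inner_radius2 x : r = 2 -> x \notin V -> x \notin W -> x = u0 \/ x = q.
Proof.
move=> r2 xV xW; have [dv dw] := inner_dist xV xW; have dq := d_u0q.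
have lv := diamT v x; have lw := diamT w x.
move: xV xW; rewrite !inE r2 /= in lv lw dq * => xV xW.
have [/eqP|nu0] := eqVneq (dist u0 x) 0; first by rewrite dist_eq0 // => /eqP; left.
have [/eqP|nq] := eqVneq (dist q x) 0; first by rewrite dist_eq0 // => /eqP; right.
have e1 : dist u0 x = 1 by lia.
have e2 : dist q x = 1 by lia.
have u0q : edge u0 q by apply: (@dist1_edge _ connT); rewrite dq.
by case: (dist_edge_step treeT x u0q); rewrite e1 e2.
Qed.

Hypotheses (mm' : flip_maps v w m m') (nn' : flip_maps w v n n')
  (n'n : flip_maps w v n' n).
Hypothesis thin : 2 < r -> #|V| <= 2 /\ #|W| <= 2.

Lemma pair_eq (A : {set T}) (a x y : T) : #|A| <= 2 -> a \in A -> x \in A -> y \in A ->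
  dist a x = dist a y -> x = y.
Proof.
move=> le2 a_in x_in y_in d_eq; apply/eqP; apply: contraT => neq.
have neq_xa : x != a.
  apply: contraNneq neq => e_x; move/eqP: d_eq; rewrite -e_x distxx eq_sym.
  by rewrite (dist_eq0 connT).
have neq_ya : y != a.
  apply: contraNneq neq => e_y; move/eqP: d_eq; rewrite -e_y distxx.
  by rewrite (dist_eq0 connT) eq_sym.
have sub : [set a; x; y] \subset A.
  by apply/subsetP=> z; rewrite !inE -orbA => /or3P[] /eqP->.
move: le2; rewrite leqNgt => /negP[]; apply: leq_trans (subset_leq_card sub).
by rewrite setUC cardsU1 cards2 !inE negb_or neq_ya eq_sym neq [a == x]eq_sym neq_xa.
Qed.

(** The flips at [v] and at [w] are reflections about two adjacent vertices of the path
    from [v] to [w], so their composition [n \o m] is a translation by two towards [w].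
    Applying it repeatedly brings two vertices with the same coordinates to one of
    the ends, where there are not enough vertices for them to differ. For [r = 2] the
    only inner vertices are the two middle vertices of the path. *)
Lemma coord_inj x y : x \notin V -> x \notin W -> y \notin V -> y \notin W ->
  dist v x = dist v y -> dist w x = dist w y -> x = y.
Proof.
move=> xV xW yV yW ev ew; have [r_le2|r_gt2] := leqP r 2.
  have r2 : r = 2 by apply/eqP; rewrite eqn_leq r_le2.
  have [dxv _] := inner_dist xV xW; have [dyv _] := inner_dist yV yW.
  have := inner_radius2 r2 xV xW; have := inner_radius2 r2 yV yW.
  have dq := d_u0q; rewrite r2 /= in dq.
  have neq : dist u0 u0 <> dist u0 q by rewrite distxx dq.
  case=> ey; case=> ex; rewrite ?ex ?ey // in dxv dyv ev *; case: neq.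
    by rewrite -[LHS]/(dist u0 u0); lia.
  by lia.
have [leV leW] := thin r_gt2.
move ek: (dist w x) => k; elim/ltn_ind: k x y xV xW yV yW ev ew ek => k IHk x y xV xW yV yW ev ew ek.
have [mxW m'x mxv mxw] := mm' xW; have [myW m'y myv myw] := mm' yW.
suff e_m : m x = m y by rewrite -m'x e_m m'y.
have [mxV|mxV] := boolP (m x \in V).
  have myV : m y \in V by rewrite inE myw -ev -mxw; rewrite inE in mxV.
  by apply: (pair_eq leV v_V) => //; apply: succn_inj; rewrite mxv myv.
have myV : m y \notin V by rewrite inE myw -ev -mxw; rewrite inE in mxV.
have [nxV n'x nxw nxv] := nn' mxV; have [nyV n'y nyw nyv] := nn' myV.
suff e_n : n (m x) = n (m y) by rewrite -n'x e_n n'y.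
have [nxW|nxW] := boolP (n (m x) \in W).
  have nyW : n (m y) \in W.
    by move: nxW; rewrite !inE nxv nyv mxw myw ev.
  apply: (pair_eq leW w_W nxW nyW); apply: succn_inj; rewrite nxw nyw.
  by apply: succn_inj; rewrite mxv myv.
have nyW : n (m y) \notin W by move: nxW; rewrite !inE nxv nyv mxw myw ev.
have eW : dist w (n (m x)) = dist w (n (m y)).
  by apply: succn_inj; rewrite nxw nyw; apply: succn_inj; rewrite mxv myv.
apply: (IHk (dist w (n (m x)))) => //; last by rewrite nxv nyv mxw myw ev.
by rewrite -ek -mxv -nxw.
Qed.

(** The translation [n \o m] moves [x] to the end near [w]; there the statement holds
    because both ends have two vertices, and moving the reflected vertex by the same
    translation brings it to the position symmetric to [x]. *)
Lemma coord_sym_thick x : #|V| = 2 -> #|W| = 2 ->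
  exists y, dist v y = dist w x /\ dist w y = dist v x.
Proof.
move=> cV cW.
have other (A : {set T}) a : a \in A -> #|A| = 2 -> exists2 b, b \in A & b != a.
  move=> a_in cA; have: A :\ a != set0.
    by rewrite -card_gt0; have := cardsD1 a A; rewrite a_in cA; lia.
  by case/set0Pn=> b; rewrite !inE => /andP[? ?]; exists b.
have [v2 v2_in neq_v2] := other _ _ v_V cV.
have [w2 w2_in neq_w2] := other _ _ w_W cW.
have dvv2 : dist v v2 = 2 by apply: V_dist2; rewrite ?v_V // eq_sym.
have dww2 : dist w w2 = 2 by apply: W_dist2; rewrite ?w_W // eq_sym.
have WV z : z \in W -> z \notin V by apply: contraL => /VW.
move ek: (dist w x) => k; elim/ltn_ind: k x ek => k IHk x ek.
have [xW|xW] := boolP (x \in W).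
  have [e_x|neq_x] := eqVneq x w.
    by exists v; rewrite -ek e_x !distxx d_wv d_vw.
  exists v2; rewrite dvv2 -ek (W_dist2 w_W xW) 1?eq_sym //.
  by move: v2_in xW; rewrite !inE => /eqP -> /eqP ->.
have [mxW m'x mxv mxw] := mm' xW.
have n'E z : z \in W -> (dist w (n' z)).+1 = dist v z /\ dist v (n' z) = (dist w z).+1.
  by move=> zW; have [_ _ d1 d2] := n'n (WV z zW).
have leW z : dist w z <= r.*2.-1 by apply: diamT.
have [mxV|mxV] := boolP (m x \in V).
  have [e_v|neq_v] := eqVneq (m x) v.
    have [d1 d2] := n'E w w_W; exists (n' w).
    by rewrite e_v distxx d_wv in mxv mxw; rewrite distxx d_vw in d1 d2; move: mxv mxw d1 d2 ek; clear; lia.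
  have d_mx := V_dist2 v_V mxV; rewrite eq_sym in d_mx; have {}d_mx := d_mx neq_v.
  have [d1 d2] := n'E w2 w2_in; exists (n' w2).
  by move: mxV w2_in d1 d2 d_mx dww2 mxv mxw ek; rewrite !inE; clear; lia.
have [nxV n'x nxw nxv] := nn' mxV.
have [|y [yv yw]] := IHk _ _ (n (m x)) erefl; first by move: nxw mxv ek; clear; lia.
have le_x := leW x.
have yW : y \notin W by rewrite inE; move: yv nxw mxv ek le_x r_gt1; clear; lia.
have [_ _ myv myw] := mm' yW.
have myV : m y \notin V by rewrite inE; move: myw yv nxw mxv ek le_x r_gt1; clear; lia.
have [_ _ nyw nyv] := nn' myV.
by exists (n (m y)); move: yv yw myv myw nyw nyv nxw nxv mxv mxw ek; clear; lia.
Qed.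


Lemma V_inj D (c : {ffun T -> 'I_D}) : distinguishing c -> {in V &, injective c}.
Proof.
move=> dist_c x y xV yV; apply: (distinguishing_twins dist_c) => t.
by apply/idP/idP=> [/(V_nbr xV)|/(V_nbr yV)] ->; apply: Vu0.
Qed.

(** All vertices other than the leaves near [v] are determined by their coordinates, so
    the only symmetries of [ext v 1] are flips and permutations of these leaves. One
    colour on [v] breaks the flips, and the leaves get distinct colours. No smaller
    set is fixing: besides all but one of the leaves near [v] other than [v], a fixing
    set must contain a vertex that breaks a flip. *)
Lemma single_far_good D (s : {perm ext v 1}) : 1 < D -> good D T -> #|W| = 1 ->
  automorphism s -> s (old v 1 v) != old v 1 v -> good D (ext v 1).
Proof.
move=> D_gt1 [c0 [_ [dist_c0 _]]] cW aut_s sv.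
have W_w x : x \in W -> x = w.
  case/eqP/cards1P: cW => y e_W; have := w_W.
  by rewrite e_W !inE => /eqP <- /eqP.
have c0_inj := V_inj dist_c0.
have j_gt0 : 0 < 1 by [].
pose Z := V :\ v.
have Z_V z : z \in Z -> z \in V by rewrite inE => /andP[].
have Z_W z : z \in Z -> z \notin W by move/Z_V/VW.
have card_V : #|V| = #|Z|.+1 by rewrite (cardsD1 v) v_V.
have [i0 [i1 [neq_i Z_i0]]] : exists i0 i1 : 'I_D, i1 != i0 /\
    (Z = set0 \/ exists2 z, z \in Z & c0 z = i0).
  have other (i : 'I_D) : exists k, k != i.
    apply/existsP; apply: contraT; rewrite negb_exists => /forallP all_i.
    have: #|'I_D| <= 1 by apply/card_le1_eqP => x y _ _; have /negPn/eqP -> := all_i x; have /negPn/eqP -> := all_i y.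
    by rewrite card_ord leqNgt D_gt1.
  have [e_Z|/set0Pn[z zZ]] := eqVneq Z set0.
    have [i1 neq] := other (Ordinal (ltnW D_gt1)).
    by exists (Ordinal (ltnW D_gt1)), i1; split=> //; left.
  by have [i1 neq] := other (c0 z); exists (c0 z), i1; split=> //; right; exists z.
pose d : {ffun ext v 1 -> 'I_D} := [ffun a : ext v 1 => match a with
  | inl t => if t == v then i1 else if t \in V then c0 t else i0 | inr _ => i0 end].
have d_old t : d (old v 1 t) = if t == v then i1 else if t \in V then c0 t else i0.
  by rewrite ffunE.
have d_new i : d (new v i) = i0 by rewrite ffunE.
have dist_d : distinguishing d.
  apply/distinguishingP=> k aut_k dk.
  have kv : k (old v 1 v) = old v 1 v.
    apply/eqP; apply: contraT => kv; have := dk (old v 1 v).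
    rewrite (flip_v d_vw j_gt0 aut_k kv wq) !d_old eqxx.
    case: eqP => [e_q|_]; first by have := q_out; rewrite e_q v_V => -[].
    by rewrite (negPf (q_out).1) => e_i; rewrite e_i eqxx in neq_i.
  have [h [aut_h hv hE]] := aut_restrict connT r_gt1 j_gt0 diamT d_vw aut_k kv.
  have h_dist x y : dist (h x) (h y) = dist x y by apply: aut_dist.
  have hw : h w = w by apply: W_w; rewrite inE -{1}hv h_dist d_vw.
  have hV x : (h x \in V) = (x \in V) by rewrite !inE -{1}hw h_dist.
  have hW x : (h x \in W) = (x \in W) by rewrite !inE -{1}hv h_dist.
  have h1 x : h x = x.
    have [xV|xV] := boolP (x \in V).
      have [->//|neq_x] := eqVneq x v.
      apply: c0_inj; rewrite ?hV //; have := dk (old v 1 x).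
      rewrite hE !d_old hV xV (negPf neq_x) -{1}hv (inj_eq perm_inj).
      by rewrite (negPf neq_x).
    have [/W_w ->//|xW] := boolP (x \in W).
    apply: coord_inj; rewrite ?hV ?hW //; first by rewrite -{1}hv h_dist.
    by rewrite -{1}hw h_dist.
  apply/permP=> a; rewrite perm1; case: (ext_cases a) => [[x ->]|[i ->]].
    by rewrite hE h1.
  by have [i' ->] := aut_pin connT r_gt1 j_gt0 diamT d_vw aut_k kv i; rewrite !ord1.
exists d, i0; split=> // S fS.
have card_d : #|[set a | d a != i0]| <= #|Z|.-1.+1.
  pose Z' := [set z in Z | c0 z != i0].
  have sub : [set a | d a != i0] \subset old v 1 v |: (old v 1 @: Z').
    apply/subsetP=> a; rewrite !inE; case: (ext_cases a) => [[x ->]|[i ->]].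
      rewrite d_old (inj_eq (@old_inj _ _ _)) (mem_imset _ _ (@old_inj _ _ _)) !inE.
      by case: (x == v) => //=; case: (dist w x == _) => //=; rewrite eqxx.
    by rewrite d_new eqxx.
  apply: leq_trans (subset_leq_card sub) _; apply: leq_trans (leq_card_setU _ _) _.
  rewrite cards1 add1n ltnS card_imset; last exact: old_inj.
  case: Z_i0 => [e_Z|[z zZ e_z]].
    rewrite (_ : Z' = set0) ?cards0 //.
    by apply/setP=> x; rewrite !inE; move/setP/(_ x): e_Z; rewrite !inE => ->.
  rewrite (cardsD1 z Z) zZ add1n; apply: subset_leq_card; apply/subsetP=> x.
  by rewrite !inE => /andP[-> c0x]; rewrite andbT; apply: contraNneq c0x => ->; rewrite e_z.
apply: leq_trans card_d _; pose SZ := [set z in Z | old v 1 z \in S].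
have card_SZ : #|Z| <= #|SZ|.+1.
  have: #|Z :\: SZ| <= 1.
    apply/card_le1_eqP=> x y; rewrite !inE => /andP[xS /andP[neq_x xV]] /andP[yS /andP[neq_y yV]].
    have xVr : x \in V by rewrite inE.
    have yVr : y \in V by rewrite inE.
    rewrite neq_x neq_y xV yV /= in xS yS.
    have twin t : edge (old v 1 x) t = edge (old v 1 y) t.
      case: (ext_cases t) => [[z ->]|[i ->]].
        rewrite !edge_old.
        by apply/idP/idP=> [/(V_nbr xVr)|/(V_nbr yVr)] ->; apply: Vu0.
      by rewrite !edge_old_new (negPf neq_x) (negPf neq_y).
    have t1 : tperm (old v 1 y) (old v 1 x) = 1%g.
      apply: (fixing_setP _ fS); first exact: twins_aut.
      by move=> a aS; rewrite tpermD //; [apply: contraNneq yS|apply: contraNneq xS] => ->.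
    by apply: (@old_inj _ v 1); have := tpermL (old v 1 y) (old v 1 x); rewrite t1 perm1.
  have := cardsID SZ Z; have := subset_leq_card (subsetIr Z SZ); clear; lia.
have subS : old v 1 @: SZ \subset S.
  by apply/subsetP=> _ /imsetP[z zSZ ->]; move: zSZ; rewrite inE => /andP[].
have e_SZ : #|old v 1 @: SZ| = #|SZ| by apply/card_imset/old_inj.
have [eS|neqS] := eqVneq (old v 1 @: SZ) S; last first.
  have: old v 1 @: SZ \proper S by rewrite properEneq neqS.
  by move/proper_card; rewrite e_SZ; move: card_SZ; clear; lia.
have [le_Z|lt_SZ] := leqP #|Z|.-1.+1 #|SZ|; first by rewrite -eS e_SZ.
have [k [aut_k k_v k_Z]] : exists k : {perm ext v 1}, [/\ automorphism k,
    k (old v 1 v) != old v 1 v & forall z, z \in SZ -> k (old v 1 z) = old v 1 z].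
  have [r_le2|r_gt2] := leqP r 2; last first.
    have [Z_le1 _] := thin r_gt2; rewrite card_V ltnS in Z_le1.
    have /cards0_eq SZ0 : #|SZ| = 0 by move: lt_SZ Z_le1; clear; lia.
    by exists s; split=> // z; rewrite SZ0 inE.
  (* For r = 2 the vertex u0 is the center of ext v 1: the flip fixes it and
     permutes the other leaves at u0. Stopping it there gives k. *)
  have r2 : r = 2 by apply/eqP; rewrite eqn_leq r_le2.
  have [m0 m0E] := flip_half d_vw j_gt0 wq aut_s sv.
  have s_u0 : s (old v 1 u0) = old v 1 u0.
    have [_ -> d1 _] := m0E u0 u0_out.2; congr old; apply: (V_nbr v_V).
    apply: (dist1_edge connT); have := W_dist w_W (t := u0).
    rewrite dist_sym // [dist q _]dist_sym // d_u0q r2 /= => e_w.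
    by move: d1; rewrite [dist w _]dist_sym // e_w => [[]|] //; apply: contraTneq w_W => <-; exact: u0_out.2.
  pose B := old v 1 @: Z.
  have s_B b : b \in B -> s b \in B.
    case/imsetP=> z zZ ->; have [_ -> d1 d2] := m0E z (Z_W z zZ).
    apply: imset_f; move: (zZ); rewrite !inE => /andP[neq_z /eqP d_z].
    have dvz : dist v z = 2 by apply: V_dist2; rewrite ?v_V ?Z_V // eq_sym.
    rewrite d2 dvz r2 /= andbT; apply/eqP => e_m.
    by rewrite e_m distxx d_z r2 in d1.
  have e_B : s @: B = B.
    apply/eqP; rewrite eqEcard card_imset ?leqnn ?andbT; last exact: perm_inj.
    by apply/subsetP=> _ /imsetP[b bB ->]; apply: s_B.
  have [||k [aut_k k_in k_out]] := @freeze_aut _ s (old v 1 u0) B aut_s s_u0.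
  - move=> b t /imsetP[z zZ ->]; have zV := Z_V z zZ.
    have neq_z : (z == v) = false by move: zZ; rewrite in_setD1 => /andP[/negPf].
    case: (ext_cases t) => [[x ->]|[i ->]]; last first.
      by rewrite edge_old_new neq_z; apply/esym/negbTE/eqP.
    rewrite edge_old (inj_eq (@old_inj _ _ _)).
    by apply/idP/eqP=> [/(V_nbr zV) //|->]; apply: Vu0.
  - by move=> b; rewrite -{1}e_B mem_imset //; apply: perm_inj.
  exists k; split=> // [|z]; last first.
    by rewrite inE => /andP[zZ _]; apply/k_in/imset_f.
  rewrite k_out //; apply/imsetP=> -[z zZ /old_inj e_z].
  by move: zZ; rewrite -e_z !inE eqxx.
have k1 : k = 1%g.
  apply: (fixing_setP _ fS) => // a; rewrite -eS => /imsetP[z zSZ ->].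
  exact: k_Z.
by rewrite k1 perm1 eqxx in k_v.
Qed.

Lemma coord_sym D x : #|V| = D -> #|W| = D -> (2 < r -> D = 2) ->
  x \notin V -> x \notin W -> exists y,
  [/\ y \notin V, y \notin W, dist v y = dist w x & dist w y = dist v x].
Proof.
move=> cV cW D2 xV xW; have [r_le2|r_gt2] := leqP r 2; last first.
  move: cV cW; rewrite D2 // => cV cW; have [y [yv yw]] := coord_sym_thick x cV cW.
  by exists y; rewrite !inE yv yw; move: xV xW; rewrite !inE.
have r2 : r = 2 by apply/eqP; rewrite eqn_leq r_le2.
have [u0V u0W] := u0_out; have [qV qW] := q_out.
have [d1 d2] := inner_dist u0V u0W; have [d3 d4] := inner_dist qV qW.
have dq := d_u0q; rewrite distxx in d1; rewrite distxx in d4.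
rewrite [dist q u0]dist_sym // in d2.
case: (inner_radius2 r2 xV xW) => ->; [exists q | exists u0]; split=> //.
all: by rewrite ?d1 ?d2 ?d3 ?d4 ?dq.
Qed.

(** An optimal colouring uses all [D] colours on the leaves near [v], all [D] colours on
    the leaves near [w], and the default colour elsewhere, since those leaves without
    the two of default colour form a fixing set. Reflecting inner vertices by
    coordinates and matching the leaves of both ends by colour then gives a nontrivial
    automorphism that preserves the colours. *)
Lemma full_ends_not_good D : 1 < D -> good D T -> #|V| = D -> #|W| = D ->
  (2 < r -> D = 2) -> False.
Proof.
move=> D_gt1 [c0 [i0 [dist_c0 min_c0]]] cV cW D2.
have injV := V_inj dist_c0.
have injW : {in W &, injective c0}.
  move=> x y xW yW; apply: (distinguishing_twins dist_c0) => t.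
  by apply/idP/idP=> [/(W_nbr xW)|/(W_nbr yW)] ->; apply: Wq.
have onto (A : {set T}) i : #|A| = D -> {in A &, injective c0} -> exists2 a, a \in A & c0 a = i.
  move=> cA injA; have: c0 @: A = setT.
    by apply/eqP; rewrite eqEcard subsetT cardsT card_ord card_in_imset // cA /=.
  move/setP/(_ i); rewrite inE => /imsetP[a aA ->]; by exists a.
have V_q x : (x \in V) = (dist q x == r.*2.-1.-1).
  rewrite inE; have [->|neq_x] := eqVneq x w.
    by rewrite distxx dist_sym // (dist_edge connT wq); lia.
  by rewrite (W_dist w_W neq_x); lia.
have W_u0 x : (x \in W) = (dist u0 x == r.*2.-1.-1).
  rewrite inE; have [->|neq_x] := eqVneq x v.
    by rewrite distxx dist_sym // (dist_edge connT vu0); lia.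
  by rewrite (V_dist v_V neq_x); lia.
have [lv lv_in c_lv] := onto V i0 cV injV; have [lw lw_in c_lw] := onto W i0 cW injW.
pose S0 := (V :\ lv) :|: (W :\ lw).
have another (A : {set T}) a : #|A| = D -> a \in A -> exists b, b \in A :\ a.
  move=> cA aA; apply/set0Pn; rewrite -card_gt0.
  by have := cardsD1 a A; rewrite aA cA; lia.
have fixS0 : fixing_set S0.
  apply/fixing_setP=> s aut_s s_fix.
  have [v1 v1_in] := another _ _ cV lv_in; have [w1 w1_in] := another _ _ cW lw_in.
  have v1V : v1 \in V by move: v1_in; rewrite inE => /andP[].
  have w1W : w1 \in W by move: w1_in; rewrite inE => /andP[].
  have su0 : s u0 = u0.
    apply: (V_nbr v1V); rewrite -{1}(s_fix v1) ?(autP _ aut_s) ?Vu0 //.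
    by rewrite inE v1_in.
  have sq : s q = q.
    apply: (W_nbr w1W); rewrite -{1}(s_fix w1) ?(autP _ aut_s) ?Wq //.
    by rewrite inE w1_in orbT.
  have s_dist x y : dist (s x) (s y) = dist x y by apply: aut_dist.
  have sV x : (s x \in V) = (x \in V) by rewrite !V_q -{1}sq s_dist.
  have sW x : (s x \in W) = (x \in W) by rewrite !W_u0 -{1}su0 s_dist.
  have s_last (A : {set T}) a : a \in A -> (forall x, (s x \in A) = (x \in A)) ->
      (forall x, x \in A :\ a -> s x = x) -> {in A, forall x, s x = x}.
    move=> aA sA s_rest x xA; have [->|neq_x] := eqVneq x a; last first.
      by apply: s_rest; rewrite !inE neq_x.
    have [//|neq_a] := eqVneq (s a) a; apply: (@perm_inj _ s).
    by apply: s_rest; rewrite in_setD1 neq_a sA.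
  apply/permP=> x; rewrite perm1.
  have [xV|xV] := boolP (x \in V).
    by apply: (s_last V lv) => // y y_in; apply: s_fix; rewrite inE y_in.
  have [xW|xW] := boolP (x \in W).
    by apply: (s_last W lw) => // y y_in; apply: s_fix; rewrite inE y_in orbT.
  have [d1 d2] := inner_dist xV xW.
  have sxV : s x \notin V by rewrite sV.
  have sxW : s x \notin W by rewrite sW.
  have [d3 d4] := inner_dist sxV sxW.
  apply: coord_inj => //.
    by rewrite d1 d3 -{1}su0 s_dist.
  by rewrite d2 d4 -{1}sq s_dist.
have e_S0 : [set x | c0 x != i0] = S0.
  apply/esym/eqP; rewrite eqEcard min_c0 // andbT; apply/subsetP=> x; rewrite !inE.
  case/orP=> /andP[neq_x x_in]; apply: contra neq_x => /eqP c_x; apply/eqP.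
    by apply: injV; rewrite ?c_x ?c_lv // inE.
  by apply: injW; rewrite ?c_x ?c_lw // inE.
have c_inner x : x \notin V -> x \notin W -> c0 x = i0.
  move=> xV xW; apply/eqP/negPn/negP => c_x.
  have: x \in S0 by rewrite -e_S0 inE.
  by rewrite in_setU !in_setD1 (negPf xV) (negPf xW) !andbF.
have WV z : z \in W -> z \notin V by apply: contraL => /VW.
(* The graph of the reflection. *)
pose R t u := if t \in V then (u \in W) && (c0 u == c0 t)
  else if t \in W then (u \in V) && (c0 u == c0 t)
  else [&& u \notin V, u \notin W, dist v u == dist w t & dist w u == dist v t].
have R_sym t u : R t u -> R u t.
  rewrite /R; case: (boolP (t \in V)) => tV.
    by case/andP=> uW c_u; rewrite (negPf (WV _ uW)) uW eq_sym c_u.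
  case: (boolP (t \in W)) => tW.
    by case/andP=> -> c_u; rewrite eq_sym c_u.
  case/and4P=> /negPf -> /negPf -> e1 e2.
  by rewrite ?tV ?tW /= eq_sym e2 eq_sym e1.
have R_ex t : exists u, R t u.
  rewrite /R; case: (boolP (t \in V)) => tV.
    by have [u uW c_u] := onto W (c0 t) cW injW; exists u; rewrite uW c_u eqxx.
  case: (boolP (t \in W)) => tW.
    by have [u uV c_u] := onto V (c0 t) cV injV; exists u; rewrite uV c_u eqxx.
  have [u [uV uW e1 e2]] := coord_sym cV cW D2 tV tW.
  by exists u; rewrite uV uW e1 e2 !eqxx.
have R_uniq t u x : R t u -> R t x -> u = x.
  rewrite /R; case: (boolP (t \in V)) => tV.
    by case/andP=> uW /eqP c_u /andP[xW /eqP c_x]; apply: injW => //; rewrite c_u.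
  case: (boolP (t \in W)) => tW.
    by case/andP=> uV /eqP c_u /andP[xV /eqP c_x]; apply: injV => //; rewrite c_u.
  case/and4P=> uV uW /eqP e1 /eqP e2 /and4P[xV xW /eqP e3 /eqP e4].
  by apply: coord_inj; rewrite ?e1 ?e2.
have [f fR] := fin_all_exists R_ex.
have fK : involutive f by move=> t; apply: (R_uniq (f t)) => //; apply: R_sym.
have [u0V u0W] := u0_out; have [qV qW] := q_out.
have f_u0 : f u0 = q.
  apply: (R_uniq u0) (fR u0) _; rewrite /R (negPf u0V) (negPf u0W) qV qW /=.
  have [d1 d2] := inner_dist u0V u0W; have [d3 d4] := inner_dist qV qW.
  by rewrite d1 d2 d3 d4 !distxx [dist q u0]dist_sym ?eqxx.
have f_q : f q = u0 by rewrite -f_u0 fK.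
have f_inner t : t \notin V -> t \notin W ->
    [/\ f t \notin V, f t \notin W, dist v (f t) = dist w t & dist w (f t) = dist v t].
  move=> tV tW; have := fR t; rewrite /R (negPf tV) (negPf tW).
  by case/and4P=> ? ? /eqP ? /eqP ?.
have edge_ends t t' : (t \in V) || (t \in W) -> edge t t' -> edge (f t) (f t').
  move=> t_VW tt'; have := fR t; rewrite /R; case: (boolP (t \in V)) t_VW => tV /= => [_|tW].
    by case/andP=> ft_W _; rewrite (V_nbr tV tt') f_u0 Wq.
  by rewrite tW => /andP[ft_V _]; rewrite (W_nbr tW tt') f_q Vu0.
have towards (x y : T) : x != y -> exists z, [/\ edge x z, y \in branch x z & dist y x = (dist y z).+1].
  move=> neq; have [z xz d_z] := dist_step connT neq; exists z; split=> //.
    by apply: (branch_toward treeT xz); rewrite d_z.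
  by rewrite dist_sym // d_z [dist y z]dist_sym.
have not_ends t : t \notin V -> t \notin W -> t != v /\ t != w.
  by move=> tV tW; split; [apply: contraNneq tV|apply: contraNneq tW] => ->; rewrite ?v_V ?w_W.
(* An inner vertex off the path from v to w has the same neighbour towards v
   and towards w, while on the path dist v t + dist w t is minimal; this determines
   the coordinates of the neighbour that f t has towards v or w. *)
have f_edge t t' : t \notin V -> t \notin W -> t' \notin V -> t' \notin W ->
    edge t t' -> dist v t = (dist v t').+1 -> edge (f t) (f t').
  move=> tV tW t'V t'W tt' d_v.
  have [ftV ftW fv fw] := f_inner t tV tW; have [ft'V ft'W fv' fw'] := f_inner t' t'V t'W.
  have [neq_ftv neq_ftw] := not_ends _ ftV ftW.
  have [z1 [fz1 v_z1 d_z1]] := towards _ _ neq_ftv.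
  have [z2 [fz2 w_z2 d_z2]] := towards _ _ neq_ftw.
  have vw_le x : dist v w <= dist v x + dist w x.
    by rewrite [dist w x]dist_sym //; apply: dist_triangle.
  have same z : dist v z = dist v (f t') -> dist w z = dist w (f t') -> z = f t'.
    move=> e1 e2; apply: coord_inj => //.
      by move: ft'V; rewrite !inE e2.
    by move: ft'W; rewrite !inE e1.
  have d_wt := dist_edge_step treeT w tt'.
  rewrite [dist t w]dist_sym // [dist t' w]dist_sym // in d_wt.
  case: d_wt => d_w.
    have [e_z|neq_z] := eqVneq z1 z2.
      have e1 : dist v z1 = dist v (f t') by move: d_z1 fv fv' d_w; clear; lia.
      have e2 : dist w z1 = dist w (f t').
        by rewrite e_z; move: d_z2 fw fw' d_v; clear; lia.
      by rewrite -(same z1).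
    have := dist_via treeT fz1 fz2 neq_z v_z1 w_z2; have := vw_le t'.
    by rewrite [dist (f t) w]dist_sym //; move: fv fw d_w d_v; clear; lia.
  have d_vz2 := dist_edge_step treeT v fz2.
  rewrite [dist (f t) v]dist_sym // [dist z2 v]dist_sym // in d_vz2.
  case: d_vz2 => d_v2; last first.
    have e1 : dist v z2 = dist v (f t') by move: d_v2 fv fv' d_w; clear; lia.
    have e2 : dist w z2 = dist w (f t') by move: d_z2 fw fw' d_v; clear; lia.
    by rewrite -(same z2).
  have [_ neq_tw] := not_ends _ tV tW; have [z3 [tz3 w_z3 d_z3]] := towards _ _ neq_tw.
  have v_t' : v \in branch t t'.
    by apply: (branch_toward treeT tt'); rewrite ![dist _ v]dist_sym // d_v.
  have neq_z3 : t' != z3.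
    apply/eqP=> e_z; rewrite -e_z in d_z3.
    by move: d_z3 d_w; clear; lia.
  have := dist_via treeT tt' tz3 neq_z3 v_t' w_z3; have := vw_le z2.
  by rewrite [dist t w]dist_sym //; move: d_v2 d_z2 fv fw; clear; lia.
have imp t t' : edge t t' -> edge (f t) (f t').
  move=> tt'; have [t_VW|] := boolP ((t \in V) || (t \in W)); first exact: edge_ends.
  have [t'_VW|] := boolP ((t' \in V) || (t' \in W)).
    by rewrite edge_sym => _; apply: edge_ends; rewrite // edge_sym.
  rewrite !negb_or => /andP[t'V t'W] /andP[tV tW].
  have := dist_edge_step treeT v tt'.
  rewrite [dist t v]dist_sym // [dist t' v]dist_sym //.
  case=> d_v; first exact: f_edge.
  by rewrite edge_sym; apply: f_edge; rewrite // edge_sym.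
have f1 : perm (inv_inj fK) = 1%g.
  apply: (distinguishingP c0 dist_c0) => [|t]; last first.
    rewrite permE; have := fR t; rewrite /R; case: ifPn => tV; first by case/andP=> _ /eqP.
    case: ifPn => tW; first by case/andP=> _ /eqP.
    by case/and4P=> ftV ftW _ _; rewrite !c_inner.
  apply/autP=> a b; rewrite !permE; apply/idP/idP; last exact: imp.
  by move/imp; rewrite !fK.
have := fR v; rewrite /R v_V => /andP[].
have := permE (inv_inj fK) v; rewrite f1 perm1 => <- vW.
by rewrite (negPf (VW v_V)) in vW.
Qed.

End Coordinates.
End FlipMaps.

(** * Choosing the end of a tree of odd diameter *)

Section BicentralRoot.
Variables (T : sgraph) (r D : nat).
Hypotheses (treeT : is_tree T) (r_gt1 : 1 < r) (D_gt1 : 1 < D).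
Hypothesis diamT : forall a b : T, dist a b <= r.*2.-1.
Hypothesis goodT : good D T.
Let connT : connected T := treeT.1.

Section OneEnd.
Variables (v w u0 q : T) (j : nat).
Hypotheses (d_vw : dist v w = r.*2.-1) (vu0 : edge v u0) (wq : edge w q)
  (j_gt0 : 0 < j).

Let v_uniq t : edge v t -> t = u0.
Proof. by move=> vt; apply: (end_nbr_uniq treeT r_gt1 diamT d_vw). Qed.

Let w_uniq t : edge w t -> t = q.
Proof. by move=> wt; apply: (end_nbr_uniq treeT r_gt1 diamT (v := w) (w := v)); rewrite // dist_sym. Qed.

Let d_u0w : dist u0 w = r.*2.-1.-1.
Proof.
have neq : w != v by rewrite eq_sym -(dist_eq0 connT) d_vw; move: r_gt1; clear; lia.
by have := pendant_dist connT v_uniq neq; rewrite d_vw => ->.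
Qed.

Let d_vq : dist v q = r.*2.-1.-1.
Proof.
have neq : v != w by rewrite -(dist_eq0 connT) d_vw; move: r_gt1; clear; lia.
by have := pendant_dist connT w_uniq neq; rewrite dist_sym // d_vw dist_sym // => ->.
Qed.

Lemma leaf_end : leaf v.
Proof.
apply/cards1P; exists u0; apply/setP=> t; rewrite !inE.
by apply/idP/eqP=> [/v_uniq|->].
Qed.

Let u0_next : exists2 z, edge u0 z & z != v.
Proof.
have neq : u0 != w by rewrite -(dist_eq0 connT) d_u0w; move: r_gt1; clear; lia.
have [z u0z d_z] := dist_step connT neq; exists z => //.
by apply/eqP=> e_z; move: d_z r_gt1; rewrite e_z d_vw d_u0w; clear; lia.
Qed.

Let u0_neq_v : u0 != v.
Proof. by apply: contraTneq vu0 => ->; rewrite edge_irrefl. Qed.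

Let not_leaf (G : sgraph) (a b c : G) : edge a b -> edge a c -> b != c -> leaf a = false.
Proof.
move=> ab ac neq; apply/negbTE/cards1P=> -[x /setP e_x]; move: (e_x b) (e_x c).
by rewrite !inE ab ac => /esym/eqP e_b /esym/eqP e_c; rewrite e_b e_c eqxx in neq.
Qed.

Lemma leaves_at_end : leaves_at (old v j v) = @new T v j @: setT.
Proof.
have [z u0z neq_z] := u0_next.
apply/setP=> a; rewrite inE; case: (ext_cases a) => [[x ->]|[i ->]]; last first.
  rewrite edge_old_new eqxx imset_f //=; apply/cards1P; exists (old v j v).
  apply/setP=> b; rewrite !inE; case: (ext_cases b) => [[y ->]|[k ->]].
    by rewrite edge_new_old (inj_eq (@old_inj _ _ _)).
  by rewrite edge_new_new; apply/esym/negbTE/eqP.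
rewrite edge_old; apply/andP/imsetP=> [[/v_uniq ->]|[i _ //]].
rewrite (@not_leaf _ (old v j u0) (old v j v) (old v j z)) //.
- by rewrite edge_old edge_sym.
- by rewrite (inj_eq (@old_inj _ _ _)) eq_sym.
Qed.

Lemma leaf_old x : x != v -> leaf (old v j x) = leaf x.
Proof.
move=> neq_x; rewrite /leaf; congr (_ == 1).
rewrite -(card_imset [set w | edge x w] (@old_inj T v j)); apply: eq_card => a.
rewrite inE; case: (ext_cases a) => [[y ->]|[i ->]].
  by rewrite edge_old mem_imset ?inE //; apply: old_inj.
by rewrite edge_old_new (negPf neq_x); apply/esym/imsetP => -[y _ //].
Qed.

Lemma end_not_leaf : leaf (old v j v) = false.
Proof.
apply: (@not_leaf _ _ (old v j u0) (new v (Ordinal j_gt0))) => //.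
by rewrite edge_old_new.
Qed.

Lemma leaves_at_nbr : leaves_at (old v j u0) = old v j @: (leaves_at u0 :\ v).
Proof.
apply/setP=> a; rewrite inE; case: (ext_cases a) => [[x ->]|[i ->]]; last first.
  by rewrite edge_old_new (negPf u0_neq_v) /=; apply/esym/imsetP => -[y _ //].
rewrite edge_old mem_imset ?inE; last exact: old_inj.
have [->|neq_x] := eqVneq x v; first by rewrite end_not_leaf andbF.
by rewrite leaf_old.
Qed.

Lemma flip_nbr_uniq (k k' : {perm ext v j}) : automorphism k -> automorphism k' ->
  k (old v j v) != old v j v -> k' (old v j v) != old v j v ->
  k (old v j u0) = k' (old v j u0) /\
  (2 < r -> k (old v j u0) != old v j u0).
Proof.
have u0W : u0 \notin far_set v r.
  by rewrite inE (dist_edge connT vu0); move: r_gt1; clear; lia.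
have img (k1 : {perm ext v j}) : automorphism k1 -> k1 (old v j v) != old v j v ->
    exists x, [/\ k1 (old v j u0) = old v j x, dist v x = r.*2.-1.-2 & edge q x].
  move=> aut_k1 k1v.
  have [m mE] := flip_half treeT r_gt1 diamT d_vw j_gt0 wq aut_k1 k1v.
  have [mW e_m d1 d2] := mE u0 u0W; exists (m u0); split=> //.
    by move: d1; rewrite [dist w u0]dist_sym // d_u0w => <-.
  have neq_m : m u0 != w by apply: contraNneq mW => ->; rewrite inE d_vw.
  apply: (dist1_edge connT); move: d2.
  by rewrite (pendant_dist connT w_uniq neq_m) (dist_edge connT vu0) => -[].
move=> aut_k aut_k' kv k'v; have [x [-> dx qx]] := img k aut_k kv.
have [y [-> dy qy]] := img k' aut_k' k'v; split.
  congr old; apply: (closer_nbr_uniq treeT qx qy (v := v)); rewrite ![dist _ v]dist_sym //.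
    by rewrite dx d_vq; move: r_gt1; clear; lia.
  by rewrite dy d_vq; move: r_gt1; clear; lia.
move=> r_gt2; rewrite (inj_eq (@old_inj _ _ _)); apply/eqP=> e_x.
by move: dx; rewrite e_x (dist_edge connT vu0); move: r_gt2; clear; lia.
Qed.

(** The colouring of [ext_coloring] can only be preserved by flips, so there is one. The
    [j] new leaves at [v], or the leaves of [T] near [v] other than [v], are bundles of twins that the
    flips move, and [bundle_good] applies to a bundle of size between 2 and [D - 1].
    The second bundle is moved only if [2 < r]: for [r = 2] it hangs from the center. *)
Lemma bad_end : j <= D -> ~ good D (ext v j) ->
  [/\ exists s : {perm ext v j}, automorphism s /\ s (old v j v) != old v j v,
      j = 1 \/ j = D & 2 < r -> #|leaves_at u0| <= 2].
Proof.
move=> le_jD bad; have r_gt0 : 0 < r by apply: ltnW.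
have [c [i0 [c_v pin_c min_c]]] := pinned_coloring treeT r_gt0 diamT d_vw goodT.
have [d [pin_d min_d]] := ext_coloring connT r_gt1 j_gt0 diamT d_vw le_jD pin_c min_c.
have [s [aut_s sv]] : exists s : {perm ext v j}, automorphism s /\ s (old v j v) != old v j v.
  apply: NNPP => none; apply: bad; exists d, i0; split=> //.
  apply/distinguishingP=> s aut_s ds; apply: pin_d => //.
  by apply/eqP/negPn/negP => sv; apply: none; exists s.
have qv : q != v.
  by rewrite eq_sym -(dist_eq0 connT) d_vq; move: r_gt1; clear; lia.
split; first by exists s.
  have [->|neq1] := eqVneq j 1; first by left.
  have [->|neqD] := eqVneq j D; first by right.
  case: bad; apply: (bundle_good (X := old v j v) (u := old v j v) (u' := old v j q) pin_d min_d) => //.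
  - by move=> k aut_k kv; apply: (flip_v treeT r_gt1 diamT d_vw j_gt0 aut_k kv wq).
  - by rewrite (inj_eq (@old_inj _ _ _)) eq_sym.
  - by rewrite inE edge_irrefl.
  - rewrite leaves_at_end card_imset; last exact: new_inj.
    by rewrite cardsT card_ord; move: neq1 neqD j_gt0 le_jD; clear; lia.
move=> r_gt2; rewrite leqNgt; apply/negP => many.
have [c0 [_ [dist_c0 _]]] := goodT.
have le_D : #|leaves_at u0| <= D.
  rewrite -[leqRHS]card_ord -(card_in_imset (f := c0) (D := mem (leaves_at u0))) ?max_card //.
  by move=> x y x_in y_in; apply: (distinguishing_twins dist_c0) => t; apply: leaves_twins x_in y_in.
have v_in : v \in leaves_at u0 by rewrite inE edge_sym vu0 leaf_end.
case: bad; apply: (bundle_good (X := old v j v) (u := old v j u0)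
  (u' := s (old v j u0)) pin_d min_d) => //.
- move=> k aut_k kv; have [h [aut_h hv hE]] := aut_restrict connT r_gt1 j_gt0 diamT d_vw aut_k kv.
  by rewrite hE; congr old; apply: v_uniq; rewrite -{1}hv (autP _ aut_h).
- by move=> k aut_k kv; have [] := flip_nbr_uniq aut_k aut_s kv sv.
- by have [_] := flip_nbr_uniq aut_s aut_s sv sv; rewrite eq_sym; apply.
- by rewrite inE end_not_leaf andbF.
- rewrite leaves_at_nbr card_imset; last exact: old_inj.
  by move: many le_D; rewrite (cardsD1 v) v_in; clear; lia.
Qed.

End OneEnd.

(** If both ends [v] and [w] fail, then [bad_end] describes both, and the numbers of
    ends opposite to [v] and to [w] are 1 or [D]. If one of them is 1, the
    corresponding end does not fail, by [single_far_good]. If both are [D], then [T] is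
    not good, by [full_ends_not_good]. *)
Lemma bicentral_root (v w : T) : dist v w = r.*2.-1 ->
  exists v' w' : T, dist v' w' = r.*2.-1 /\
    forall j, 0 < j <= D -> good D (ext v' j).
Proof.
move=> d_vw; have d_wv : dist w v = r.*2.-1 by rewrite dist_sym.
case: (classic (forall j, 0 < j <= D -> good D (ext v j))) => [|bad_v].
  by exists v, w.
case: (classic (forall j, 0 < j <= D -> good D (ext w j))) => [|bad_w].
  by exists w, v.
have ex_bad x : ~ (forall j, 0 < j <= D -> good D (ext x j)) ->
    exists j, [/\ 0 < j, j <= D & ~ good D (@ext T x j)].
  move=> bad; apply: NNPP => none; apply: bad => j /andP[j_gt0 le_jD].
  by apply: NNPP => bad_j; apply: none; exists j.
have [j [j_gt0 le_jD bad_j]] := ex_bad v bad_v.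
have [j' [j'_gt0 le_j'D bad_j']] := ex_bad w bad_w.
have [u0 [vu0 _]] := end_nbr treeT r_gt1 diamT d_vw.
have [q [wq _]] := end_nbr treeT r_gt1 diamT d_wv.
have [[s [aut_s sv]] j_1D leaves_v] := bad_end d_vw vu0 wq j_gt0 le_jD bad_j.
have [[s' [aut_s' s'w]] j'_1D leaves_w] := bad_end d_wv wq vu0 j'_gt0 le_j'D bad_j'.
have Wq x : x \in far_set v r -> edge x q.
  exact: (flip_far_nbr treeT r_gt1 diamT d_vw j_gt0 wq aut_s sv).
have Vu0 x : x \in far_set w r -> edge x u0.
  exact: (flip_far_nbr treeT r_gt1 diamT d_wv j'_gt0 vu0 aut_s' s'w).
have cW : #|far_set v r| = j := card_far connT r_gt1 j_gt0 diamT d_vw aut_s sv.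
have cV : #|far_set w r| = j' := card_far connT r_gt1 j'_gt0 diamT d_wv aut_s' s'w.
have [m [m' [mm' m'm]]] := flip_mapsP treeT r_gt1 diamT d_vw j_gt0 wq aut_s sv.
have [n [n' [nn' n'n]]] := flip_mapsP treeT r_gt1 diamT d_wv j'_gt0 vu0 aut_s' s'w.
have few (x y z : T) : dist x y = r.*2.-1 -> (forall t, t \in far_set y r -> edge t z) ->
    #|leaves_at z| <= 2 -> #|far_set y r| <= 2.
  move=> d_xy far_z; apply: leq_trans; apply/subset_leq_card/subsetP=> t t_in.
  have tz := far_z t t_in; rewrite inE edge_sym tz /=; apply: (@leaf_end t y z) => //.
  by move: t_in; rewrite inE dist_sym // => /eqP.
have thin : 2 < r -> #|far_set w r| <= 2 /\ #|far_set v r| <= 2.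
  move=> r_gt2; split; first exact: few d_vw Vu0 (leaves_v r_gt2).
  exact: few d_wv Wq (leaves_w r_gt2).
have thin' : 2 < r -> #|far_set v r| <= 2 /\ #|far_set w r| <= 2.
  by move=> /thin[].
case: j_1D => [j1|jD].
  move: s aut_s sv bad_j cW; rewrite j1 => s1 aut_s1 s1v bad_j cW; case: bad_j.
  exact: (single_far_good treeT r_gt1 diamT d_vw vu0 wq Vu0 Wq mm' nn' thin D_gt1 goodT cW aut_s1 s1v).
case: j'_1D => [j1|j'D].
  move: s' aut_s' s'w bad_j' cV; rewrite j1 => s1 aut_s1 s1w bad_j' cV; case: bad_j'.
  exact: (single_far_good treeT r_gt1 diamT d_wv wq vu0 Wq Vu0 nn' mm' thin' D_gt1 goodT cV aut_s1 s1w).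
rewrite jD in cW; rewrite j'D in cV.
case: (full_ends_not_good treeT r_gt1 diamT d_vw vu0 wq Vu0 Wq mm' nn' n'n thin D_gt1 goodT cV cW).
by case/thin; rewrite cV; move: D_gt1; clear; lia.
Qed.

End BicentralRoot.

(** * Rooting the trees *)

Section RootChoice.
Variables (D r : nat).
Hypotheses (D_gt1 : 1 < D) (r_gt0 : 0 < r).

(** What is required of the vertex [v] of [T] placed at the hub of the universal tree.
    The eccentricity of [v] decides which unions with other branches can have radius
    [r]: for an end of a longest path, only the unions with at most [D] branches
    consisting of one edge, and for a diameter of [2 * r] none of these either. *)
Definition well_rooted (T : sgraph) (v : T) : Prop :=
  [/\ is_tree T, #|leaves_at v| <= D
    & 1 < r -> eccentricity v < r \/
      [/\ leaf v, leaves_at v = set0, good D T, r.*2.-1 <= eccentricity v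
        & eccentricity v < r.*2 -> forall j, 0 < j <= D -> good D (ext v j)]].

(** From a center [z], step towards a farthest vertex [t]. The vertex [u] reached has a
    vertex [t'] at distance at least the radius, and [t'] cannot be on the side of [t],
    where it would be too far from [z]. *)
Lemma radius_diameter (T : sgraph) : is_tree T -> 1 < radius T ->
  exists a b : T, (radius T).*2.-1 <= dist a b.
Proof.
move=> treeT rad_gt1; have connT := treeT.1.
have [z e_z] := radius_attained connT; have [t e_t] := ecc_attained connT z.
have neq_tz : t != z.
  by rewrite eq_sym -(dist_eq0 connT) e_t e_z -lt0n ltnW.
have [u zu t_u] := branch_cover treeT neq_tz.
have [t' e_t'] := ecc_attained connT u.
have le_rad := radius_le_ecc u; have t'_out : t' \notin branch z u.
  apply/negP=> /(dist_branch treeT zu); have := dist_le_ecc z t'.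
  by move: e_t' le_rad e_z; clear; lia.
exists t', t; rewrite (dist_cut treeT zu t_u t'_out).
have := dist_triangle connT u z t'; have := dist_branch treeT zu t_u.
rewrite (dist_sym connT t' z) (dist_sym connT u z) (dist_edge connT zu).
by move: e_t' le_rad e_z e_t; clear; lia.
Qed.

Lemma diameter_end (T : sgraph) (a b : T) : is_tree T -> 2 < dist a b ->
  (forall x y : T, dist x y <= dist a b) ->
  [/\ leaf a, leaves_at a = set0 & eccentricity a = dist a b].
Proof.
move=> treeT d_gt2 diamT; have connT := treeT.1.
have neq_ab : a != b by rewrite -(dist_eq0 connT); move: d_gt2; clear; lia.
have [u au d_u] := dist_step connT neq_ab.
have uniq_nbr t : edge a t -> t = u.
  move=> at'; apply: (closer_nbr_uniq treeT at' au (v := b)); last by rewrite d_u.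
  by case: (dist_edge_step treeT b at'); have := diamT t b; clear; lia.
split.
- apply/cards1P; exists u; apply/setP=> t; rewrite !inE.
  by apply/idP/eqP=> [/uniq_nbr|->].
- apply/setP=> t; rewrite !inE; apply/negP=> /andP[/uniq_nbr -> /cards1P[x /setP e_x]].
  have neq_ub : u != b.
    by rewrite -(dist_eq0 connT); move: d_u d_gt2; clear; lia.
  have [z uz d_z] := dist_step connT neq_ub.
  have := e_x a; have := e_x z; rewrite !inE uz edge_sym au => /esym/eqP e_zx /esym/eqP e_ax.
  by move: d_u d_z; rewrite e_ax e_zx; clear; lia.
- apply/eqP; rewrite eqn_leq dist_le_ecc andbT.
  by apply/ecc_leP=> w; apply: diamT.
Qed.

Lemma card_leaves_at (T : sgraph) (v : T) : good D T -> #|leaves_at v| <= D.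
Proof.
case=> c [_ [dist_c _]].
rewrite -[leqRHS]card_ord -(card_in_imset (f := c) (D := mem (leaves_at v))) ?max_card //.
by move=> x y x_in y_in; apply: (distinguishing_twins dist_c) => t; apply: leaves_twins x_in y_in.
Qed.

Lemma root_choice (T : sgraph) : is_tree T -> good D T -> radius T <= r ->
  exists v : T, well_rooted v.
Proof.
move=> treeT goodT le_rad; have connT := treeT.1.
have [z e_z] := radius_attained connT.
move: le_rad; rewrite leq_eqVlt => /orP[/eqP rad_r|lt_rad]; last first.
  by exists z; split=> //; [exact: card_leaves_at | left; rewrite e_z].
have [r_le1|r_gt1] := leqP r 1.
  by exists z; split=> //; [exact: card_leaves_at | rewrite ltnNge r_le1].
have d3 : 2 < r.*2.-1 by move: r_gt1; clear; lia.
have [a0 [b0 far0]] := radius_diameter treeT (etrans (congr1 _ rad_r) r_gt1).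
rewrite rad_r in far0.
have [[a b] _ max_ab] := arg_maxnP (fun xy : T * T => dist xy.1 xy.2) (isT : xpredT (a0, b0)).
have diamT (x y : T) : dist x y <= dist a b by have := max_ab (x, y) isT.
have le_d : dist a b <= r.*2 by rewrite -rad_r dist_le_radius.
have ge_d : r.*2.-1 <= dist a b := leq_trans far0 (diamT a0 b0).
have [d_lt|d_ge] := ltnP (dist a b) r.*2; last first.
  have [leaf_a no_leaf ecc_a] := diameter_end treeT (leq_trans d3 ge_d) diamT.
  exists a; split=> //; first exact: card_leaves_at.
  by move=> _; right; split; rewrite ?ecc_a // ltnNge d_ge.
have d_ab : dist a b = r.*2.-1 by move: d_lt ge_d; clear; lia.
rewrite d_ab in diamT.
have [v [w [d_vw good_ext]]] := bicentral_root treeT r_gt1 D_gt1 diamT goodT d_ab.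
have [||leaf_v no_leaf ecc_v] := @diameter_end T v w treeT; rewrite ?d_vw //.
exists v; split=> //; first exact: card_leaves_at.
by move=> _; right; split; rewrite // ecc_v d_vw.
Qed.

End RootChoice.

(** * Branched subgraphs of a tree *)

Section Branched.
Variables (U : sgraph) (x : U).
Hypothesis treeU : is_tree U.
Let connU : connected U := treeU.1.
Let acycU : acyclic U := treeU.2.

Lemma acyclic_induced (S : {set U}) : acyclic (induced S).
Proof.
move=> p lt_p /andP[cycle_p uniq_p]; apply: (acycU (p := map val p)); first by rewrite size_map.
rewrite /ucycle map_inj_uniq ?uniq_p ?andbT; last exact: val_inj.
case: p cycle_p {uniq_p lt_p} => //= u p; rewrite -map_rcons.
by rewrite path_map.
Qed.

(** The unions of branches at [x], characterized without mentioning branches. *)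
Definition branch_closed_set (S : {set U}) :=
  x \in S /\ forall a b : U, a \in S -> a != x -> b != x -> edge a b -> b \in S.

Lemma closed_connect S z a : branch_closed_set S -> z \in S -> edge x z ->
  a \in branch x z -> a \in S.
Proof.
case=> _ closedS zS xz; rewrite inE; apply: (connect_ind (Q := fun t => t \in S)) => //.
by move=> b c bS /and3P[bc b_neq c_neq]; apply: closedS bc.
Qed.

Lemma closed_tree S : branch_closed_set S -> is_tree (induced S).
Proof.
case=> xS closedS; split; last exact: acyclic_induced.
pose x' : induced S := Sub x xS; split; first by apply/card_gt0P; exists x'.
have to_x (a : induced S) : connect (@edge (induced S)) a x'.
  move en: (dist (val a) x) => n; elim: n a en => [|n IHn] a en.
    have /eqP : dist (val a) x == 0 by rewrite en.
    by move/eqP; rewrite (dist_eq0 connU) => /eqP e_a; rewrite (_ : a = x') //; apply: val_inj.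
  have neq_a : val a != x by rewrite -(dist_eq0 connU) en.
  have [b ab d_b] := dist_step connU neq_a.
  have bS : b \in S.
    by have [-> //|neq_b] := eqVneq b x; apply: closedS neq_a neq_b ab; apply: valP.
  apply: connect_trans (connect1 (_ : edge a (Sub b bS : induced S))) _; first by [].
  by apply: IHn; move: d_b; rewrite en => -[].
move=> a b; apply: connect_trans (to_x a) _.
by rewrite (sym_connect_sym (@edge_sym (induced S))).
Qed.

Let Br z := x |: branch x z.

Let Br_closed z : edge x z -> branch_closed_set (Br z).
Proof.
move=> xz; split=> [|a b]; first by rewrite setU11.
rewrite !in_setU1 => /orP[/eqP->|a_in] a_neq b_neq ab; first by rewrite eqxx in a_neq.
by rewrite (branch_closed xz a_in ab b_neq) orbT.
Qed.

Let Br_subtree z : edge x z -> subtree_with_leaf x (Br z).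
Proof.
move=> xz; split; first exact/closed_tree/Br_closed.
have x_in : x \in Br z by rewrite setU11.
have z_in : z \in Br z by rewrite in_setU1 branch_self orbT.
exists (Sub x x_in : induced (Br z)); split=> //; apply/cards1P.
exists (Sub z z_in); apply/setP=> u; rewrite !inE -val_eqE /=.
change (edge x (val u) = (val u == z)).
apply/idP/eqP=> [xu|-> //]; have := valP u; rewrite in_setU1 => /orP[/eqP e_u|u_in].
  by rewrite e_u edge_irrefl in xu.
exact: (branch_nbr acycU xz xu u_in).
Qed.

Let subtree_Br S : subtree_with_leaf x S -> exists2 z, edge x z & S \subset Br z.
Proof.
case=> treeS [y [e_y /cards1P[z' /setP e_z']]].
have nbr (u : induced S) : edge y u = (u == z') by have := e_z' u; rewrite !inE.
have xz : edge x (val z') by rewrite -e_y -[edge _ _]/(edge y z') nbr.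
exists (val z') => //; apply/subsetP=> a aS.
have := treeS.1.2 y (Sub a aS).
apply: (connect_ind (Q := fun u : induced S => val u \in Br (val z'))) => [u u'|].
  rewrite !in_setU1 => /orP[/eqP e_u uu'|u_in uu'].
    suff -> : u' = z' by rewrite branch_self orbT.
    have u_y : u = y by apply: val_inj; rewrite e_u.
    by apply/eqP; rewrite -nbr -u_y.
  have [//|neq_u'] := eqVneq (val u') x.
  exact: (branch_closed xz u_in uu' neq_u').
by rewrite in_setU1 e_y eqxx.
Qed.

Let is_branchP B : is_branch x B <-> exists2 z, edge x z & B = Br z.
Proof.
split=> [[subB maxB]|[z xz ->]].
  have [z xz sub_z] := subtree_Br subB; exists z => //.
  by rewrite (maxB (Br z)) //; apply: Br_subtree.
split=> [|S subS sub_z]; first exact: Br_subtree.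
have [z' xz' sub_z'] := subtree_Br subS.
have zS : z \in S by apply: (subsetP sub_z); rewrite in_setU1 branch_self orbT.
have := subsetP sub_z' z zS; rewrite in_setU1 => /orP[/eqP e_z|z_in].
  by rewrite e_z edge_irrefl in xz.
apply/eqP; rewrite eqEsubset sub_z andbT.
by rewrite (branch_nbr acycU xz' xz z_in).
Qed.

(** The maximal subtrees in which [x] is a leaf are the sets [x |: branch x z]: the
    unique neighbour [z] of [x] in such a subtree confines it to this set. *)
Lemma branched_subgraphP S : branched_subgraph x S <-> branch_closed_set S.
Proof.
split=> [[->|[P [P_neq0 P_branch ->]]]|closedS].
- split=> [|a b]; first by rewrite set11.
  by rewrite inE => /eqP ->; rewrite eqxx.
- split.
    have [B BP] := set0Pn _ P_neq0; have /is_branchP[z xz e_B] := P_branch B BP.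
    by apply/bigcupP; exists B; rewrite // e_B setU11.
  move=> a b /bigcupP[B BP aB] a_neq b_neq ab; apply/bigcupP; exists B => //.
  have /is_branchP[z xz e_B] := P_branch B BP; rewrite e_B in aB *.
  exact: (Br_closed xz).2 ab.
have [->|neq_S] := eqVneq S [set x]; first by left.
have to_nbr a : a \in S -> a != x -> exists z, [/\ edge x z, z \in S & a \in branch x z].
  move=> aS a_neq; have [z xz a_in] := branch_cover treeU a_neq; exists z; split=> //.
  move: a_in; rewrite inE avoid_connect_sym.
  apply: (connect_ind (Q := fun t => t \in S)) => // b c bS /and3P[bc b_neq c_neq].
  exact: closedS.2 bc.
right; exists [set Br z | z in [set z in S | edge x z]]; split.
- have [a aS a_neq] : exists2 a, a \in S & a != x.
    have: ~~ (S \subset [set x]).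
      apply: contra neq_S => sub; rewrite eqEsubset sub sub1set; exact: closedS.1.
    by case/subsetPn=> a aS; rewrite inE; exists a.
  have [z [xz zS _]] := to_nbr a aS a_neq; apply/set0Pn; exists (Br z).
  by apply: imset_f; rewrite inE zS.
- move=> B /imsetP[z]; rewrite inE => /andP[_ xz] ->; apply/is_branchP; by exists z.
apply/eqP; rewrite eqEsubset; apply/andP; split; apply/subsetP=> a.
  move=> aS; apply/bigcupP; have [e_a|a_neq] := eqVneq a x; last first.
    have [z [xz zS a_in]] := to_nbr a aS a_neq; exists (Br z).
      by apply: imset_f; rewrite inE zS.
    by rewrite in_setU1 a_in orbT.
  have [b bS b_neq] : exists2 b, b \in S & b != x.
    have: ~~ (S \subset [set x]).
      apply: contra neq_S => sub; rewrite eqEsubset sub sub1set; exact: closedS.1.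
    by case/subsetPn=> b bS; rewrite inE; exists b.
  have [z [xz zS _]] := to_nbr b bS b_neq; exists (Br z); last by rewrite e_a setU11.
  by apply: imset_f; rewrite inE zS.
case/bigcupP=> B /imsetP[z]; rewrite inE => /andP[zS xz] -> /setU1P[->|].
  exact: closedS.1.
exact: closed_connect closedS zS xz.
Qed.

End Branched.

(** * Gluing rooted trees at a hub *)

Section Glue.
Variables (D n : nat) (T_ : 'I_n -> sgraph) (v_ : forall k, T_ k).
Hypothesis tree_ : forall k, is_tree (T_ k).

(** The vertices of [T_ k] that are copied into the universal tree. The vertex [v_ k]
    becomes the hub, and the leaves at [v_ k] are represented by [D] pendant vertices
    of the hub that all the trees share, so that no union of branches has more than
    [D] leaves at the hub. *)
Definition inner k : {set T_ k} := [set t | (t != v_ k) && (t \notin leaves_at (v_ k))].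
Definition piece k : sgraph := induced (inner k).

Definition glue_edge (a b : option ('I_D + {k : 'I_n & piece k})) : bool :=
  match a, b with
  | None, Some (inl _) | Some (inl _), None => true
  | None, Some (inr u) | Some (inr u), None => edge (v_ (tag u)) (val (tagged u))
  | Some (inr u), Some (inr u') => (tag u == tag u') && edge (tagged u) (tagged_as u u')
  | _, _ => false
  end.

Lemma glue_edge_sym : symmetric glue_edge.
Proof.
move=> [[l|[k t]]|] [[l'|[k' t']]|] //=.
have [e_k|//] := eqVneq k k'; subst k'.
by rewrite !tagged_asE /=; apply: (@edge_sym (piece k)).
Qed.

Lemma glue_edge_irrefl : irreflexive glue_edge.
Proof. by move=> [[l|[k t]]|] //=; rewrite eqxx tagged_asE; apply: (@edge_irrefl (piece k)). Qed.

Definition glue : sgraph := SGraph glue_edge_sym glue_edge_irrefl.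

Definition hub : glue := None.
Definition pendant (l : 'I_D) : glue := Some (inl l).
Definition emb k (t : T_ k) : glue :=
  if insub t is Some b then Some (inr (Tagged (fun k => piece k) (b : piece k))) else None.

Lemma embE k t (t_in : t \in inner k) :
  emb t = Some (inr (Tagged (fun k => piece k) (Sub t t_in : piece k))).
Proof. by rewrite /emb insubT. Qed.

Lemma glue_cases (a : glue) :
  [\/ a = hub, exists l, a = pendant l | exists k (t : T_ k), t \in inner k /\ a = emb t].
Proof.
case: a => [[l|[k t]]|]; [by constructor 2; exists l | | by constructor 1].
constructor 3; exists k, (val t); split; first exact: valP.
by rewrite (embE (valP t)); congr (Some (inr (Tagged _ _))); apply: val_inj.
Qed.

Lemma emb_neq_hub k (t : T_ k) : t \in inner k -> emb t != hub.
Proof. by move=> t_in; rewrite (embE t_in). Qed.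

Lemma emb_neq_pendant k (t : T_ k) l : t \in inner k -> emb t != pendant l.
Proof. by move=> t_in; rewrite (embE t_in). Qed.

Lemma emb_root k : emb (v_ k) = hub.
Proof. by rewrite /emb insubF // inE eqxx. Qed.

Lemma emb_inj k (t t' : T_ k) : t \in inner k -> t' \in inner k -> emb t = emb t' -> t = t'.
Proof.
move=> t_in t'_in; rewrite (embE t_in) (embE t'_in) => -[] /eqP.
by rewrite eq_Tagged /= => /eqP.
Qed.

Lemma edge_hub_pendant l : edge hub (pendant l). Proof. by []. Qed.

Lemma edge_pendant l a : edge (pendant l) a = (a == hub).
Proof. by case: a => [[]|]. Qed.

Lemma edge_hub k (t : T_ k) : t \in inner k -> edge hub (emb t) = edge (v_ k) t.
Proof. by move=> t_in; rewrite (embE t_in). Qed.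

Lemma edge_emb k (t t' : T_ k) : t \in inner k -> t' \in inner k ->
  edge (emb t) (emb t') = edge t t'.
Proof.
by move=> t_in t'_in; rewrite (embE t_in) (embE t'_in) /edge /= eqxx tagged_asE.
Qed.

Lemma edge_emb_neq k k' (t : T_ k) (t' : T_ k') : t \in inner k -> t' \in inner k' ->
  edge (emb t) (emb t') -> k = k'.
Proof.
move=> t_in t'_in; rewrite (embE t_in) (embE t'_in) /edge /=.
by case/andP=> /eqP.
Qed.

Lemma edge_emb_step k (t : T_ k) a : t \in inner k -> edge (emb t) a -> a != hub ->
  exists t' : T_ k, [/\ t' \in inner k, a = emb t' & edge t t'].
Proof.
move=> t_in ta a_neq; case: (glue_cases a) => [e_a|[l e_a]|[k' [t' [t'_in e_a]]]].
- by rewrite e_a eqxx in a_neq.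
- by move: ta; rewrite e_a edge_sym edge_pendant (negPf (emb_neq_hub t_in)).
- move: ta; rewrite e_a => ta; have e_k := edge_emb_neq t_in t'_in ta; subst k'.
  by exists t'; split=> //; rewrite -edge_emb.
Qed.

Lemma inner_step k (t : T_ k) : t \in inner k -> exists t' : T_ k,
  [/\ edge t t', dist (v_ k) t = (dist (v_ k) t').+1 & t' = v_ k \/ t' \in inner k].
Proof.
move=> t_in; have connT := (tree_ k).1; have neq_t : t != v_ k by move: t_in; rewrite inE => /andP[].
have [t' tt' d_t'] := dist_step connT neq_t; exists t'; split=> //.
  by rewrite dist_sym // d_t' dist_sym.
have [->|neq_t'] := eqVneq t' (v_ k); [by left | right].
rewrite inE neq_t'; apply: contra neq_t => /leaf_nbr e_t.
by apply/eqP/e_t; rewrite edge_sym.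
Qed.

Lemma edge_emb_root k (t t' : T_ k) : t \in inner k -> t' = v_ k \/ t' \in inner k ->
  edge (emb t) (emb t') = edge t t'.
Proof.
move=> t_in [->|t'_in]; last exact: edge_emb.
by rewrite emb_root edge_sym edge_hub // edge_sym.
Qed.

Lemma glue_connected : connected glue.
Proof.
split; first by apply/card_gt0P; exists hub.
have to_hub a : connect (@edge glue) a hub.
  case: (glue_cases a) => [->|[l ->]|[k [t [t_in ->]]]]; first exact: connect0.
    by apply: connect1; rewrite edge_pendant.
  move ed: (dist (v_ k) t) => d; elim: d t t_in ed => [|d IHd] t t_in ed.
    move/eqP: ed; rewrite (dist_eq0 (tree_ k).1) => /eqP e_t.
    by rewrite -e_t inE eqxx in t_in.
  have [t' [tt' d_t' t'_in]] := inner_step t_in.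
  have step : edge (emb t) (emb t') by rewrite edge_emb_root.
  apply: connect_trans (connect1 step) _.
  case: t'_in => [->|t'_in]; first by rewrite emb_root connect0.
  by apply: IHd => //; move: d_t'; rewrite ed => -[].
move=> a b; apply: connect_trans (to_hub a) _.
by rewrite (sym_connect_sym (@edge_sym glue)).
Qed.

Lemma emb_path k (t : T_ k) p : t \in inner k -> path (@edge glue) (emb t) p ->
  hub \notin p -> exists2 q, p = map (@emb k) q & all (mem (inner k)) q && path (@edge (T_ k)) t q.
Proof.
elim: p t => [|a p IHp] t t_in /=; first by exists [::].
case/andP=> ta walk_p; rewrite inE negb_or eq_sym => /andP[a_neq hub_p].
have [t' [t'_in e_a tt']] := edge_emb_step t_in ta a_neq.
rewrite e_a in walk_p; have [q e_p /andP[q_in walk_q]] := IHp t' t'_in walk_p hub_p.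
by exists (t' :: q); rewrite /= ?e_a ?e_p // t'_in q_in tt'.
Qed.

Lemma glue_acyclic : acyclic glue.
Proof.
move=> p lt_p cyc_p; have [hub_p|hub_p] := boolP (hub \in p); last first.
  case: p lt_p cyc_p hub_p => // a p lt_p /andP[cyc_p uniq_p].
  rewrite inE negb_or eq_sym => /andP[a_neq hub_p].
  case: (glue_cases a) => [e_a|[l e_a]|[k [t [t_in e_a]]]].
  - by rewrite e_a eqxx in a_neq.
  - case: p lt_p cyc_p hub_p {uniq_p} => // b p _ /= /andP[ab _].
    by move: ab; rewrite e_a -[glue_edge _ _]/(edge (pendant l) b) edge_pendant inE eq_sym => ->.
  - have hub_p' : hub \notin rcons p a by rewrite mem_rcons inE negb_or eq_sym a_neq.
    move: cyc_p; rewrite /= {1}e_a => /(emb_path t_in)/(_ hub_p')[q e_q /andP[q_in walk_q]].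
    case/lastP: q e_q q_in walk_q => [|q t1]; first by case: (p).
    rewrite map_rcons all_rcons => /rcons_inj[e_p e_a1] /andP[/= t1_in q_in] walk_q.
    have e_t1 : t1 = t by apply: emb_inj => //; rewrite -e_a1.
    apply: ((tree_ k).2 (t :: q)).
      by move: lt_p; rewrite e_p /= size_map.
    rewrite e_t1 in walk_q; rewrite /ucycle /= walk_q /=.
    by move: uniq_p; rewrite e_a e_p -map_cons => /map_uniq.
have [i p' e_rot] := rot_to hub_p.
have cyc_p' : ucycle (@edge glue) (hub :: p') by rewrite -e_rot rot_ucycle.
have {}lt_p : 1 < size p'.
  by have := size_rot i p; rewrite e_rot /= => e_p; rewrite -ltnS e_p.
case/andP: cyc_p' => /= cyc_p' /andP[hub_p' uniq_p'].
case: p' lt_p cyc_p' hub_p' uniq_p' {e_rot} => // a p' lt_p.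
rewrite rcons_path => /andP[/andP[hub_a walk_p'] last_p'].
rewrite inE negb_or eq_sym => /andP[a_neq hub_p'] uniq_p'.
case: (glue_cases a) => [e_a|[l e_a]|[k [t [t_in e_a]]]].
- by rewrite e_a eqxx in a_neq.
- case: p' lt_p walk_p' hub_p' {last_p' uniq_p'} => // b p' _ /= /andP[ab _].
  by move: ab; rewrite e_a -[glue_edge _ _]/(edge (pendant l) b) edge_pendant inE eq_sym => ->.
have [q e_q /andP[q_in walk_q]] : exists2 q, p' = map (@emb k) q &
    all (mem (inner k)) q && path (@edge (T_ k)) t q.
  by apply: emb_path => //; rewrite -e_a.
have vt : edge (v_ k) t by rewrite -edge_hub // -e_a.
have last_in : last t q \in inner k.
  by have := mem_last t q; rewrite inE => /orP[/eqP -> //|]; apply: (allP q_in).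
have vlast : edge (v_ k) (last t q).
  by rewrite -edge_hub // -last_map -e_a -e_q edge_sym.
have last_br : last t q \in branch (v_ k) t.
  rewrite inE; apply/connectP; exists q => //.
  have: all (fun y => y != v_ k) (t :: q).
    rewrite /= andbC; apply/andP; split; last by move: t_in; rewrite inE => /andP[].
    by apply: sub_all q_in => y; rewrite /= inE => /andP[].
  elim: q t walk_q {t_in e_a e_q q_in vt last_in vlast} => //= y q IHq t /andP[ty walk_q].
  case/and3P=> t_neq y_neq q_neq; rewrite /avoid ty t_neq y_neq /=.
  by apply: IHq; rewrite // y_neq.
have e_last := branch_nbr (tree_ k).2 vt vlast last_br.
case: q e_q e_last {walk_q q_in last_in vlast last_br} => [e_q|y q e_q e_last].
  by rewrite e_q in lt_p.
move: uniq_p'; rewrite e_a e_q cons_uniq; apply/negP; rewrite negb_and negbK.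
by rewrite -[t in emb t \in _]e_last (map_f (@emb k) (mem_last y q)).
Qed.

Lemma glue_tree : is_tree glue.
Proof. by split; [exact: glue_connected | exact: glue_acyclic]. Qed.

Section Attach.
Variables (k : 'I_n) (G : sgraph) (x0 : G) (L : {set G}) (g : G -> T_ k) (lab : G -> 'I_D).
Variable S : {set glue}.
Hypotheses (g_root : g x0 = v_ k) (x0_L : x0 \notin L)
  (g_inner : forall u, u \notin L -> u != x0 -> g u \in inner k)
  (g_inj : forall u u', u \notin L -> u' \notin L -> g u = g u' -> u = u')
  (g_onto : forall t, t \in inner k -> exists u, [/\ u \notin L, u != x0 & g u = t])
  (g_edge : forall u u', u \notin L -> u' \notin L -> edge (g u) (g u') = edge u u')
  (L_edge : forall u t, u \in L -> edge u t = (t == x0))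
  (lab_inj : {in L &, injective lab})
  (S_E : forall a, a \in S <-> [\/ a = hub, exists t : T_ k, t \in inner k /\ a = emb t
                                | exists u, u \in L /\ a = pendant (lab u)]).

(** The graph [G] is made of a copy of [v_ k] and the inner vertices of [T_ k], together
    with a set [L] of leaves attached to it at [x0]. This covers both [T_ k] itself,
    with its own leaves at [v_ k], and [T_ k] extended by new leaves at [v_ k]. *)
Lemma attach_iso : graph_iso G (induced S).
Proof.
pose h u := if u \in L then pendant (lab u) else emb (g u).
have h_root : h x0 = hub by rewrite /h (negPf x0_L) g_root emb_root.
have h_hub u : u \notin L -> (h u == hub) = (u == x0).
  move=> uL; have [->|neq_u] := eqVneq u x0; first by rewrite h_root eqxx.
  by rewrite /h (negPf uL); apply/negbTE/emb_neq_hub/g_inner.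
have h_emb u : u \notin L -> u != x0 -> h u = emb (g u) by rewrite /h => /negPf ->.
have h_inj : injective h.
  move=> u u'; have [uL|uL] := boolP (u \in L); have [u'L|u'L] := boolP (u' \in L).
  - by rewrite /h uL u'L => -[]; apply: lab_inj.
  - move=> e_h; rewrite {1}/h uL in e_h.
    have [e_u'|neq] := eqVneq u' x0; first by rewrite e_u' h_root in e_h.
    rewrite h_emb // in e_h; have := emb_neq_pendant (lab u) (g_inner u'L neq).
    by rewrite -e_h eqxx.
  - move=> e_h; rewrite {2}/h u'L in e_h.
    have [e_u|neq] := eqVneq u x0; first by rewrite e_u h_root in e_h.
    rewrite h_emb // in e_h; have := emb_neq_pendant (lab u') (g_inner uL neq).
    by rewrite e_h eqxx.
  - have [->|neq] := eqVneq u x0.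
      by rewrite h_root => /esym/eqP; rewrite h_hub // => /eqP.
    have [->|neq'] := eqVneq u' x0.
      by rewrite h_root => /eqP; rewrite h_hub // (negPf neq).
    by rewrite !h_emb // => e_h; apply: g_inj => //; apply: emb_inj e_h; apply: g_inner.
have h_edge u u' : edge (h u) (h u') = edge u u'.
  have half a b : a \in L -> edge (h a) (h b) = edge a b.
    move=> aL; rewrite L_edge // {1}/h aL edge_pendant; have [bL|bL] := boolP (b \in L).
      have [e_b|_] := eqVneq b x0; first by move: x0_L; rewrite -e_b bL.
      by rewrite /h bL.
    exact: h_hub.
  have [uL|uL] := boolP (u \in L); first exact: half.
  have [u'L|u'L] := boolP (u' \in L); first by rewrite edge_sym half // edge_sym.
  have [e_u|neq] := eqVneq u x0; have [e_u'|neq'] := eqVneq u' x0.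
  - by rewrite e_u e_u' !edge_irrefl.
  - by rewrite e_u h_root h_emb // edge_hub ?g_inner // -g_root g_edge.
  - rewrite e_u' h_root h_emb // edge_sym edge_hub ?g_inner // -g_root g_edge //.
    by rewrite edge_sym.
  - by rewrite !h_emb // edge_emb ?g_inner // g_edge.
have hS u : h u \in S.
  apply/S_E; have [uL|uL] := boolP (u \in L).
    by constructor 3; exists u; rewrite /h uL.
  have [->|neq] := eqVneq u x0; first by constructor 1.
  by constructor 2; exists (g u); rewrite h_emb // g_inner.
have h_onto (a : induced S) : exists u, h u = val a.
  have /S_E[-> | [t [t_in ->]] | [u [uL ->]]] := valP a.
  - by exists x0.
  - by have [u [uL neq <-]] := g_onto t_in; exists u; rewrite h_emb.
  - by exists u; rewrite /h uL.
have [h' h'K] := fin_all_exists h_onto.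
exists (fun u => Sub (h u) (hS u) : induced S); split; last by move=> u u'; apply: h_edge.
exists h' => [u|a]; first by apply: h_inj; rewrite h'K.
by apply: val_inj; rewrite /= h'K.
Qed.

End Attach.

Lemma piece_represented k : 0 < D -> #|leaves_at (v_ k)| <= D ->
  exists S : {set glue}, branch_closed_set hub S /\ graph_iso (T_ k) (induced S).
Proof.
move=> D_gt0 le_D; pose L := leaves_at (v_ k).
pose lab u := insubd (Ordinal D_gt0) (index u (enum L)).
have lab_val u : u \in L -> val (lab u) = index u (enum L).
  by move=> uL; rewrite val_insubd (leq_trans _ le_D) // cardE index_mem mem_enum.
pose S := [set a : glue | [|| a == hub, [exists t : T_ k, (t \in inner k) && (a == emb t)]
                          | [exists u, (u \in L) && (a == pendant (lab u))]]].
have S_E a : a \in S <-> [\/ a = hub, exists t : T_ k, t \in inner k /\ a = emb t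
                                | exists u, u \in L /\ a = pendant (lab u)].
  rewrite inE; split=> [/or3P[/eqP|/existsP[t /andP[? /eqP]]|/existsP[u /andP[? /eqP]]]|].
  - by constructor 1.
  - by constructor 2; exists t.
  - by constructor 3; exists u.
  - case=> [->|[t [t_in ->]]|[u [uL ->]]]; apply/or3P; [by constructor 1|constructor 2|constructor 3].
      by apply/existsP; exists t; rewrite t_in eqxx.
    by apply/existsP; exists u; rewrite uL eqxx.
exists S; split.
  split=> [|a b /S_E[-> | [t [t_in ->]] | [u [uL ->]]] a_neq b_neq]; first by apply/S_E; constructor 1.
  - by rewrite eqxx in a_neq.
  - case/(edge_emb_step t_in)/(_ b_neq)=> t' [t'_in -> _].
    by apply/S_E; constructor 2; exists t'.
  - by rewrite edge_pendant (negPf b_neq).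
apply: (@attach_iso k (T_ k) (v_ k) L id lab S) => //.
- by rewrite inE edge_irrefl.
- by move=> u uL neq; rewrite inE neq.
- by move=> t; rewrite inE => /andP[neq tL]; exists t.
- move=> u t uL; apply/idP/eqP=> [/(leaf_nbr uL) //|->].
  by move: uL; rewrite inE edge_sym => /andP[].
- move=> u u' uL u'L /(congr1 val); rewrite !lab_val // => e_i.
  by rewrite -(nth_index u (_ : u \in enum L)) ?mem_enum // e_i nth_index ?mem_enum.
Qed.

(** A potential for bounding distances from below: it increases by one per step into
    the [k]-th piece and decreases outside of it. Depth 2 outside the [k]-th piece is
    all that is ever needed, which explains the truncation. *)
Definition height k (a : glue) : nat :=
  match a with
  | None => 2
  | Some (inl _) => 1
  | Some (inr u) => if tag u == k then dist (v_ (tag u)) (val (tagged u)) + 2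
                    else 2 - dist (v_ (tag u)) (val (tagged u))
  end.

Lemma height_emb k k' (t : T_ k') : t \in inner k' ->
  height k (emb t) = if k' == k then dist (v_ k') t + 2 else 2 - dist (v_ k') t.
Proof. by move=> t_in; rewrite (embE t_in). Qed.

Lemma height_lipschitz k (a b : glue) : edge a b -> height k b <= (height k a).+1.
Proof.
have step k' (t t' : T_ k') : edge t t' -> dist (v_ k') t <= (dist (v_ k') t').+1.
  move=> tt'; have := dist_triangle (tree_ k').1 (v_ k') t' t.
  by rewrite [dist t' t]dist_sym ?(dist_edge (tree_ k').1 tt') ?addn1 //; case: (tree_ k').
case: (glue_cases a) => [->|[l ->]|[k1 [t [t_in ->]]]].
- case: (glue_cases b) => [->|[l ->]|[k2 [t [t_in ->]]]] //.
  rewrite edge_hub // height_emb // => /(dist_edge (tree_ k2).1) ->.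
  by case: ifP.
- by rewrite edge_pendant => /eqP ->.
have [->|b_neq] := eqVneq b hub.
  rewrite edge_sym edge_hub // height_emb // => /(dist_edge (tree_ k1).1) ->.
  by case: ifP.
move=> tb; have [t' [t'_in -> tt']] := edge_emb_step t_in tb b_neq.
have t't : edge t' t by rewrite edge_sym.
rewrite !height_emb //; have := step k1 t t' tt'; have := step k1 t' t t't.
by case: ifP; lia.
Qed.

Section ClosedSet.
Variable S : {set glue}.
Hypothesis closedS : branch_closed_set hub S.

Let connS : connected (induced S) := (closed_tree glue_tree closedS).1.

Lemma height_radius k a b : a \in S -> b \in S ->
  height k b <= height k a + (radius (induced S)).*2.
Proof.
move=> aS bS.
have := dist_lipschitz connS (phi := fun u : induced S => height k (val u)) _ (Sub a aS) (Sub b bS).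
move=> H; have {H} := H (fun u u' => @height_lipschitz k (val u) (val u')).
rewrite /= => le_d; apply: leq_trans le_d _.
by rewrite leq_add2l dist_le_radius.
Qed.

Lemma closed_emb k (t t' : T_ k) : t \in inner k -> t' \in inner k ->
  emb t \in S -> edge t t' -> emb t' \in S.
Proof.
move=> t_in t'_in tS tt'; apply: (closedS.2 _ _ tS); rewrite ?emb_neq_hub //.
by rewrite edge_emb.
Qed.

Lemma small_radius h : 0 < h ->
  (forall k (t : T_ k), t \in inner k -> emb t \in S -> dist (v_ k) t <= h) ->
  radius (induced S) <= h.
Proof.
move=> h_gt0 le_h; pose x : induced S := Sub hub closedS.1.
apply: leq_trans (radius_le_ecc x) _; apply/ecc_leP=> a.
case: (glue_cases (val a)) => [e_a|[l e_a]|[k [t [t_in e_a]]]].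
- by rewrite (_ : a = x) ?distxx //; apply: val_inj.
- rewrite (dist_edge connS) // -[edge x a]/(edge hub (val a)) e_a.
  exact: edge_hub_pendant.
have tS : emb t \in S by rewrite -e_a; apply: valP.
apply: leq_trans (le_h k t t_in tS).
move ed: (dist (v_ k) t) => d; elim: d t a t_in tS e_a ed => [|d IHd] t a t_in tS e_a ed.
  move/eqP: ed; rewrite (dist_eq0 (tree_ k).1) => /eqP e_t.
  by rewrite -e_t inE eqxx in t_in.
have [t' [tt' d_t' t'_in]] := inner_step t_in.
have t'S : emb t' \in S.
  case: t'_in => [->|t'_in]; first by rewrite emb_root closedS.1.
  exact: closed_emb tS tt'.
pose b : induced S := Sub (emb t') t'S.
have ba : edge b a.
  by rewrite -[edge b a]/(edge (emb t') (val a)) e_a edge_sym edge_emb_root.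
apply: leq_trans (dist_triangle connS x b a) _.
rewrite (dist_edge connS ba) addn1 ltnS.
case: t'_in => [e_t'|t'_in].
  by rewrite (_ : b = x) ?distxx //; apply: val_inj; rewrite /= e_t' emb_root.
by apply: (IHd t') => //; move: d_t'; rewrite ed => -[].
Qed.

(** A neighbour of [v_ k] that is an inner vertex is not a leaf, so the branch goes on. *)
Lemma inner_depth_two k (t : T_ k) : t \in inner k -> emb t \in S ->
  exists t' : T_ k, [/\ t' \in inner k, emb t' \in S & 1 < dist (v_ k) t'].
Proof.
move=> t_in tS; have treeT := tree_ k; have connT := treeT.1.
have [d_gt1|d_le1] := ltnP 1 (dist (v_ k) t); first by exists t.
have neq_t : t != v_ k by move: t_in; rewrite inE => /andP[].
have vt : edge (v_ k) t.
  apply: (dist1_edge connT); apply/eqP; rewrite eqn_leq d_le1 lt0n dist_eq0 //.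
  by rewrite eq_sym.
have [t' tt' neq_t'] : exists2 t', edge t t' & t' != v_ k.
  apply: NNPP => none; move: t_in; rewrite inE => /andP[_ /negP[]].
  rewrite inE vt; apply/cards1P; exists (v_ k); apply/setP=> y; rewrite !inE.
  apply/idP/eqP=> [ty|->]; last by rewrite edge_sym.
  by apply/eqP/negPn/negP => neq_y; apply: none; exists y.
have d_t' : dist (v_ k) t' = 2.
  have d_t := dist_edge connT vt; have := dist_edge_step treeT (v_ k) tt'.
  rewrite [dist t _]dist_sym // [dist t' _]dist_sym // d_t.
  case=> [[/esym/eqP]|->//]; by rewrite dist_eq0 // eq_sym (negPf neq_t').
have t'_in : t' \in inner k.
  rewrite inE neq_t'; apply/negP; rewrite inE => /andP[/(dist_edge connT)].
  by rewrite d_t'.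
by exists t'; split=> //; [exact: closed_emb tS tt' | rewrite d_t'].
Qed.

(** If all pieces that [S] meets are rooted at a vertex of eccentricity below [r], then
    the radius is below [r]. Otherwise [S] contains a whole piece in which some vertex
    is at distance at least [2 * r - 1] from the hub. If [S] meets another piece, at
    depth 2, two of its vertices are at distance at least [2 * r + 1], which exceeds
    twice the radius. So [S] adds only pendant vertices to the piece, and none if the
    piece reaches distance [2 * r]; the choice of the root makes the result good. *)
Lemma closed_good r : 1 < r -> (forall k, well_rooted D r (v_ k)) ->
  radius (induced S) = r -> good D (induced S).
Proof.
move=> r_gt1 rooted rad_r.
case: (classic (exists k (t : T_ k), [/\ t \in inner k, emb t \in S & r <= eccentricity (v_ k)]));
  last first.
  move=> none; suff: radius (induced S) <= r.-1 by rewrite rad_r; lia.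
  apply: small_radius => [|k t t_in tS]; first by lia.
  rewrite -ltnS prednK; last by lia.
  apply: leq_ltn_trans (dist_le_ecc _ _) _; rewrite ltnNge; apply/negP => le_r.
  by apply: none; exists k, t.
case=> k [t0 [t0_in t0S le_r]]; have treeT := tree_ k; have connT := treeT.1.
have [_ _ /(_ r_gt1)[|[leaf_v no_leaf goodT ge_ecc ext_good]]] := rooted k; first by rewrite ltnNge le_r.
have innerE t : (t \in inner k) = (t != v_ k) by rewrite inE no_leaf inE andbT.
have [u vu] : exists u, edge (v_ k) u.
  by case/cards1P: leaf_v => u /setP/(_ u); rewrite !inE eqxx; exists u.
have nbr_u t : edge (v_ k) t -> t = u.
  case/cards1P: leaf_v => y /setP e_y; have := e_y u; have := e_y t; rewrite !inE vu.
  by move=> -> /esym/eqP -> /eqP.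
have all_S (t : T_ k) : t \in inner k -> emb t \in S.
  have to_br (y : T_ k) : y \in inner k -> y \in branch (v_ k) u.
    rewrite innerE => neq_y; have [z vz y_in] := branch_cover treeT neq_y.
    by rewrite -(nbr_u z vz).
  move=> t_in; have := to_br t t_in; have := to_br t0 t0_in; rewrite !inE => ut0 ut.
  have: connect (avoid (v_ k)) t0 t by apply: connect_trans ut; rewrite avoid_connect_sym.
  apply: (connect_ind (Q := fun y => emb y \in S)) => // a b aS /and3P[ab a_neq b_neq].
  by apply: closed_emb aS ab; rewrite innerE.
have [w e_w] := ecc_attained connT (v_ k).
have w_in : w \in inner k.
  by rewrite innerE; apply: contraTneq le_r => e_wv; rewrite -e_w e_wv distxx; lia.
(* The radius bounds the difference of heights between a and a farthest vertex
   w of the k-th piece. *)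
have too_far a : a \in S -> (height k a).+1 < (eccentricity (v_ k)) + 3 - r.*2 -> False.
  move=> aS; have := height_radius k aS (all_S w w_in).
  by rewrite height_emb // eqxx e_w rad_r; lia.
have only_k k' (t : T_ k') : t \in inner k' -> emb t \in S -> k' = k.
  move=> t_in tS; apply/eqP; apply: contraT => neq_k.
  have [t' [t'_in t'S d_t']] := inner_depth_two t_in tS.
  exfalso; apply: (too_far _ t'S); rewrite height_emb // (negPf neq_k).
  by move: d_t' ge_ecc r_gt1; clear; lia.
have root_in : hub \in S := closedS.1.
pose J := [set l | pendant l \in S].
have S_E a : a \in S <-> [\/ a = hub, exists t : T_ k, t \in inner k /\ a = emb t
                                | exists2 l, l \in J & a = pendant l].
  split=> [aS|[->|[t [t_in ->]]|[l]]]; last first.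
  - by rewrite inE => lS ->.
  - exact: all_S.
  - by [].
  case: (glue_cases a) => [->|[l e_a]|[k' [t [t_in e_a]]]].
  - by constructor 1.
  - by constructor 3; exists l; rewrite // inE -e_a.
  - have tS : emb t \in S by rewrite -e_a.
    have e_k := only_k k' t t_in tS; subst k'; by constructor 2; exists t.
have [J0|J_neq0] := eqVneq J set0.
  have [c _] := goodT; apply: graph_iso_good goodT.
  apply: (@attach_iso k (T_ k) (v_ k) set0 id c S) => //.
  - by rewrite inE.
  - by move=> u' _ neq; rewrite innerE.
  - by move=> t t_in; exists t; rewrite inE -innerE.
  - by move=> u' t; rewrite inE.
  - by move=> x y; rewrite inE.
  - move=> a; rewrite S_E; split=> [] [->|[t [t_in ->]]|[l]].
    + by constructor 1.
    + by constructor 2; exists t.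
    + by rewrite J0 inE.
    + by constructor 1.
    + by constructor 2; exists t.
    + by rewrite inE => -[].
have j_gt0 : 0 < #|J| by rewrite card_gt0.
have le_jD : #|J| <= D by rewrite -[leqRHS]card_ord max_card.
have lt_ecc : eccentricity (v_ k) < r.*2.
  rewrite ltnNge; apply/negP=> ge_2r; have [l lJ] := set0Pn _ J_neq0.
  apply: (too_far (pendant l)); first by move: lJ; rewrite inE.
  by rewrite /=; lia.
have good_G : good D (ext (v_ k) #|J|) by apply: ext_good; rewrite // j_gt0.
apply: graph_iso_good good_G.
pose g (a : ext (v_ k) #|J|) : T_ k := if a is inl t then t else v_ k.
pose lab (a : ext (v_ k) #|J|) : 'I_D :=
  if a is inr i then enum_val i else enum_val (Ordinal j_gt0).
have old_L t : (old (v_ k) #|J| t \in @new _ (v_ k) #|J| @: setT) = false.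
  by apply/negbTE/imsetP => -[].
have new_L i : new (v_ k) i \in @new _ (v_ k) #|J| @: setT by apply: imset_f.
apply: (@attach_iso k _ (old (v_ k) #|J| (v_ k)) (@new _ (v_ k) #|J| @: setT) g lab S) => //.
- by rewrite old_L.
- move=> a; case: (ext_cases a) => [[t ->] _|[i ->]]; last by rewrite new_L.
  by rewrite (inj_eq (@old_inj _ _ _)) innerE.
- move=> a b; case: (ext_cases a) => [[t ->] _|[i ->]]; last by rewrite new_L.
  case: (ext_cases b) => [[t' ->] _|[i ->]]; last by rewrite new_L.
  by rewrite /g /= => ->.
- move=> t t_in; exists (old (v_ k) #|J| t).
  by rewrite old_L (inj_eq (@old_inj _ _ _)) -innerE.
- move=> a b; case: (ext_cases a) => [[t ->] _|[i ->]]; last by rewrite new_L.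
  by case: (ext_cases b) => [[t' ->] _|[i ->]]; last by rewrite new_L.
- move=> a b /imsetP[i _ ->]; case: (ext_cases b) => [[t ->]|[i' ->]].
    by rewrite edge_new_old (inj_eq (@old_inj _ _ _)).
  by rewrite edge_new_new; apply/esym/negbTE/eqP.
- by move=> a b /imsetP[i _ ->] /imsetP[i' _ ->] /enum_val_inj ->.
- move=> a; rewrite S_E; split=> [] [->|[t [t_in ->]]|].
  + by constructor 1.
  + by constructor 2; exists t.
  + move=> [l lJ ->]; constructor 3; exists (new (v_ k) (enum_rank_in lJ l)).
    by rewrite /lab /= enum_rankK_in.
  + by constructor 1.
  + by constructor 2; exists t.
  + move=> [_ [/imsetP[i _ ->] ->]]; constructor 3.
    by exists (enum_val i) => //; apply: enum_valP.
Qed.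

End ClosedSet.

End Glue.

(** * The universal tree *)

(** A good tree of radius at most [r] has at most [size_bound D r] vertices, so there
    are finitely many of them up to isomorphism. *)
Lemma pointed_reps D r : 1 < D -> 0 < r ->
  exists (n : nat) (T_ : 'I_n -> sgraph) (v_ : forall k, T_ k),
    (forall k, well_rooted D r (v_ k)) /\
    forall T : sgraph, is_tree T -> good D T -> radius T <= r ->
      exists k, graph_iso T (T_ k).
Proof.
move=> D_gt1 r_gt0; have D_gt0 := ltnW D_gt1.
have [reps repsE] := finite_reps (size_bound D r).
pose P (T : sgraph) := [/\ is_tree T, good D T & radius T <= r].
have [L [rootedL coverL]] : exists L : seq {T : sgraph & T},
    (forall x, List.In x L -> well_rooted D r (projT2 x)) /\
    (forall H, List.In H reps -> P H -> exists v : H, List.In (existT (fun T : sgraph => T : Type) H v) L).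
  elim: reps {repsE} => [|H reps [L [rootedL coverL]]]; first by exists [::].
  case: (classic (P H)) => [[treeH goodH radH]|notP].
    have [v rooted_v] := root_choice D_gt1 treeH goodH radH.
    exists (existT _ H v :: L); split=> [x [<- //|/rootedL //]|H' [<- _|H'_in /(coverL _ H'_in)[v' v'_in]]].
      by exists v; left.
    by exists v'; right.
  by exists L; split=> // H' [<- /notP //|]; apply: coverL.
have in_nth (s : seq {T : sgraph & T}) x d : List.In x s -> exists2 i, i < size s & nth d s i = x.
  elim: s => //= y s IHs [<-|/IHs[i lt_i <-]]; first by exists 0.
  by exists i.+1.
have nth_in (s : seq {T : sgraph & T}) d i : i < size s -> List.In (nth d s i) s.
  by elim: s i => //= y s IHs [_|i lt_i]; [left | right; apply: IHs].
pose d : {T : sgraph & T} :=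
  existT (fun T : sgraph => T : Type) (mx_graph [ffun _ : 'I_1 * 'I_1 => false]) ord0.
exists (size L), (fun k => projT1 (nth d L k)), (fun k => projT2 (nth d L k)); split.
  by move=> k; apply/rootedL/nth_in.
move=> T treeT goodT radT; have [c [_ [dist_c _]]] := goodT.
have [z e_z] := radius_attained treeT.1.
have le_T : #|T| <= size_bound D r.
  apply: leq_trans (card_tree treeT dist_c z) _; apply: size_bound_mono => //.
  by rewrite e_z.
have [H H_in isoH] := repsE T le_T.
have PH : P H.
  split; [exact: graph_iso_tree isoH treeT | exact: graph_iso_good isoH goodT |].
  exact: leq_trans (graph_iso_radius isoH treeT.1 (graph_iso_tree isoH treeT).1) radT.
have [v v_in] := coverL H H_in PH; have [i lt_i e_i] := in_nth _ _ d v_in.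
by exists (Ordinal lt_i); rewrite /= e_i.
Qed.

Theorem theorem10 (D r : nat) (hD : 2 <= D) (hr : 0 < r) :
  exists (U : sgraph) (x : U),
    [/\ is_tree U,
        forall T : sgraph,
          is_tree T -> distinguishable D T -> radius T <= r ->
          paint_cost D T = fixing_number T ->
          exists S : {set U}, branched_subgraph x S /\ graph_iso T (induced S)
      & 2 <= r ->
        forall S : {set U},
          branched_subgraph x S -> radius (induced S) = r ->
          distinguishable D (induced S) /\
          paint_cost D (induced S) = fixing_number (induced S)].
Proof.
have D_gt0 := ltnW hD.
have [n [T_ [v_ [rooted cover]]]] := pointed_reps hD hr.
have tree_ k : is_tree (T_ k) by case: (rooted k).
have treeU := glue_tree D v_ tree_.
exists (glue D v_), (hub D v_); split=> // [T treeT dist_T radT costT|r_gt1 S].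
  have goodT : good D T by apply/goodP.
  have [k isoT] := cover T treeT goodT radT.
  have [_ le_D _] := rooted k.
  have [S [closedS isoS]] := piece_represented D_gt0 le_D.
  exists S; split; first exact/branched_subgraphP.
  exact: graph_iso_trans isoT isoS.
move/(branched_subgraphP (hub D v_) treeU)=> closedS rad_r; apply/goodP => //.
exact: (closed_good tree_ closedS r_gt1 rooted rad_r).
Qed.
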